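(* The edge-transitive maps with free edges are, up to isomorphism: (i) the maps $\mathcal{A}_n$ and $\mathcal{A}_n^\circ$ for $n\in\mathbb{N}\cup\{\infty\}$, together with $\mathcal{N}(1)$, $\mathcal{N}(2^* )$, $\mathcal{N}(2^P)$ and $\mathcal{D}$, all in class $1$; (ii) the maps $\mathcal{M}_{2^*,0}$ and $\mathcal{M}_{2^P,0}$, in classes $2^*$ and $2^P$ respectively. They are all on the closed disc, apart from the maps $\mathcal{A}_n^\circ$, which are on the sphere. Their automorphism groups are all dihedral groups, apart from $\mathrm{Aut}\,\mathcal{N}(1)$, which is the identity group.
   Context: Let $\Gamma=\langle R_0,R_1,R_2\mid R_i^2=(R_0R_2)^2=1\rangle$ and $E=\langle R_0,R_2\rangle\cong V_4$. A (connected) map $\mathcal{M}$ (possibly non-orientable, non-compact, or with non-empty boundary) is identified, up to isomorphism, with a transitive permutation representation of $\Gamma$ on a set $\Phi$ of flags, or equivalently with a conjugacy class of subgroups $M\le\Gamma$ (its map subgroups, the stabilisers of flags). Vertices, edges and faces are the orbits on $\Phi$ of $\langle R_1,R_2\rangle$, $\langle R_0,R_2\rangle$ and $\langle R_0,R_1\rangle$. $\mathrm{Aut}\,\mathcal{M}$ is the centraliser of $\Gamma$ in $\mathrm{Sym}\,\Phi$, isomorphic to $N_\Gamma(M)/M$. The map is edge-transitive if $\mathrm{Aut}\,\mathcal{M}$ is transitive on edges, equivalently $\Gamma=N_\Gamma(M)E$. A free edge (also called a semi-edge or half-edge) is an edge whose flags are fixed by $R_0$ (its free end is on the boundary) or by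 $R_0R_2$ (its free end is in the interior). Let $N(1)=\Gamma$; let $N(2)$, $N(2^* )$, $N(2^P)$ be the subgroups of index $2$ in $\Gamma$ containing, among $R_0,R_1,R_2$, exactly $R_1,R_2$, exactly $R_0,R_1$, and exactly $R_1$, respectively. $\mathcal{N}(T)$ denotes the map with map subgroup $N(T)$. For $T=1,2^*,2^P$, a map is in class $T$ if its map subgroups satisfy $N_\Gamma(M)=N(T)$ (so class $1$ consists of the regular maps). The maps named are as follows. $\mathcal{A}_n$ (finite $n\ge 1$) embeds in the closed disc a semi-star: one interior vertex with $n$ free edges joining it to the boundary; $\mathcal{A}_\infty$ embeds a semi-star of countably infinite valency in the closed disc. The map subgroup of $\mathcal{A}_n$ is the normal closure in $\Gamma$ of $R_0$ and $(R_1R_2)^n$ (of $R_0$ alone if $n=\infty$). $\mathcal{A}_n^\circ$ is the spherical map obtained from $\mathcal{A}_n$ by embedding the disc in the sphere (one vertex, $n$ free edges with interior free ends, one face); its map subgroup is the normal closure in $\Gamma$ of $R_0R_2$ and $(R_1R_2)^n$ (of $R_0R_2$ alone if $n=\infty$). $\mathcal{D}$ embeds one vertex and two half-edges along the boundary of the closed disc; its map subgroup is the normal closure of $R_0$ and $R_2$ in $\Gamma$. $\mathcal{M}_{2^*,0}$ has a single vertex on the boundary of the closed disc and two free edges crossing the interior to two other boundary points; its map subgroup is the normal closure of $R_1$ and $R_0$ in $N(2^* )$. $\mathcal{M}_{2^P,0}$ has a single vertex on the boundary of the closed disc, two free edges ending in the interior, and one face; its map subgroup is the normal closure of $R_1$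 and $R_0R_2$ in $N(2^P)$. Dihedral groups $D_n$ (of order $2n$) include $D_1\cong C_2$, $D_2\cong V_4$ and $D_\infty\cong C_2*C_2$. $\mathbb{N}=\{1,2,\ldots\}$. *)

(* Defs.v *)
From HB Require Import structures.
From mathcomp Require Import all_boot all_order all_algebra.
From mathcomp Require Import all_classical all_reals all_analysis.
Import numFieldNormedType.Exports.

Set Implicit Arguments.
Unset Strict Implicit.
Unset Printing Implicit Defensive.

Import Order.TTheory GRing.Theory Num.Theory.

Local Open Scope classical_set_scope.
Local Open Scope quotient_scope.
Local Open Scope group_scope.

(* Groups given by generators and relators: the quotient of the words in the
   letters (i, false), read as i, and (i, true), read as the inverse of i, by
   the least congruence killing the relators and the words x x^-1. *)

Definition word (I : Type) := seq (I * bool).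

Definition inv_word (I : Type) (w : word I) : word I :=
  rev [seq (x.1, ~~ x.2) | x <- w].

Definition pos_word (I : Type) (s : seq I) : word I := [seq (i, false) | i <- s].

Inductive word_cong (I : Type) (rels : set (word I)) : word I -> word I -> Prop :=
| WcRefl w : word_cong rels w w
| WcSym v w : word_cong rels v w -> word_cong rels w v
| WcTrans u v w : word_cong rels u v -> word_cong rels v w -> word_cong rels u w
| WcCat u u' v v' :
    word_cong rels u u' -> word_cong rels v v' -> word_cong rels (u ++ v) (u' ++ v')
| WcCancel i b : word_cong rels [:: (i, b); (i, ~~ b)] [::]
| WcRel r : rels r -> word_cong rels r [::].

Section Presentation.
Variables (I : choiceType) (rels : set (word I)).

Definition word_congb (v w : word I) : bool := `[< word_cong rels v w >].

Lemma word_congb_refl : reflexive word_congb.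
Proof. by move=> w; apply/asboolP; apply: WcRefl. Qed.

Lemma word_congb_sym : symmetric word_congb.
Proof. by move=> v w; apply/asboolP/asboolP; apply: WcSym. Qed.

Lemma word_congb_trans : transitive word_congb.
Proof. by move=> v u w /asboolP uv /asboolP vw; apply/asboolP; apply: WcTrans vw. Qed.

Canonical word_congb_equiv :=
  EquivRel word_congb word_congb_refl word_congb_sym word_congb_trans.

Definition presented := {eq_quot word_congb}.

HB.instance Definition _ := Choice.on presented.

Definition pres_class (w : word I) : presented := \pi_({eq_quot word_congb}) w.

Lemma pres_classP v w : pres_class v = pres_class w <-> word_cong rels v w.
Proof. by split => [/eqmodP/asboolP|vw] //; apply/eqmodP/asboolP. Qed.

Lemma word_cong_repr w : word_cong rels (repr (pres_class w)) w.
Proof. by apply/pres_classP; rewrite /pres_class reprK. Qed.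

Definition pres_one : presented := pres_class [::].
Definition pres_mul (x y : presented) : presented := pres_class (repr x ++ repr y).
Definition pres_inv (x : presented) : presented := pres_class (inv_word (repr x)).

Lemma pres_classE (x : presented) : exists w, x = pres_class w.
Proof. by exists (repr x); rewrite /pres_class reprK. Qed.

Lemma pres_mulE v w : pres_mul (pres_class v) (pres_class w) = pres_class (v ++ w).
Proof. by apply/pres_classP; apply: WcCat; apply: word_cong_repr. Qed.

Lemma word_cong_mulV w : word_cong rels (w ++ inv_word w) [::].
Proof.
elim: w => [|[i b] w IHw]; first exact: WcRefl.
have -> : ((i, b) :: w) ++ inv_word ((i, b) :: w) =
    [:: (i, b)] ++ ((w ++ inv_word w) ++ [:: (i, ~~ b)]).
  by rewrite /inv_word /= rev_cons -cats1 catA.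
apply: WcTrans (WcCancel _ i b).
apply: (WcCat (u' := [:: (i, b)]) (v' := [::] ++ [:: (i, ~~ b)])).
  exact: WcRefl.
by apply: WcCat => //; exact: WcRefl.
Qed.

Lemma inv_wordK : involutive (@inv_word I).
Proof.
move=> w; rewrite /inv_word map_rev revK -map_comp -[RHS]map_id.
by apply: eq_map => -[i b] /=; rewrite negbK.
Qed.

Lemma word_cong_Vmul w : word_cong rels (inv_word w ++ w) [::].
Proof. by rewrite -{2}[w]inv_wordK; apply: word_cong_mulV. Qed.

Lemma pres_mulA : associative pres_mul.
Proof.
move=> x y z; have [[u ->] [v ->] [w ->]] :=
  And3 (pres_classE x) (pres_classE y) (pres_classE z).
by rewrite !pres_mulE catA.
Qed.

Lemma pres_mul1g : left_id pres_one pres_mul.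
Proof. by move=> x; have [w ->] := pres_classE x; rewrite pres_mulE. Qed.

Lemma pres_mulg1 : right_id pres_one pres_mul.
Proof. by move=> x; have [w ->] := pres_classE x; rewrite pres_mulE cats0. Qed.

Lemma pres_mulVg : left_inverse pres_one pres_inv pres_mul.
Proof.
move=> x; rewrite -{2}[x]reprK -/(pres_class _) pres_mulE.
by apply/pres_classP; apply: word_cong_Vmul.
Qed.

Lemma pres_mulgV : right_inverse pres_one pres_inv pres_mul.
Proof.
move=> x; rewrite -{1}[x]reprK -/(pres_class _) pres_mulE.
by apply/pres_classP; apply: word_cong_mulV.
Qed.

HB.instance Definition _ := isGroup.Build presented
  pres_mulA pres_mul1g pres_mulg1 pres_mulVg pres_mulgV.

Definition pres_gen (i : I) : presented := pres_class (pos_word [:: i]).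

End Presentation.

Definition isogroup (G H : groupType) : Prop :=
  exists f : {multiplicative G -> H}, bijective f.

(* The indices n in {1, 2, ...} together with infinity. *)
Inductive xnat := Fin (n : nat) of (0 < n)%N | Inf.

(* D_n = < a, b | a^2 = b^2 = (ab)^n = 1 >, with the last relation absent for
   n infinite; the generator a is true and b is false. *)
Definition dihedral_rels (n : xnat) : set (word bool) :=
  [set pos_word [:: true; true]; pos_word [:: false; false]] `|`
  (if n is @Fin k _ then [set pos_word (flatten (nseq k [:: true; false]))] else set0).

Definition dihedral (n : xnat) : groupType := presented (dihedral_rels n).

Notation i0 := (@Ordinal 3 0 isT).
Notation i1 := (@Ordinal 3 1 isT).
Notation i2 := (@Ordinal 3 2 isT).

Definition Gamma_rels : set (word 'I_3) :=
  [set pos_word [:: i0; i0]; pos_word [:: i1; i1]; pos_word [:: i2; i2];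
       pos_word [:: i0; i2; i0; i2]].

Definition Gamma : groupType := presented Gamma_rels.

Definition gen (i : 'I_3) : Gamma := pres_gen Gamma_rels i.

Notation R0 := (gen i0).
Notation R1 := (gen i1).
Notation R2 := (gen i2).

Section Subgroups.
Variable G : groupType.
Implicit Types H K A : set G.

Definition subgroup H : Prop :=
  [/\ H 1, (forall x y, H x -> H y -> H (x * y)) & (forall x, H x -> H x^-1)].

Definition generated A : set G := smallest subgroup A.

(* The normal closure of A in K, for A contained in the subgroup K. *)
Definition normal_closure K A : set G :=
  smallest (fun H => [/\ subgroup H, H `<=` K &
                         forall h k, H h -> K k -> H (h ^ k)]) A.

Definition normaliser H : set G := [set g | forall h, H h <-> H (h ^ g)].

Definition rcoset H (g : G) : set G := [set h * g | h in H].

Definition rcosets H : set (set G) := [set rcoset H g | g in [set: G]].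

End Subgroups.

Definition index2 (J : set 'I_3) : set (set Gamma) :=
  [set H | [/\ subgroup H, (rcosets H #= `I_2)%card & forall i, H (gen i) <-> J i]].

(* The subgroup of index 2 containing, among the R_i, exactly those with i in J;
   it exists and is unique for every proper subset J. *)
Definition N (J : set 'I_3) : set Gamma := xget set0 (index2 J).

Definition N1 : set Gamma := [set: Gamma].
Definition N2star : set Gamma := N [set i0; i1].
Definition N2P : set Gamma := N [set i1].

(* A connected map: a transitive permutation representation of Gamma, acting
   on the right on the set of flags. *)
Record Map := MkMap {
  flag :> Type;
  act : flag -> Gamma -> flag;
  act1 : forall x, act x 1 = x;
  actM : forall x g h, act x (g * h) = act (act x g) h;
  flag_inhabited : inhabited flag;
  act_transitive : forall x y, exists g, act x g = y
}.

Definition isomorphic (M M' : Map) : Prop :=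
  exists f : M -> M', bijective f /\ forall x g, f (act x g) = act (f x) g.

Definition flag_orbit (M : Map) (A : set Gamma) (x : M) : set M := [set act x g | g in A].

Definition stabiliser (M : Map) (x : M) : set Gamma := [set g | act x g = x].

Definition edge (M : Map) : set (set M) :=
  [set flag_orbit (generated [set R0; R2]) x | x in [set: M]].

Definition free_edge (M : Map) (e : set M) : Prop :=
  edge e /\ ((forall x, e x -> act x R0 = x) \/ (forall x, e x -> act x (R0 * R2) = x)).

Definition has_free_edge (M : Map) : Prop := exists e : set M, free_edge e.

(* T is one of N1, N2star, N2P; the map subgroups are the stabilisers of flags. *)
Definition in_class (T : set Gamma) (M : Map) : Prop :=
  forall x : M, normaliser (stabiliser x) = T.

Section Automorphisms.
Variable M : Map.

Definition is_aut (f : M -> M) : Prop :=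
  bijective f /\ forall x g, f (act x g) = act (f x) g.

Definition Aut : Type := {f : M -> M | `[< is_aut f >]}.
HB.instance Definition _ := gen_eqMixin Aut.
HB.instance Definition _ := gen_choiceMixin Aut.

Lemma is_aut_id : `[< is_aut id >].
Proof. by apply/asboolP; split => //; exists id. Qed.

Lemma is_aut_comp (f g : Aut) : `[< is_aut (val f \o val g) >].
Proof.
apply/asboolP; have [/asboolP[bf cf] /asboolP[bg cg]] := (valP f, valP g).
by split => [|x h /=]; [apply: bij_comp|rewrite cg cf].
Qed.

Lemma aut_inv_exists (f : Aut) :
  exists g : Aut, cancel (val f) (val g) /\ cancel (val g) (val f).
Proof.
have /asboolP[[g fK gK] cf] := valP f.
suff ag : `[< is_aut g >] by exists (exist _ g ag).
apply/asboolP; split => [|x h]; first by exists (val f).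
by apply: (can_inj fK); rewrite cf !gK.
Qed.

Definition aut_one : Aut := exist _ id is_aut_id.
Definition aut_mul (f g : Aut) : Aut := exist _ (val f \o val g) (is_aut_comp f g).
Definition aut_inv (f : Aut) : Aut := projT1 (cid (aut_inv_exists f)).

Lemma aut_mulA : associative aut_mul. Proof. by move=> f g h; apply: val_inj. Qed.
Lemma aut_mul1g : left_id aut_one aut_mul. Proof. by move=> f; apply: val_inj. Qed.
Lemma aut_mulg1 : right_id aut_one aut_mul. Proof. by move=> f; apply: val_inj. Qed.

Lemma aut_mulVg : left_inverse aut_one aut_inv aut_mul.
Proof.
move=> f; apply: val_inj; apply/funext => x /=.
by rewrite /aut_inv; case: cid => g [fK gK] /=; apply: fK.
Qed.

Lemma aut_mulgV : right_inverse aut_one aut_inv aut_mul.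
Proof.
move=> f; apply: val_inj; apply/funext => x /=.
by rewrite /aut_inv; case: cid => g [fK gK] /=; apply: gK.
Qed.

HB.instance Definition _ := isGroup.Build Aut
  aut_mulA aut_mul1g aut_mulg1 aut_mulVg aut_mulgV.

Definition edge_transitive : Prop :=
  forall e e', edge e -> edge e' -> exists f : Aut, val f @` e = e'.

End Automorphisms.

(* The map with map subgroup H: Gamma acts by right multiplication on the
   right cosets of the subgroup H, and the flag H has stabiliser H. *)
Section CosetMap.
Variable H : set Gamma.

Definition coset_flag : Type := {A : set Gamma | A \in rcosets H}.

Lemma rcosetM g h : [set x * h | x in rcoset H g] = rcoset H (g * h).
Proof.
apply/seteqP; split => [_ [_ [x Hx <-] <-]|_ [x Hx <-]]; last first.
  by exists (x * g); [exists x | rewrite mulgA].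
by exists x => //; rewrite mulgA.
Qed.

Lemma coset_act_subproof (A : coset_flag) (h : Gamma) :
  [set x * h | x in val A] \in rcosets H.
Proof.
have /set_mem[g _ <-] := valP A.
by rewrite rcosetM; apply/mem_set; exists (g * h).
Qed.

Definition coset_act (A : coset_flag) (h : Gamma) : coset_flag :=
  exist _ [set x * h | x in val A] (coset_act_subproof A h).

Lemma coset_act1 A : coset_act A 1 = A.
Proof.
apply: val_inj => /=; apply/seteqP; split => [_ [x Ax <-]|x Ax].
  by rewrite mulg1.
by exists x; rewrite ?mulg1.
Qed.

Lemma coset_actM A g h : coset_act A (g * h) = coset_act (coset_act A g) h.
Proof.
have /set_mem[k _ AE] := valP A; apply: val_inj => /=.
by rewrite -AE !rcosetM mulgA.
Qed.

Lemma mem_rcoset g : rcoset H g \in rcosets H.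
Proof. by apply/mem_set; exists g. Qed.

Lemma coset_inhabited : inhabited coset_flag.
Proof. by constructor; exists (rcoset H 1); exact: mem_rcoset. Qed.

Lemma coset_transitive A B : exists g, coset_act A g = B.
Proof.
have [/set_mem[a _ AE] /set_mem[b _ BE]] := (valP A, valP B).
exists (a^-1 * b); apply: val_inj => /=.
by rewrite -AE rcosetM mulgA mulgV mul1g.
Qed.

Definition coset_map : Map :=
  MkMap coset_act1 coset_actM coset_inhabited coset_transitive.

End CosetMap.

(* nAcirc n stands for the map A_n with superscript circle, nM2star0 and nM2P0 for
   M_{2*,0} and M_{2^P,0}. *)
Inductive map_name :=
| nA of xnat | nAcirc of xnat | nN1 | nN2star | nN2P | nD | nM2star0 | nM2P0.

Definition rotation_power (n : xnat) : set Gamma :=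
  if n is @Fin k _ then [set (R1 * R2) ^+ k] else set0.

Definition map_subgroup (c : map_name) : set Gamma :=
  match c with
  | nA n => normal_closure [set: Gamma] ([set R0] `|` rotation_power n)
  | nAcirc n => normal_closure [set: Gamma] ([set R0 * R2] `|` rotation_power n)
  | nN1 => N1
  | nN2star => N2star
  | nN2P => N2P
  | nD => normal_closure [set: Gamma] [set R0; R2]
  | nM2star0 => normal_closure N2star [set R1; R0]
  | nM2P0 => normal_closure N2P [set R1; R0 * R2]
  end.

Definition named_map (c : map_name) : Map := coset_map (map_subgroup c).

(* The surface of a map. Each flag x is a triangle with barycentric coordinates
   (t_0, t_1, t_2), whose corners 0, 1, 2 lie at the vertex, the edge and the
   face of x, and side t_i = 0 of x is glued to the same side of x R_i. Hence
   (x, t) and (y, t) are identified when y is in the orbit of x under the R_i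
   with t_i = 0. *)
Section Surface.
Variables (R : realType) (M : Map).
Local Open Scope ring_scope.

Definition simplex : set 'rV[R]_3 :=
  [set t | (forall i, 0 <= t ord0 i) /\ \sum_i t ord0 i = 1].

Definition glue_orbit (x : M) (t : 'rV[R]_3) : set M :=
  flag_orbit (generated [set gen i | i in [set i | t ord0 i = 0]]) x.

(* Where infinitely many triangles meet (at the centre of a vertex of infinite
   valency or of a face with infinitely many flags) the complex is not locally
   finite. It is a surface, with or without boundary, at all the other points. *)
Definition ordinary (x : M) : set 'rV[R]_3 :=
  [set t | simplex t /\ finite_set (glue_orbit x t)].

(* The centre of a face with infinitely many flags is an ideal point, and is
   omitted; vertices of infinite valency belong to the embedded graph. *)
Definition realised (x : M) : set 'rV[R]_3 :=
  [set t | simplex t /\ (t ord0 i2 = 1 -> finite_set (glue_orbit x t))].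

(* M is a map on the space S, a subset of X with the induced topology: S is
   covered by triangles p x, glued exactly as prescribed, so that the locally
   finite part of the complex is embedded homeomorphically as an open subset of
   S. At a vertex of infinite valency p is only required to be continuous on
   each triangle. If M is finite then p identifies S with the quotient space of
   the disjoint union of all the triangles. *)
Definition lies_on (X : topologicalType) (S : set X) : Prop :=
  exists p : M -> 'rV[R]_3 -> X,
  [/\ forall x, {within realised x, continuous (p x)},
      \bigcup_(x in [set: M]) (p x @` realised x) = S,
      forall x y s t, realised x s -> realised y t ->
        (p x s = p y t <-> s = t /\ glue_orbit x s y) &
      forall W : M -> set 'rV[R]_3,
        (forall x, exists2 O, open O & W x = O `&` ordinary x) ->
        (forall x y t, W x t -> glue_orbit x t y -> W y t) ->
        exists2 O, open O & \bigcup_(x in [set: M]) (p x @` W x) = O `&` S].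

End Surface.

Definition closed_disc (R : realType) : set (R * R)%type :=
  [set z | z.1 ^+ 2 + z.2 ^+ 2 <= 1]%R.

Definition sphere (R : realType) : set (R * R * R)%type :=
  [set z | z.1.1 ^+ 2 + z.1.2 ^+ 2 + z.2 ^+ 2 = 1]%R.

Arguments closed_disc : clear implicits.
Arguments sphere : clear implicits.

(* Main.v *)
Require Import Defs.
From HB Require Import structures.
From mathcomp Require Import all_boot all_order all_algebra.
From mathcomp Require Import all_classical all_reals all_analysis.
From mathcomp Require Import zify ring lra.
Import numFieldNormedType.Exports.

Set Implicit Arguments.
Unset Strict Implicit.
Unset Printing Implicit Defensive.

Import Order.TTheory GRing.Theory Num.Theory.

Local Open Scope classical_set_scope.
Local Open Scope group_scope.

(** In an edge-transitive map all edges look alike, so if one edge is free then R0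
    fixes every flag, or R0 R2 does.  Either way the flags form a transitive set
    for the group generated by the two involutions R1 and R2.  Such a set is a
    row: picture a flag as a unit segment [k, k + 1] of the line, with R2 acting as
    the reflection in its even end point and R1 as the reflection in its odd end
    point.  A row is closed with 2n segments, or is the whole line, or ends in
    walls where a reflection fixes the last flag.  These rows are the [chain]s
    below.

    Classification. Edges are the orbits of R2. If R2 fixes one flag it fixes all
    of them, and there are one or two flags. Otherwise, if R1 fixes a flag, the
    row starts at a wall, and as every edge is the image of the first one there is
    a wall at one end of each edge: the row has one edge or two. If there are no
    fixed flags the row is closed or infinite. This gives the chains of the list,
    and conversely each map subgroup of the list is the stabiliser of a flag in
    the corresponding chain: it is contained in the stabiliser because its
    generators act as required, and it contains the stabiliser because it contains
    the Schreier generators for the transversal of alternating words in R1 and R2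
    ([map_subgroup_chain]); a subgroup of index 2 is determined by the generators
    in it, since it consists of the words with an even number of the others. The
    maps are told apart by which of R0, R1, R2 act trivially, by whether R1 fixes
    a flag, and by the least trivial power of R1 R2.

    Automorphisms.  An automorphism is determined by the image of one flag, which
    can be any flag with the same stabiliser.  In a closed or infinite row all
    flags have the same stabiliser, and the automorphisms taking the first flag to
    its images under R1 and R2 satisfy the dihedral relations and no others.  In
    the rows with walls and more than one flag exactly two flags share each
    stabiliser, because the reversal of the row is the only symmetry.

    Surfaces.  If R0 fixes all flags then the triangles of a row form a fan about
    their common vertex; if R0 acts as R2 they form a row of lunes between the
    vertex and the centre of the face.  In both cases a point has a height h and a
    position u along the row, its triangle has width w(h) at that height, and the
    poles are the points with w(h) = 0.  Points of two triangles are identified if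
    and only if they have the same height and the same position up to the period
    of the row ([chart_inj]).  Hence the surface of a chain can be given by a
    single map Q of the pair (u, h) ([lies_on_swept]).  Where finitely many
    triangles suffice the image of an open set is open by compactness; for infinite
    rows this only requires that points near a given ordinary point come from
    bounded u and from widths bounded below.  The six maps Q are: polar coordinates
    for a closed row in the disc and cylindrical coordinates in the sphere; for
    rows with walls half of these, that is a half disc stretched to a disc, and
    half a sphere seen from the side; and for the infinite rows the Cayley
    transform of a half plane and the stereographic projection of a plane, which
    put the vertex of infinite valency at infinity. *)

(** * Presented groups *)

Section Presented.
Variables (I : choiceType) (rels : set (word I)).
Local Notation G := (presented rels).

Lemma pres_class_mul (v w : word I) :
  pres_class rels v * pres_class rels w = pres_class rels (v ++ w).
Proof. exact: pres_mulE. Qed.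

Lemma pres_class_letter (i : I) b :
  pres_class rels [:: (i, b)] =
  (if b then (pres_gen rels i)^-1 else pres_gen rels i) :> G.
Proof.
case: b => //; apply/esym/mulg1_eq.
rewrite /pres_gen pres_class_mul; apply/pres_classP.
exact: (@WcCancel I rels i false).
Qed.

Lemma presented_ind (P : G -> Prop) :
  P 1 -> (forall x i, P x -> P (x * pres_gen rels i)) ->
  (forall x i, P x -> P (x * (pres_gen rels i)^-1)) -> forall x, P x.
Proof.
move=> P1 Pg PV x; have [w ->] := pres_classE x.
elim/last_ind: w => [|w [i b] IH]; first exact: P1.
rewrite -cats1 -pres_class_mul pres_class_letter.
by case: b; [apply: PV|apply: Pg].
Qed.

Variables (H : groupType) (f : I -> H).

Definition word_eval (w : word I) : H :=
  foldr (fun l h => (if l.2 then (f l.1)^-1 else f l.1) * h) 1 w.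

Lemma word_eval_cat v w : word_eval (v ++ w) = word_eval v * word_eval w.
Proof. by elim: v => [|l v IH] /=; rewrite ?mul1g // IH mulgA. Qed.

Hypothesis f_rels : forall r, rels r -> word_eval r = 1.

Lemma word_eval_cong v w : word_cong rels v w -> word_eval v = word_eval w.
Proof.
elim=> {v w} [w|v w _ ->|u v w _ -> _ ->|u u' v v' _ IHu _ IHv|i [] /=|r /f_rels ->] //.
- by rewrite !word_eval_cat IHu IHv.
- by rewrite mulg1 mulVg.
- by rewrite mulg1 mulgV.
Qed.

(** The universal property of a presented group. *)
Definition pres_lift (x : G) : H := word_eval (repr x).

Lemma pres_liftE w : pres_lift (pres_class rels w) = word_eval w.
Proof. exact/word_eval_cong/word_cong_repr. Qed.

Lemma pres_lift_gen i : pres_lift (pres_gen rels i) = f i.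
Proof. by rewrite pres_liftE /= mulg1. Qed.

Lemma pres_liftM : {morph pres_lift : x y / x * y}.
Proof.
move=> x y; have [v ->] := pres_classE x; have [w ->] := pres_classE y.
by rewrite pres_class_mul !pres_liftE word_eval_cat.
Qed.

End Presented.

Lemma isogroup_sym (G H : groupType) : isogroup G H -> isogroup H G.
Proof.
move=> [f [g fK gK]].
have gM : {morph g : x y / x * y}.
  by move=> x y; apply: (can_inj fK); rewrite gmulfM !gK.
pose gm := isMultiplicative.Build H G g gM.
by exists (HB.pack_for {multiplicative H -> G} g gm); exists f.
Qed.

Lemma isogroup_morph (G H : groupType) (f : G -> H) :
  {morph f : x y / x * y} -> bijective f -> isogroup G H.
Proof.
move=> fM bf; pose fm := isMultiplicative.Build G H f fM.
by exists (HB.pack_for {multiplicative G -> H} f fm).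
Qed.

Lemma ord3_ind (P : 'I_3 -> Prop) : P i0 -> P i1 -> P i2 -> forall i, P i.
Proof.
move=> P0 P1 P2 [[|[|[|//]]] ?].
- by rewrite (_ : Ordinal _ = i0) //; apply: val_inj.
- by rewrite (_ : Ordinal _ = i1) //; apply: val_inj.
- by rewrite (_ : Ordinal _ = i2) //; apply: val_inj.
Qed.

Lemma gen_sq i : gen i * gen i = 1.
Proof.
rewrite /gen /pres_gen pres_class_mul; apply/pres_classP/WcRel.
elim/ord3_ind: i => /=.
- by left; left; left.
- by left; left; right.
- by left; right.
Qed.

Lemma genV i : (gen i)^-1 = gen i.
Proof. exact: mulg1_eq (gen_sq i). Qed.

Lemma gen02_sq : R0 * R2 * (R0 * R2) = 1.
Proof.
rewrite /gen /pres_gen [pres_class _ _ * pres_class _ (pos_word [:: i2])]pres_class_mul.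
by rewrite pres_class_mul; apply/pres_classP/WcRel; right.
Qed.

Lemma gen02_comm : R0 * R2 = R2 * R0.
Proof. by rewrite -(mulg1_eq gen02_sq) invgM !genV. Qed.

Lemma Gamma_ind (P : Gamma -> Prop) :
  P 1 -> (forall g i, P g -> P (g * gen i)) -> forall g, P g.
Proof.
move=> P1 Pg; apply: presented_ind => // g i Pgg.
by rewrite -/(gen i) genV; apply: Pg.
Qed.

Arguments act {m} x g : simpl never.

(** * Maps, flag stabilisers and automorphisms *)

Lemma inj_surj_bij (A B : Type) (f : A -> B) :
  injective f -> (forall y, exists x, f x = y) -> bijective f.
Proof.
move=> fI fS; exists (fun y => projT1 (cid (fS y))) => [x|y].
  by apply: fI; case: cid.
by case: cid.
Qed.

Section Generated.
Variable G : groupType.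

Lemma sub_generated (A : set G) : A `<=` generated A.
Proof. exact: sub_gen_smallest. Qed.

Lemma generated_subgroup (A : set G) : subgroup (generated A).
Proof.
split=> [H [[]] //|x y Hx Hy H [sH sA]|x Hx H [sH sA]].
- by case: (sH) => _ + _; apply; [apply: Hx|apply: Hy].
- by case: (sH) => _ _; apply; apply: Hx.
Qed.

Lemma generated_sub (A H : set G) : subgroup H -> A `<=` H -> generated A `<=` H.
Proof. by move=> sH sA; apply: smallest_sub. Qed.

End Generated.

Lemma generated02P g :
  generated [set R0; R2] g <-> [\/ g = 1, g = R0, g = R2 | g = R0 * R2].
Proof.
split=> [|gE]; last first.
  have [g1 gM _] := generated_subgroup [set R0; R2].
  have E0 : generated [set R0; R2] R0 by apply: sub_generated; left.
  have E2 : generated [set R0; R2] R2 by apply: sub_generated; right.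
  by case: gE => -> //; apply: gM.
move: g; apply: generated_sub => [|_ [] ->]; last 2 first.
- exact: Or42.
- exact: Or43.
have s0 := gen_sq i0; have s2 := gen_sq i2; have c := gen02_comm.
have a0 x : R0 * (R0 * x) = x by rewrite mulgA s0 mul1g.
have a2 x : R2 * (R2 * x) = x by rewrite mulgA s2 mul1g.
have c2 x : R2 * (R0 * x) = R0 * (R2 * x) by rewrite mulgA -c mulgA.
split=> [|x y|x]; first exact: Or41.
  case=> -> [] ->; rewrite ?mul1g ?mulg1 -?mulgA ?a0 ?a2 ?s0 ?s2 ?c2 ?a0 ?a2 -?c ?s2 ?mulg1;
  by [exact: Or41|exact: Or42|exact: Or43|exact: Or44].
case=> ->; rewrite ?invgM ?genV ?invg1 -?c;
  by [exact: Or41|exact: Or42|exact: Or43|exact: Or44].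
Qed.

Section MapTheory.
Implicit Types M : Map.

Lemma act_gen2 M (x : M) i : act (act x (gen i)) (gen i) = x.
Proof. by rewrite -actM gen_sq act1. Qed.

Lemma actK M (x : M) g : act (act x g) g^-1 = x.
Proof. by rewrite -actM mulgV act1. Qed.

Lemma actVK M (x : M) g : act (act x g^-1) g = x.
Proof. by rewrite -actM mulVg act1. Qed.

Lemma flag_ind M (x0 : M) (P : M -> Prop) :
  P x0 -> (forall x i, P x -> P (act x (gen i))) -> forall x, P x.
Proof.
move=> P0 Pi x; have [g <-] := act_transitive x0 x.
by elim/Gamma_ind: g => [|g i IH]; rewrite ?act1 // actM; apply: Pi.
Qed.

Lemma flag_orbit_ind M (A : set Gamma) (P : M -> Prop) (x : M) :
  P x -> (forall g y, A g -> P (act y g) <-> P y) ->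
  forall y, flag_orbit (generated A) x y -> P y.
Proof.
move=> Px PA _ [g Ag <-].
suff /(_ g Ag x) [_ +] : generated A `<=` [set g | forall y, P (act y g) <-> P y].
  by apply.
apply: generated_sub => [|h Ah y]; last exact: PA.
split=> [y|h k hP kP y|h hP y]; first by rewrite act1.
  by rewrite actM; split=> [/kP/hP|/hP/kP].
by split=> [|Py]; [move/hP; rewrite actVK|apply/hP; rewrite actVK].
Qed.

Definition equivariant M M' (f : M -> M') := forall x g, f (act x g) = act (f x) g.

Lemma equivariant_gen M M' (f : M -> M') :
  (forall x i, f (act x (gen i)) = act (f x) (gen i)) -> equivariant f.
Proof.
move=> fi x g; elim/Gamma_ind: g => [|g i IH]; first by rewrite !act1.
by rewrite !actM fi IH.
Qed.

(** An equivariant map into a transitive set is onto. *)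
Lemma equivariant_iso M M' (f : M -> M') :
  equivariant f -> injective f -> isomorphic M M'.
Proof.
move=> fe fI; exists f; split=> //; apply: inj_surj_bij => // y.
have [x] := flag_inhabited M.
by have [g <-] := act_transitive (f x) y; exists (act x g).
Qed.

Lemma isomorphic_sym M M' : isomorphic M M' -> isomorphic M' M.
Proof.
move=> [f [[g fK gK] fe]]; exists g; split=> [|y h]; first by exists f.
by apply: (can_inj fK); rewrite fe !gK.
Qed.

Lemma isomorphic_trans M M' M'' :
  isomorphic M M' -> isomorphic M' M'' -> isomorphic M M''.
Proof.
move=> [f [bf fe]] [g [bg ge]]; exists (g \o f); split; first exact: bij_comp.
by move=> x h /=; rewrite fe ge.
Qed.

Lemma stabiliser_inj M M' (f : M -> M') x :
  equivariant f -> injective f -> stabiliser (f x) = stabiliser x.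
Proof.
move=> fe fI; apply/seteqP; split=> g; rewrite /stabiliser /= -fe; first exact: fI.
by move=> ->.
Qed.

Lemma stabiliser_act M (x : M) g h :
  stabiliser (act x g) (h ^ g) <-> stabiliser x h.
Proof.
rewrite /stabiliser /= conjgE -!actM !mulgA mulgV mul1g !actM; split=> [|->] //.
by move/(congr1 (fun y => act y g^-1)); rewrite !actK.
Qed.

(** The flags are the cosets of any one of their stabilisers, so that two flags
    with the same stabiliser are interchangeable. *)
Lemma stabiliser_iso M M' (x : M) (x' : M') :
  stabiliser x = stabiliser x' ->
  exists f : M -> M', [/\ bijective f, equivariant f & f x = x'].
Proof.
move=> xx'.
have gP y : exists g, act x g = y by apply: act_transitive.
pose f y := act x' (projT1 (cid (gP y))).
have fE g : f (act x g) = act x' g.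
  rewrite /f; case: cid => h /= hg.
  have : stabiliser x (h * g^-1) by rewrite /stabiliser /= actM hg actK.
  by rewrite xx' /stabiliser /= actM => {2}<-; rewrite actVK.
exists f; split.
- apply: inj_surj_bij => [y z|y].
    have [g <-] := gP y; have [h <-] := gP z; rewrite !fE => gh.
    have : stabiliser x' (g * h^-1) by rewrite /stabiliser /= actM gh actK.
    by rewrite -xx' /stabiliser /= actM => {2}<-; rewrite actVK.
  by have [g <-] := act_transitive x' y; exists (act x g).
- by move=> y h; have [g <-] := gP y; rewrite -actM !fE actM.
- by rewrite -{1}[x]act1 fE act1.
Qed.

Lemma aut_equivariant M (f : Aut M) : equivariant (val f).
Proof. by case: (asboolP _ (valP f)). Qed.

Lemma aut_bij M (f : Aut M) : bijective (val f).
Proof. by case: (asboolP _ (valP f)). Qed.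

Lemma aut_eq M (f g : Aut M) x : val f x = val g x -> f = g.
Proof.
move=> fg; apply/val_inj/funext => y; have [h <-] := act_transitive x y.
by rewrite !aut_equivariant fg.
Qed.

Lemma aut_stabiliser M (f : Aut M) x : stabiliser (val f x) = stabiliser x.
Proof. by apply: stabiliser_inj (bij_inj (aut_bij f)); apply: aut_equivariant. Qed.

Lemma aut_exists M (x y : M) :
  stabiliser x = stabiliser y -> exists f : Aut M, val f x = y.
Proof.
move=> /stabiliser_iso[f [bf fe fx]].
have af : `[< is_aut f >] by apply/asboolP.
by exists (exist _ f af).
Qed.

Lemma normaliser_stabiliser M (x : M) g :
  normaliser (stabiliser x) g <-> stabiliser (act x g) = stabiliser x.
Proof.
split=> [nx|xg h]; last by rewrite -{2}xg stabiliser_act.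
suff xg h : stabiliser (act x g) h <-> stabiliser x h.
  by apply/seteqP; split=> h /xg.
by rewrite -[h](conjgKV g) stabiliser_act; apply: nx.
Qed.

Lemma edge_transitiveP M :
  edge_transitive M <->
  forall x y : M, exists2 g, generated [set R0; R2] g &
    stabiliser (act y g) = stabiliser x.
Proof.
pose e (x : M) := flag_orbit (generated [set R0; R2]) x.
have exx x : e x x.
  by exists 1; [case: (generated_subgroup [set R0; R2])|rewrite act1].
split=> [tM x y|tM _ _ [x _ <-] [y _ <-]].
  have [||f fe] := tM (e x) (e y); [by exists x|by exists y|].
  have : e y (val f x) by rewrite -fe; exists x.
  by case=> g Eg yg; exists g; rewrite // yg aut_stabiliser.
have [g Eg xy] := tM x y; have [f fx] := aut_exists (esym xy).
have [_ EM EV] := generated_subgroup [set R0; R2].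
exists f; apply/seteqP; split=> [_ [_ [h Eh <-] <-]|_ [h Eh <-]].
  by exists (g * h); [apply: EM|rewrite actM aut_equivariant fx].
exists (act x (g^-1 * h)); first by exists (g^-1 * h) => //; apply: EM => //; apply: EV.
by rewrite aut_equivariant fx -actM mulgA mulgV mul1g.
Qed.

(** All edges are free, with free ends in the interior if b is true and on the
    boundary if b is false. *)
Definition free_type (b : bool) M := forall x : M, act x R0 = if b then act x R2 else x.

Lemma free_type_edge b M : free_type b M -> has_free_edge M.
Proof.
have [x] := flag_inhabited M; move=> ft.
exists (flag_orbit (generated [set R0; R2]) x); split; first by exists x.
case: b ft => ft; [right|left] => y _; last exact: ft.
by rewrite actM ft act_gen2.
Qed.

(** The flags of one free edge are fixed by R0 or by R0 R2, and every flag of an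
    edge-transitive map is the image of one of them under an automorphism. *)
Lemma edge_transitive_free M :
  edge_transitive M -> has_free_edge M -> exists b, free_type b M.
Proof.
move=> tM [e [ee fe]].
have im (y : M) : exists f : Aut M, exists2 z, e z & val f z = y.
  have [|f fee] := tM e (flag_orbit (generated [set R0; R2]) y) ee.
    by exists y.
  have : flag_orbit (generated [set R0; R2]) y y.
    by exists 1; [case: (generated_subgroup [set R0; R2])|rewrite act1].
  by rewrite -fee => -[z ez <-]; exists f, z.
case: fe => fe; [exists false|exists true] => y; have [f [z ez <-]] := im y.
  by rewrite -aut_equivariant fe.
by rewrite -!aut_equivariant -{2}(fe z ez) actM act_gen2.
Qed.

Lemma free_type_iso b M M' : isomorphic M M' -> free_type b M -> free_type b M'.
Proof.
move=> [f [[g fK gK] fe]] ft y.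
by rewrite -[y]gK -!fe ft; case: b {ft}.
Qed.

Lemma edge_transitive_iso M M' :
  isomorphic M M' -> edge_transitive M -> edge_transitive M'.
Proof.
move=> [f [bf fe]] /edge_transitiveP tM; apply/edge_transitiveP => x y.
have [g fK gK] := bf.
have [h Eh xy] := tM (g x) (g y); exists h => //.
by rewrite -[x]gK -[y]gK -fe !(stabiliser_inj _ fe (can_inj fK)).
Qed.

Lemma in_class_iso T M M' : isomorphic M M' -> in_class T M -> in_class T M'.
Proof.
move=> [f [[g fK gK] fe]] cM y.
by rewrite -[y]gK (stabiliser_inj _ fe (can_inj fK)).
Qed.

End MapTheory.

(** * Maps given by three involutions *)

Section InvolutionMap.
Variables (F : Type) (r : 'I_3 -> F -> F) (x0 : F).
Hypothesis rK : forall i, involutive (r i).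
Hypothesis r02 : forall x, r i0 (r i2 x) = r i2 (r i0 x).
Hypothesis r_conn : forall P : F -> Prop,
  P x0 -> (forall x i, P x -> P (r i x)) -> forall x, P x.

Definition word_act (x : F) (w : word 'I_3) : F := foldl (fun y l => r l.1 y) x w.

Lemma word_act_cat x v w : word_act x (v ++ w) = word_act (word_act x v) w.
Proof. exact: foldl_cat. Qed.

Lemma word_act_cong v w :
  word_cong Gamma_rels v w -> forall x, word_act x v = word_act x w.
Proof.
elim=> {v w} [w|v w _ IH|u v w _ IHu _ IHv|u u' v v' _ IHu _ IHv|i b|w rw] x //.
- by rewrite IHu IHv.
- by rewrite !word_act_cat IHu IHv.
- exact: rK.
- by case: rw => [[[]|]|] -> /=; rewrite ?r02 ?rK.
Qed.

Definition inv_act (x : F) (g : Gamma) : F := word_act x (repr g).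

Lemma inv_actE x w : inv_act x (pres_class Gamma_rels w) = word_act x w.
Proof. exact/word_act_cong/word_cong_repr. Qed.

Lemma inv_act1 x : inv_act x 1 = x.
Proof. exact: (inv_actE x [::]). Qed.

Lemma inv_actM x g h : inv_act x (g * h) = inv_act (inv_act x g) h.
Proof.
have [v ->] := pres_classE g; have [w ->] := pres_classE h.
by rewrite pres_class_mul !inv_actE word_act_cat.
Qed.

Lemma inv_act_gen x i : inv_act x (gen i) = r i x.
Proof. exact: inv_actE. Qed.

Lemma inv_act_transitive x y : exists g, inv_act x g = y.
Proof.
have reach : forall z, exists g, inv_act x0 g = z.
  apply: r_conn => [|z i [g <-]]; first by exists 1; rewrite inv_act1.
  by exists (g * gen i); rewrite inv_actM inv_act_gen.
have [g <-] := reach x; have [h <-] := reach y.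
by exists (g^-1 * h); rewrite -inv_actM mulgA mulgV mul1g.
Qed.

Definition inv_map : Map :=
  MkMap inv_act1 inv_actM (inhabits x0) inv_act_transitive.

Lemma inv_map_gen (x : inv_map) i : act x (gen i) = r i x.
Proof. exact: inv_act_gen. Qed.

End InvolutionMap.

(** * Chains of flags *)

Ltac lia_if :=
  repeat match goal with
  | |- context [if ?c then _ else _] => let h := fresh "h" in
      lazymatch c with context [if _ then _ else _] => fail | _ => case: (boolP c) => h end
  end; try lia.

(** A chain is a row of flags, thought of as unit segments [k, k + 1] of the line:
    2n of them in a closed row, the whole line, or the m + 1 segments lo, ..., lo + m
    between two walls.  The parity of lo matters, since it decides which of R1 and
    R2 meets the first wall. *)
Inductive chain_shape := Closed of xnat | Interval of nat & nat.

Definition in_shape (s : chain_shape) (k : int) : bool :=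
  match s with
  | Closed Inf => true
  | Closed (Fin n _) => (0 <= k < n%:Z * 2)%R
  | Interval lo m => (lo%:Z <= k <= lo%:Z + m%:Z)%R
  end.

(** Reflection in the even end point (b true) or the odd end point (b false). *)
Definition mirror (b : bool) (k : int) : int :=
  (if ((k %% 2)%Z == 0) == b then k - 1 else k + 1)%R.

Definition fold_back (s : chain_shape) (k k' : int) : int :=
  match s with
  | Closed Inf => k'
  | Closed (Fin n _) =>
    (if k' < 0 then k' + n%:Z * 2 else if k' < n%:Z * 2 then k' else k' - n%:Z * 2)%R
  | Interval _ _ => if in_shape s k' then k' else k
  end.

Definition step (s : chain_shape) b k := fold_back s k (mirror b k).

Definition origin (s : chain_shape) : int := if s is Interval lo _ then lo%:Z else 0%R.

Lemma mirrorK b : involutive (mirror b).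
Proof. by move=> k; rewrite /mirror; case: b; lia_if. Qed.

Lemma in_shape_origin s : in_shape s (origin s).
Proof. by case: s => [[n n_gt0|]|lo m] //=; lia. Qed.

Lemma in_shape_step s b k : in_shape s k -> in_shape s (step s b k).
Proof.
case: s => [[n n_gt0|]|lo m] //=; rewrite /step /mirror /=; first by case: b; lia_if.
by case: ifP.
Qed.

Lemma step_involutive s b k : in_shape s k -> step s b (step s b k) = k.
Proof.
case: s => [[n n_gt0|]|lo m] /=; rewrite /step /=.
- by rewrite /mirror; case: b; lia_if.
- by rewrite mirrorK.
move=> kin; have [kin'|/negPf kout] := boolP (lo%:Z <= mirror b k <= lo%:Z + m%:Z)%R.
  by rewrite mirrorK kin.
by rewrite kout.
Qed.

(** Starting at the origin, the reflections alternate in moving to the next segment;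
    on the whole line this also has to be done downwards. *)
Lemma step_connected s (P : int -> Prop) :
  P (origin s) -> (forall k b, in_shape s k -> P k -> P (step s b k)) ->
  forall k, in_shape s k -> P k.
Proof.
move=> P0 Ps.
have up (d : nat) : in_shape s (origin s + d%:Z)%R -> P (origin s + d%:Z)%R.
  elim: d => [|d IH] din; first by rewrite addr0.
  have din' : in_shape s (origin s + d%:Z)%R.
    by case: s {P0 Ps IH} din => [[n n_gt0|]|lo m] //=; lia.
  have := Ps _ (((origin s + d%:Z) %% 2)%Z != 0)%R din' (IH din').
  suff -> : step s (((origin s + d%:Z) %% 2)%Z != 0)%R (origin s + d%:Z)%R =
            (origin s + d.+1%:Z)%R by [].
  case: s {P0 Ps IH} din din' => [[n n_gt0|]|lo m] /=; rewrite /step /mirror /=; lia_if.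
move=> k kin; have [k_ge|k_lt] := leP (origin s) k.
  have kE : k = (origin s + `|k - origin s|%N%:Z)%R by lia.
  by rewrite kE; apply: up; rewrite -kE.
case: s P0 Ps up kin k_lt => [[n n_gt0|]|lo m] /= P0 Ps _ kin k_lt; try lia.
suff down (d : nat) : P (- d%:Z)%R by have := down `|k|%N; congr P; lia.
elim: d => [//|d IH].
have := Ps _ (((- d%:Z) %% 2)%Z == 0)%R isT IH.
by rewrite /step /mirror /=; congr P; lia_if.
Qed.

Section Chain.
Variables (b : bool) (s : chain_shape).

Definition chain_flag := {k : int | in_shape s k}.

Definition chain_step (c : bool) (x : chain_flag) : chain_flag :=
  exist _ (step s c (val x)) (in_shape_step c (valP x)).

Definition chain_gen (i : 'I_3) (x : chain_flag) : chain_flag :=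
  match val i with
  | 0 => if b then chain_step true x else x
  | 1 => chain_step false x
  | _ => chain_step true x
  end.

Definition chain_origin : chain_flag := exist _ (origin s) (in_shape_origin s).

Lemma chain_stepK c : involutive (chain_step c).
Proof. by move=> x; apply: val_inj; rewrite /= step_involutive // (valP x). Qed.

Lemma chain_genK i : involutive (chain_gen i).
Proof.
by elim/ord3_ind: i => x; rewrite /chain_gen /=; case: b; rewrite ?chain_stepK.
Qed.

Lemma chain_gen02 x : chain_gen i0 (chain_gen i2 x) = chain_gen i2 (chain_gen i0 x).
Proof. by rewrite /chain_gen /=; case: b. Qed.

Lemma chain_conn (P : chain_flag -> Prop) :
  P chain_origin -> (forall x i, P x -> P (chain_gen i x)) -> forall x, P x.
Proof.
move=> P0 Pi x.
suff : forall k, in_shape s k -> forall kin : in_shape s k, P (exist _ k kin).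
  by case: x => k kin; apply.
apply: step_connected => [kin|k c kin Pk kin'].
  by move: P0; rewrite /chain_origin (bool_irrelevance (in_shape_origin s) kin).
have := Pi _ (if c then i2 else i1) (Pk kin).
by congr P; apply: val_inj => /=; case: (c).
Qed.

(** As flags in the same edge are related by R2, a free end in the interior (b true)
    makes R0 act as R2, and one on the boundary makes it act trivially. *)
Definition chain : Map := inv_map chain_genK chain_gen02 chain_conn.

Lemma chainE (x : chain) i : act x (gen i) = chain_gen i x.
Proof. exact: inv_map_gen. Qed.

Lemma chain_free_type : free_type b chain.
Proof. by move=> x; rewrite !chainE /chain_gen /=; case: b. Qed.

Definition position (x : chain) : int := sval x.

Lemma position_inj : injective position.
Proof. exact: val_inj. Qed.

Lemma position_range x : in_shape s (position x).
Proof. exact: valP x. Qed.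

Lemma position_origin : position chain_origin = origin s.
Proof. by []. Qed.

Lemma position_step c x :
  position (act x (gen (if c then i2 else i1))) = step s c (position x).
Proof. by rewrite chainE; case: c. Qed.

End Chain.

Arguments position {b s} x : simpl never.

(** * The map subgroups as stabilisers in chains *)

Lemma card_eq2P (T : Type) (A : set T) :
  (A #= `I_2)%card <-> exists x y, [/\ x <> y, A x, A y & forall z, A z -> z = x \/ z = y].
Proof.
split=> [/eq_cardSP[x Ax /eq_cardSP[y [Ay yx]]]|[x [y [xy Ax Ay Axy]]]].
  rewrite II0 card_eq0 => /eqP A0; exists x, y; split=> // [/esym//|z Az].
  have [zx|zx] := pselect (z = x); [by left|right]; apply: contrapT => zy.
  by have : ((A `\ x) `\ y) z by []; rewrite A0.
apply/eq_cardSP; exists x => //; apply/eq_cardSP; exists y; first by split=> // /esym.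
rewrite II0 card_eq0; apply/eqP/seteqP; split=> // z [[Az zx] zy].
by case: (Axy z Az).
Qed.

Lemma stabiliser_subgroup (M : Map) (x : M) : subgroup (stabiliser x).
Proof.
split=> [|g h gx hx|g gx]; rewrite /stabiliser /= ?act1 //; first by rewrite actM gx hx.
by rewrite -{1}gx actK.
Qed.

Section Cosets.
Variables (H : set Gamma).
Hypothesis sH : subgroup H.

Lemma subgroup_mulr g h : H h -> H (g * h) <-> H g.
Proof.
have [_ HM HV] := sH; move=> Hh; split=> [Hgh|Hg]; last exact: HM.
by rewrite -[g](mulgK h); apply: HM => //; apply: HV.
Qed.

Lemma mem_rcosetP g x : Defs.rcoset H g x <-> H (x * g^-1).
Proof.
split=> [[h Hh <-]|Hx]; first by rewrite mulgK.
by exists (x * g^-1); rewrite ?mulgVK.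
Qed.

Lemma rcoset_eqP g h : Defs.rcoset H g = Defs.rcoset H h <-> H (g * h^-1).
Proof.
have [H1 HM HV] := sH; split=> [gh|Hgh].
  by apply/mem_rcosetP; rewrite -gh mem_rcosetP mulgV.
apply/seteqP; split=> x; rewrite !mem_rcosetP => Hx.
  by rewrite -[x](mulgVK g) -mulgA; apply: HM.
rewrite -[x](mulgVK h) -mulgA; apply: HM => //.
by have := HV _ Hgh; rewrite invgF.
Qed.

End Cosets.

(** In a subgroup of index 2 the product of two elements outside is inside, so
    membership of a word is decided by the parity of its letters outside. *)
Lemma index2_step J H g i : index2 J H -> H (g * gen i) <-> (H g <-> J i).
Proof.
move=> [sH /card_eq2P[A [B [AB _ _ HAB]]] HJ]; rewrite -HJ.
have [H1 HM HV] := sH; have [Hi|Hi] := pselect (H (gen i)).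
  by rewrite subgroup_mulr //; split=> // -[_]; apply.
split=> [Hgi|]; last first.
  move=> [gi _]; have [/gi //|Hg] := pselect (H g).
  have coset h : let C := Defs.rcoset H h in C = A \/ C = B by apply: HAB; exists h.
  suff : Defs.rcoset H g = Defs.rcoset H (gen i) by rewrite rcoset_eqP // genV.
  have nH h : ~ H h -> Defs.rcoset H h <> Defs.rcoset H 1.
    by move=> nHh; rewrite rcoset_eqP // invg1 mulg1.
  have := nH _ Hi; have := nH _ Hg.
  by case: (coset g) (coset (gen i)) (coset 1) => -> [] -> [] ->.
split=> // Hg; case: Hi; rewrite -[gen i](mulKg g); apply: HM => //; exact: HV.
Qed.

Lemma index2_unique J H K : index2 J H -> index2 J K -> H = K.
Proof.
move=> iH iK; have [[H1 _ _] _ _] := iH; have [[K1 _ _] _ _] := iK.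
suff HK g : H g <-> K g by apply/seteqP; split=> g /HK.
elim/Gamma_ind: g => [|g i IH]; first by split.
by rewrite (index2_step _ _ iH) (index2_step _ _ iK) IH.
Qed.

Lemma N_stabiliser (M : Map) (x y : M) (J : set 'I_3) :
  x <> y -> (forall z, z = x \/ z = y) ->
  (forall i, act x (gen i) = x <-> J i) -> N J = stabiliser x.
Proof.
move=> xy xyP xJ; have sS := stabiliser_subgroup x.
suff iS : index2 J (stabiliser x).
  by apply: (index2_unique _ iS); rewrite /N; apply: xgetPex; exists (stabiliser x).
split=> //; apply/card_eq2P; have [g xg] := act_transitive x y.
exists (Defs.rcoset (stabiliser x) 1), (Defs.rcoset (stabiliser x) g).
split; [|by exists 1|by exists g|].
  rewrite rcoset_eqP // mul1g => xgV; apply: xy; rewrite -xg.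
  by have := congr1 (fun z => act z g) xgV; rewrite /= actVK.
move=> _ [h _ <-]; case: (xyP (act x h)) => xh; [left|right].
  by apply/rcoset_eqP => //; rewrite invg1 mulg1.
by apply/rcoset_eqP => //; rewrite /stabiliser /= actM xh -xg actK.
Qed.

Definition kernel (M : Map) : set Gamma := [set g | forall x : M, act x g = x].

Lemma kernel_stabiliser (M : Map) (x : M) : kernel M `<=` stabiliser x.
Proof. by move=> g; apply. Qed.

Lemma normal_closure_kernel (M : Map) (A : set Gamma) :
  A `<=` kernel M -> normal_closure [set: Gamma] A `<=` kernel M.
Proof.
move=> AM; apply: smallest_sub => //; split=> // [|g h gM _ x]; last first.
  by rewrite conjgE !actM gM actVK.
split=> [x|g h gM hM x|g gM x]; first exact: act1.
  by rewrite actM gM hM.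
by rewrite -{1}(gM x) actK.
Qed.

Lemma sub_normal_closure (G : groupType) (K A : set G) : A `<=` normal_closure K A.
Proof. exact: sub_gen_smallest. Qed.

Lemma normal_closure_subgroup (G : groupType) (K A : set G) : subgroup (normal_closure K A).
Proof.
split=> [H [[[]]] //|x y Hx Hy H [[sH HK Hn] sA]|x Hx H [[sH HK Hn] sA]].
- by case: (sH) => _ + _; apply; [apply: Hx|apply: Hy].
- by case: (sH) => _ _; apply; apply: Hx.
Qed.

Lemma normal_closure_conj (G : groupType) (K A : set G) h k :
  normal_closure K A h -> K k -> normal_closure K A (h ^ k).
Proof. by move=> hH Kk H [[sH HK Hn] sA]; exact: (Hn _ _ (hH _ (conj (And3 sH HK Hn) sA)) Kk). Qed.

(** A choice of elements taking x0 to each flag is a transversal for the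
    stabiliser; a subgroup that contains the resulting Schreier generators
    contains the whole stabiliser. *)
Lemma schreier (M : Map) (x0 : M) (H : set Gamma) (v : M -> Gamma) :
  subgroup H -> H `<=` stabiliser x0 -> v x0 = 1 ->
  (forall x i, H (v x * gen i * (v (act x (gen i)))^-1)) -> H = stabiliser x0.
Proof.
move=> [H1 HM HV] Hx v0 Hv; apply/seteqP; split=> // g gx.
suff : H (g * (v (act x0 g))^-1) by rewrite gx v0 invg1 mulg1.
elim/Gamma_ind: g {gx} => [|g i IH]; first by rewrite act1 v0 mulgV.
rewrite actM; have := HM _ _ IH (Hv (act x0 g) i).
by rewrite !mulgA mulgVK.
Qed.

Definition rot (j : int) : Gamma :=
  match j with Posz j => (R1 * R2) ^+ j | Negz j => (R1 * R2) ^- j.+1 end.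

Lemma rotSr j : rot (j + 1)%R = rot j * (R1 * R2).
Proof.
case: j => [j|[|j]].
- by rewrite (_ : (Posz j + 1)%R = Posz j.+1) /= ?expgSr //; lia.
- by rewrite (_ : (Negz 0 + 1)%R = Posz 0) //= expg1 mulVg.
rewrite (_ : (Negz j.+1 + 1)%R = Negz j); last by lia.
by rewrite /= [in RHS]expgS invgM mulgVK.
Qed.

Lemma rotS j : rot (j + 1)%R = R1 * R2 * rot j.
Proof.
case: j => [j|[|j]].
- by rewrite (_ : (Posz j + 1)%R = Posz j.+1) /= ?expgS //; lia.
- by rewrite (_ : (Negz 0 + 1)%R = Posz 0) //= expg1 mulgV.
rewrite (_ : (Negz j.+1 + 1)%R = Negz j); last by lia.
by rewrite /= [in RHS]expgSr invgM mulVKg.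
Qed.

(** The product of the alternating word in R1 and R2 that leads from the segment
    0 of the line to the segment k. *)
Definition chain_word (k : int) : Gamma :=
  if (k %% 2)%Z == 0%R then rot (k %/ 2)%Z else rot (k %/ 2)%Z * R1.

Lemma chain_word_mirror c k :
  chain_word (mirror c k) = chain_word k * gen (if c then i2 else i1).
Proof.
have even j : chain_word (j * 2)%R = rot j.
  rewrite /chain_word (_ : (_ %% 2)%Z = 0%R) ?eqxx; last by lia.
  by rewrite (_ : (_ %/ 2)%Z = j) //; lia.
have odd j : chain_word (j * 2 + 1)%R = rot j * R1.
  rewrite /chain_word (_ : (_ %% 2)%Z = 1%R) /=; last by lia.
  by rewrite (_ : (_ %/ 2)%Z = j) //; lia.
have mirror_even d j : mirror d (j * 2)%R = (if d then (j - 1) * 2 + 1 else j * 2 + 1)%R.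
  by rewrite /mirror; case: d; lia_if.
have mirror_odd d j : mirror d (j * 2 + 1)%R = (if d then (j + 1) * 2 else j * 2)%R.
  by rewrite /mirror; case: d; lia_if.
have [j [->|->]] : exists j : int, (k = j * 2 \/ k = j * 2 + 1)%R.
  by exists (k %/ 2)%Z; lia.
  rewrite mirror_even even; case: (c); rewrite odd //.
  by rewrite -{2}[j](subrK 1%R) rotSr -!mulgA gen_sq mulg1.
rewrite mirror_odd odd; case: (c); rewrite even.
  by rewrite rotSr mulgA.
by rewrite -mulgA gen_sq mulg1.
Qed.

Lemma chain_word_shift n k : chain_word (k + n%:Z * 2)%R = (R1 * R2) ^+ n * chain_word k.
Proof.
elim: n => [|n IH]; first by rewrite mul0r addr0 mul1g.
rewrite (_ : (k + n.+1%:Z * 2 = k + n%:Z * 2 + 2)%R); last by lia.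
rewrite expgS -mulgA -IH; move: (k + _)%R => j; rewrite /chain_word.
rewrite (_ : ((j + 2) %% 2)%Z = (j %% 2)%Z); last by lia.
rewrite (_ : ((j + 2) %/ 2)%Z = ((j %/ 2)%Z + 1)%R) ?rotS; last by lia.
by case: ifP => // _; rewrite mulgA.
Qed.

Lemma chain_word_0 : chain_word 0 = 1.
Proof. by []. Qed.

Lemma chain_word_even j : chain_word (j%:Z * 2)%R = (R1 * R2) ^+ j.
Proof. by rewrite -[(_ * _)%R]add0r chain_word_shift chain_word_0 mulg1. Qed.

(** What the type of the free edges makes trivial. *)
Definition rho (b : bool) : Gamma := if b then R0 * R2 else R0.

Section ChainStabiliser.
Variables (b : bool) (s : chain_shape) (H : set Gamma).
Hypothesis sH : subgroup H.

Definition chain_path (k : int) : Gamma := (chain_word (origin s))^-1 * chain_word k.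

Lemma chain_path_mirror c k :
  chain_path (mirror c k) = chain_path k * gen (if c then i2 else i1).
Proof. by rewrite /chain_path chain_word_mirror mulgA. Qed.

(** In the last hypothesis the two paths differ at a wall or at the closure of
    the row; elsewhere the Schreier generators for R1 and R2 are trivial. *)
Lemma chain_stabiliser :
  H `<=` stabiliser (chain_origin s : chain b s) ->
  (forall k, in_shape s k -> H (chain_path k * rho b * (chain_path k)^-1)) ->
  (forall k c, in_shape s k -> mirror c k != step s c k ->
     H (chain_path (mirror c k) * (chain_path (step s c k))^-1)) ->
  H = stabiliser (chain_origin s : chain b s).
Proof.
move=> Ho Hrho Hstep; have [H1 HM HV] := sH.
apply: (@schreier _ _ _ (fun x : chain b s => chain_path (position x))) => //.
  by rewrite position_origin /chain_path mulVg.
have Hc c (x : chain b s) : H (chain_path (position x) * gen (if c then i2 else i1) *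
    (chain_path (position (act x (gen (if c then i2 else i1)))))^-1).
  rewrite position_step -chain_path_mirror.
  have [->|] := eqVneq (mirror c (position x)) (step s c (position x)).
    by rewrite mulgV.
  by apply: Hstep; apply: position_range.
move=> x; elim/ord3_ind; [|exact: (Hc false x)|exact: (Hc true x)].
have key g h : H (g * (R0 * R2) * g^-1) -> H (g * R2 * h^-1) -> H (g * R0 * h^-1).
  move=> Hg Hh; have := HM _ _ Hg Hh; congr H.
  by rewrite -!mulgA mulKg [R2 * (R2 * _)]mulgA gen_sq mul1g.
move: (Hrho _ (position_range x)) (Hc true x); rewrite /rho chain_free_type.
by case: b x {Ho Hrho Hc} => // x Hx Hy; apply: key Hx Hy.
Qed.

End ChainStabiliser.

Lemma act_rot (M : Map) (x : M) j :
  act x ((R1 * R2) ^+ j.+1) = act (act (act x ((R1 * R2) ^+ j)) R1) R2.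
Proof. by rewrite expgSr !actM. Qed.

Lemma closed_double n (n_gt0 : (0 < n)%N) k : in_shape (Closed (Fin n_gt0)) k ->
  step (Closed (Fin n_gt0)) true (step (Closed (Fin n_gt0)) false k) =
  (if (k %% 2)%Z == 0 then if k + 2 < n%:Z * 2 then k + 2 else k + 2 - n%:Z * 2
   else if 0 <= k - 2 then k - 2 else k - 2 + n%:Z * 2)%R.
Proof. by rewrite /step /mirror /= => kin; lia_if. Qed.

Lemma closed_rot b n (n_gt0 : (0 < n)%N) (x : chain b (Closed (Fin n_gt0))) j :
  (j <= n)%N -> position (act x ((R1 * R2) ^+ j)) =
  (if ((position x) %% 2)%Z == 0 then
     if position x + j%:Z * 2 < n%:Z * 2 then position x + j%:Z * 2 else position x + j%:Z * 2 - n%:Z * 2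
   else if 0 <= position x - j%:Z * 2 then position x - j%:Z * 2 else position x - j%:Z * 2 + n%:Z * 2)%R.
Proof.
have xin := position_range x; rewrite /in_shape in xin.
elim: j => [|j IH] jn; first by rewrite expg0 act1; lia_if.
rewrite act_rot (position_step true) (position_step false) closed_double; last first.
  exact: position_range.
have {IH} -> := IH (ltnW jn); move: (position x) xin => k kin; clear x.
by case: (boolP ((k %% 2)%Z == 0)) => k2; lia_if.
Qed.

Lemma closed_rot_kernel b n (n_gt0 : (0 < n)%N) :
  kernel (chain b (Closed (Fin n_gt0))) ((R1 * R2) ^+ n).
Proof.
move=> x; apply: position_inj; rewrite closed_rot //; have xin := position_range x; rewrite /in_shape in xin.
by lia_if.
Qed.

Lemma rho_kernel b s : kernel (chain b s) (rho b).
Proof.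
move=> x; have := chain_free_type x; rewrite /rho; case: b x => x // xE.
by rewrite actM xE act_gen2.
Qed.

(** The Schreier generators for the alternating words are conjugates of rho b, of
    the rotation that closes the row, and of the reflections in its walls. *)
Lemma normal_chain b s (A : set Gamma) :
  A `<=` kernel (chain b s) -> A (rho b) ->
  match s with
  | Closed Inf => True
  | Closed (Fin n _) => A ((R1 * R2) ^+ n)
  | Interval lo m => forall k c, in_shape s k -> ~~ in_shape s (mirror c k) ->
                       A (gen (if c then i2 else i1))
  end ->
  normal_closure [set: Gamma] A = stabiliser (chain_origin s : chain b s).
Proof.
move=> AK Arho As; have sA := @sub_normal_closure _ [set: Gamma] A.
have sH := normal_closure_subgroup [set: Gamma] A; have [_ HM HV] := sH.
have conjA g x : A x -> normal_closure [set: Gamma] A (g * x * g^-1).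
  move=> Ax; have := @normal_closure_conj _ setT A x (g^-1) (sA _ Ax) I.
  by rewrite conjgE invgK mulgA.
apply: chain_stabiliser => //.
- exact: subset_trans (normal_closure_kernel AK) (@kernel_stabiliser _ _).
- by move=> k _; apply: conjA.
move=> k c; case: s {AK} As => [[n n_gt0|]|lo m] As kin.
(* In a closed row only the step across the closure differs from a reflection. *)
- have HR := sA _ As.
  have path j : chain_path (Closed (Fin n_gt0)) j = chain_word j.
    by rewrite /chain_path /= chain_word_0 invg1 mul1g.
  have back : chain_word (n%:Z * 2 - 1)%R = (R1 * R2) ^+ n * R2.
    rewrite -chain_word_even -(chain_word_mirror true); congr chain_word.
    by rewrite /mirror; lia_if.
  have front : chain_word (-1)%R = R2.
    by rewrite -[RHS]mul1g -chain_word_0 -(chain_word_mirror true).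
  rewrite !path; move: kin; rewrite /step /in_shape => kin ks.
  have [kE|kE] : (mirror c k = -1 /\ fold_back (Closed (Fin n_gt0)) k (mirror c k) =
       n%:Z * 2 - 1 \/ mirror c k = n%:Z * 2 /\
       fold_back (Closed (Fin n_gt0)) k (mirror c k) = 0)%R.
    move: ks; rewrite /mirror /=; case: c; lia_if.
    by rewrite kE.2 kE.1 back front invgM mulgA mulgV mul1g; apply: HV.
  by rewrite kE.2 kE.1 chain_word_even chain_word_0 invg1 mulg1.
- by rewrite eqxx.
rewrite /step /=; case: ifPn => [|kout _]; first by rewrite eqxx.
rewrite chain_path_mirror; apply: conjA.
exact: As kout.
Qed.

Lemma normal_stabilisers (H : set Gamma) (M : Map) (x y : M) :
  normal_closure [set: Gamma] H = stabiliser x -> stabiliser y = stabiliser x.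
Proof.
move=> Hx; have [g <-] := act_transitive x y.
apply/normaliser_stabiliser => h; rewrite -Hx; split=> hH.
  exact: normal_closure_conj.
by rewrite -[h](conjgK g); apply: normal_closure_conj.
Qed.

Definition flag_at b s (k : int) : chain b s := insubd (chain_origin s) k.

Lemma position_flag_at b s k : in_shape s k -> position (flag_at b s k) = k.
Proof. by move=> kin; rewrite /position /flag_at; apply: insubdK. Qed.

Lemma flag_at_position b s (x : chain b s) : flag_at b s (position x) = x.
Proof. by apply: position_inj; rewrite position_flag_at ?position_range. Qed.

Lemma free_equivariant b (M M' : Map) (f : M -> M') :
  free_type b M -> free_type b M' ->
  (forall x c, f (act x (gen (if c then i2 else i1))) =
               act (f x) (gen (if c then i2 else i1))) -> equivariant f.
Proof.
move=> fM fM' fe; apply: equivariant_gen => x; elim/ord3_ind.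
- by rewrite fM fM'; case: b {fM fM'} => //; apply: (fe x true).
- exact: (fe x false).
- exact: (fe x true).
Qed.

Lemma chain_equivariant b s s' (p : int -> int) :
  (forall k, in_shape s k -> in_shape s' (p k)) ->
  (forall c k, in_shape s k -> p (step s c k) = step s' c (p k)) ->
  equivariant (fun x : chain b s => flag_at b s' (p (position x))).
Proof.
move=> ps pc; apply: (@free_equivariant b); [exact: chain_free_type|exact: chain_free_type|].
move=> x c; apply: position_inj; have xin := position_range x.
rewrite !position_step !position_flag_at ?ps ?pc //.
exact: in_shape_step.
Qed.

Definition N2 (b : bool) : set Gamma := if b then N2P else N2star.

Lemma N2_stabiliser b :
  N2 b = stabiliser (chain_origin (Interval 1 1) : chain b (Interval 1 1)).
Proof.
pose x : chain b (Interval 1 1) := chain_origin (Interval 1 1).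
pose y := flag_at b (Interval 1 1) 2%R.
have px : position x = 1%R by [].
have py : position y = 2%R by rewrite position_flag_at.
have xy : x <> y by move=> /(congr1 position); rewrite px py.
have xyP z : z = x \/ z = y.
  have zin := position_range z; rewrite /in_shape in zin.
  have [zE|zE] : (position z = 1 \/ position z = 2)%R by lia.
    by left; apply: position_inj; rewrite zE.
  by right; apply: position_inj; rewrite zE py.
have R1x : act x R1 = x by apply: position_inj; rewrite (position_step false).
have R2x : act x R2 <> x by move=> /(congr1 position); rewrite (position_step true).
have R0x : act x R0 = x <-> ~~ b.
  by rewrite chain_free_type; case: b @x {y xy xyP px py R1x} R2x.
rewrite /N2 /N2P /N2star -/x; case: b x y px py xy xyP R1x R2x R0x => x y px py xy xyP R1x R2x R0x;
  apply: (N_stabiliser xy xyP) => i; elim/ord3_ind: i.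
- by rewrite R0x; split=> // /(congr1 val).
- by rewrite R1x; split.
- by split=> // /(congr1 val).
- by rewrite R0x; split=> // _; left.
- by rewrite R1x; split=> // _; right.
- by split=> // -[] /(congr1 val).
Qed.

(** * Chains with two and four flags *)

(** Reversal preserves the parity of the end points only if the number m + 1 of
    segments is even. *)
Lemma interval_reverse b lo m : odd m -> equivariant (fun x : chain b (Interval lo m) =>
  flag_at b (Interval lo m) (lo%:Z * 2 + m%:Z - position x)%R).
Proof.
move=> m_odd; apply: (@chain_equivariant b _ _ (fun k => lo%:Z * 2 + m%:Z - k)%R).
  by move=> k /=; lia.
by move=> c k; rewrite /step /mirror /= => kin; case: c; lia_if.
Qed.

Lemma interval_stabiliser b lo m (x y : chain b (Interval lo m)) :
  odd m -> (position x + position y = lo%:Z * 2 + m%:Z)%R -> stabiliser x = stabiliser y.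
Proof.
move=> m_odd xy; have range (z : chain b (Interval lo m)) :
    (lo%:Z <= position z <= lo%:Z + m%:Z)%R.
  exact: (position_range z).
rewrite -(stabiliser_inj _ (@interval_reverse b lo m m_odd)) => [|u v /(congr1 position)].
  congr stabiliser; apply: position_inj; rewrite position_flag_at /=;
    have := range x; have := range y; lia.
have ru := range u; have rv := range v.
rewrite !position_flag_at /in_shape; [|lia|lia].
by move=> uv; apply: position_inj; lia.
Qed.

Lemma two_stabiliser b lo (x y : chain b (Interval lo 1)) : stabiliser x = stabiliser y.
Proof.
have range (z : chain b (Interval lo 1)) :
    (lo%:Z <= position z <= lo%:Z + 1)%R by have := position_range z; rewrite /=; lia.
have [|] : position x = position y \/ (position x + position y = lo%:Z * 2 + 1)%R.
- by have := range x; have := range y; lia.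
- by move/position_inj=> ->.
- exact: interval_stabiliser.
Qed.

(** The four-flag map is a double cover of the two-flag map, whose flag stabilisers
    are the class subgroup; folding the row in the middle is the covering. *)
Lemma four_fold b : equivariant (fun x : chain b (Interval 1 3) =>
  flag_at b (Interval 1 1) (if (position x == 1) || (position x == 4) then 1 else 2)%R).
Proof.
apply: (@chain_equivariant b _ _
  (fun k => if (k == 1) || (k == 4) then 1 else 2)%R) => [k|c k] /=; first by lia_if.
by rewrite /step /mirror /= => kin; case: c; lia_if.
Qed.

Lemma four_stabiliser b (x y : chain b (Interval 1 3)) :
  stabiliser x = stabiliser y <->
  (position x = position y \/ position x + position y = 5)%R.
Proof.
have range (z : chain b (Interval 1 3)) : (1 <= position z <= 4)%R.
  by have := position_range z; rewrite /=; lia.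
split=> [xy|[/position_inj -> //|xy]]; last exact: interval_stabiliser.
(* R1 fixes the two flags at the walls and swaps the two in the middle. *)
have fixR1 (z : chain b (Interval 1 3)) :
    stabiliser z R1 <-> (position z = 1 \/ position z = 4)%R.
  have := range z; rewrite /stabiliser /=; split=> [/(congr1 position)|zE].
    rewrite (position_step false) /step /mirror /=; lia_if.
  apply: position_inj; rewrite (position_step false) /step /mirror /=; lia_if.
have sxy : stabiliser x R1 <-> stabiliser y R1 by rewrite xy.
have := range x; have := range y; have [sy|sy] := pselect (stabiliser y R1).
  by have /fixR1 := sxy.2 sy; have /fixR1 := sy; lia.
have nx : ~ (position x = 1 \/ position x = 4)%R by move/fixR1/sxy.
have ny : ~ (position y = 1 \/ position y = 4)%R by move/fixR1.
lia.
Qed.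

(** The right-hand side says that k normalises the stabiliser of x. *)
Lemma four_N2 b (k : Gamma) (x : chain b (Interval 1 3)) :
  N2 b k <-> stabiliser (act x k) = stabiliser x.
Proof.
rewrite four_stabiliser N2_stabiliser.
rewrite (two_stabiliser _ (flag_at b (Interval 1 1)
           (if (position x == 1) || (position x == 4) then 1 else 2)%R)).
have range (z : chain b (Interval 1 3)) : (1 <= position z <= 4)%R.
  by have := position_range z; rewrite /=; lia.
have rx := range x; have rxk := range (act x k).
have := @four_fold b x k; rewrite /stabiliser /= => <-; split=> [/(congr1 position)|kE].
  by rewrite !position_flag_at /in_shape; lia_if.
by apply: position_inj; rewrite !position_flag_at /in_shape; lia_if.
Qed.

Lemma N2_subgroup b : subgroup (N2 b).
Proof. by rewrite N2_stabiliser; apply: stabiliser_subgroup. Qed.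

(** The class subgroup contains R1 and its conjugate by R2; as R2 commutes with
    rho b, the normal closure of R1 and rho b in it is the whole stabiliser. *)
Lemma four_subgroup b :
  normal_closure (N2 b) [set R1; rho b] =
  stabiliser (chain_origin (Interval 1 3) : chain b (Interval 1 3)).
Proof.
pose x : chain b (Interval 1 3) := chain_origin (Interval 1 3).
have px : position x = 1%R by [].
have sN := N2_subgroup b; have [_ NM NV] := sN.
have sA := @sub_normal_closure _ (N2 b) [set R1; rho b].
have xR1 : stabiliser x R1 by apply: position_inj; rewrite (position_step false).
have N1 : N2 b R1 by apply/(four_N2 _ x); apply: congr1.
have NT : N2 b (R2 * R1 * R2).
  apply/(four_N2 _ x)/four_stabiliser; right; rewrite !actM.
  by rewrite (position_step true) (position_step false) (position_step true).
have TV : (R2 * R1 * R2)^-1 = R2 * R1 * R2 by rewrite !invgM !genV mulgA.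
have rhoR2 : R2 * rho b * R2 = rho b.
  rewrite /rho; case: b {x px sN NM NV sA xR1 N1 NT}.
    by rewrite gen02_comm !mulgA gen_sq mul1g gen02_comm.
  by rewrite -gen02_comm -mulgA gen_sq mulg1.
have path2 : chain_path (Interval 1 3) 2%R = R2.
  by rewrite (chain_path_mirror _ true 1) /chain_path mulVg mul1g.
have path3 : chain_path (Interval 1 3) 3%R = R2 * R1.
  by rewrite (chain_path_mirror _ false 2) path2.
have path4 : chain_path (Interval 1 3) 4%R = R2 * R1 * R2.
  by rewrite (chain_path_mirror _ true 3) path3.
have path1 : chain_path (Interval 1 3) 1%R = 1 by rewrite /chain_path mulVg.
have path0 : chain_path (Interval 1 3) 0%R = R1.
  by rewrite (chain_path_mirror _ false 1) path1 mul1g.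
have path5 : chain_path (Interval 1 3) 5%R = R2 * R1 * R2 * R1.
  by rewrite (chain_path_mirror _ false 4) path4.
apply: chain_stabiliser; first exact: normal_closure_subgroup.
- apply: smallest_sub => [|g [->|->]] //; last exact: rho_kernel.
  split; first exact: stabiliser_subgroup.
    move=> g gx; apply/(four_N2 _ x); congr stabiliser; exact: gx.
  by move=> h k hx /(four_N2 _ x) <-; apply/stabiliser_act.
- have Hrho : normal_closure (N2 b) [set R1; rho b] (rho b) by apply: sA; right.
  have HT := normal_closure_conj Hrho NT.
  have TE : R2 * R1 * rho b * (R2 * R1)^-1 = rho b ^ (R2 * R1 * R2).
    by rewrite conjgE TV -{1}rhoR2 invgM !genV -!mulgA.
  move=> k; rewrite /in_shape => kin.
  have [|[|[|]]] : (k = 1 \/ k = 2 \/ k = 3 \/ k = 4)%R by lia.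
  + by move=> ->; rewrite path1 mul1g invg1 mulg1.
  + by move=> ->; rewrite path2 genV rhoR2.
  + by move=> ->; rewrite path3 TE.
  + move=> ->; rewrite path4; move: HT; congr normal_closure.
    by rewrite conjgE TV mulgA.
- move=> k c; rewrite /in_shape /step => kin kc.
  have [[mE sE]|[mE sE]] :
      (mirror c k = 0 /\ fold_back (Interval 1 3) k (mirror c k) = 1 \/
       mirror c k = 5 /\ fold_back (Interval 1 3) k (mirror c k) = 4)%R.
    move: kc; rewrite /mirror /=; case: c; lia_if.
    by rewrite sE mE path0 path1 invg1 mulg1; apply: sA; left.
  rewrite sE mE path5 path4; have H1 : normal_closure (N2 b) [set R1; rho b] R1.
    by apply: sA; left.
  have := normal_closure_conj H1 NT; congr normal_closure.
  by rewrite conjgE TV mulgA.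
Qed.

(** * The named maps as chains *)

Definition name_type (c : map_name) : bool :=
  match c with nAcirc _ | nN2P | nM2P0 => true | _ => false end.

Definition name_shape (c : map_name) : chain_shape :=
  match c with
  | nA n | nAcirc n => Closed n
  | nN1 => Interval 0 0
  | nD => Interval 0 1
  | nN2star | nN2P => Interval 1 1
  | nM2star0 | nM2P0 => Interval 1 3
  end.

Definition model (c : map_name) : Map := chain (name_type c) (name_shape c).

Lemma rotation_closed b n :
  [set rho b] `|` rotation_power n `<=` kernel (chain b (Closed n)).
Proof.
move=> g [->|]; first exact: rho_kernel.
by case: n => [n n_gt0 ->|//]; apply: closed_rot_kernel.
Qed.

Lemma map_subgroup_chain c :
  map_subgroup c = stabiliser (chain_origin (name_shape c) : model c).
Proof.
have closed b n : normal_closure [set: Gamma] ([set rho b] `|` rotation_power n) =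
    stabiliser (chain_origin (Closed n) : chain b (Closed n)).
  apply: normal_chain; [exact: rotation_closed|by left|].
  by case: n => //= n n_gt0; right.
case: c => [n|n||||||]; rewrite /map_subgroup.
- exact: (closed false).
- exact: (closed true).
- have zero (y : chain false (Interval 0 0)) : position y = 0%R.
    by have := position_range y; rewrite /=; lia.
  apply/seteqP; split=> // g _; apply: position_inj.
  exact: etrans (zero _) (esym (zero _)).
- exact: (N2_stabiliser false).
- exact: (N2_stabiliser true).
- apply: normal_chain; [|by left|].
    move=> g [->|->]; first by have := @rho_kernel false (Interval 0 1).
    move=> x; apply: position_inj; rewrite (position_step true).
    by have := position_range x; rewrite /step /mirror /= => xin; lia_if.
  move=> k c kin kout; right.
  by move: kin kout; rewrite /mirror /=; case: c => //; lia_if.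
- exact: (four_subgroup false).
- exact: (four_subgroup true).
Qed.

Lemma coset_map_stabiliser (H : set Gamma) :
  subgroup H -> exists x : coset_map H, stabiliser x = H.
Proof.
move=> sH; have [H1 _ _] := sH.
exists (exist _ (Defs.rcoset H 1) (mem_rcoset H 1)).
apply/seteqP; split=> g; rewrite /stabiliser /=.
  move/(congr1 val); rewrite /= rcosetM mul1g rcoset_eqP // invg1 mulg1.
  by [].
move=> Hg; apply: val_inj; rewrite /= rcosetM mul1g; apply/rcoset_eqP => //.
by rewrite invg1 mulg1.
Qed.

Lemma model_iso c : isomorphic (model c) (named_map c).
Proof.
have [x xE] : exists x : named_map c, stabiliser x = map_subgroup c.
  apply: coset_map_stabiliser; rewrite map_subgroup_chain.
  exact: stabiliser_subgroup.
have [|f [bf fe _]] := @stabiliser_iso _ _ (chain_origin (name_shape c) : model c) x.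
  by rewrite xE map_subgroup_chain.
by exists f.
Qed.

(** * Classification *)

(** A walk along the flags of a map, alternating between R1 and R2, is equivariant
    where it turns back at the walls and closes up as the chain does. *)
Lemma walk_iso b s (M : Map) (x : M) :
  free_type b M ->
  (forall c k, in_shape s k ->
    act x (chain_path s (mirror c k)) = act x (chain_path s (step s c k))) ->
  (forall k l, in_shape s k -> in_shape s l ->
    act x (chain_path s k) = act x (chain_path s l) -> k = l) ->
  isomorphic (chain b s) M.
Proof.
move=> fM wstep winj.
apply: (@equivariant_iso _ _ (fun y => act x (chain_path s (position y)))) => [|y z].
  apply: (@free_equivariant b) => // [|y c]; first exact: chain_free_type.
  by rewrite position_step -wstep ?position_range // chain_path_mirror actM.
by move=> /winj yz; apply/position_inj/yz; apply: position_range.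
Qed.

Section Classification.
Variables (b : bool) (M : Map).
Hypotheses (fM : free_type b M) (tM : edge_transitive M).

(** R2 commutes with R0, so it fixes all flags of an edge if it fixes one. *)
Lemma edge_fix_R2 (x y : M) : act x R2 = x -> act y R2 = y.
Proof.
move=> xR2; have [g Eg yx] := (edge_transitiveP M).1 tM x y.
have : stabiliser (act y g) R2 by rewrite yx.
rewrite /stabiliser /= -actM (_ : g * R2 = R2 * g).
  by move/(congr1 (fun z => act z g^-1)); rewrite actM !actK.
have := gen02_comm.
by case/generated02P: Eg => -> c; rewrite ?mulg1 ?mul1g // -?c -?mulgA ?gen_sq ?mulg1 ?c //
  mulgA gen_sq mul1g.
Qed.

Lemma classify_R2 (x : M) : act x R2 = x ->
  isomorphic (chain b (Interval 0 0)) M \/ isomorphic (chain b (Interval 0 1)) M.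
Proof.
move=> xR2; have yR2 (y : M) : act y R2 = y by exact: edge_fix_R2 xR2.
have path0 : chain_path (Interval 0 0) 0%R = 1 by rewrite /chain_path mulVg.
have path0' : chain_path (Interval 0 1) 0%R = 1 by rewrite /chain_path mulVg.
have path1 : chain_path (Interval 0 1) 1%R = R1.
  by rewrite (chain_path_mirror _ false 0) path0' mul1g.
have [xR1|xR1] := pselect (act x R1 = x); [left|right].
  apply: (@walk_iso _ _ _ x) => // [c k|k l]; rewrite /in_shape => kin; last by lia.
  rewrite chain_path_mirror actM.
  rewrite (_ : step _ c k = 0%R); last by rewrite /step /mirror /=; case: c; lia_if.
  by rewrite (_ : k = 0%R) ?path0 ?act1; [case: c|lia].
apply: (@walk_iso _ _ _ x) => // [c k|k l]; rewrite /in_shape => kin; last first.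
  move=> lin; have [[-> ->]|[[-> ->]|->]] :
    (k = 0 /\ l = 1 \/ k = 1 /\ l = 0 \/ k = l)%R by lia.
  - by rewrite path0' path1 act1 => /esym.
  - by rewrite path0' path1 act1.
  - by [].
rewrite chain_path_mirror actM; case: c.
  rewrite yR2 (_ : step _ true k = k) //.
  by rewrite /step /mirror /=; lia_if.
rewrite (_ : step _ false k = mirror false k) ?chain_path_mirror ?actM //.
by rewrite /step /mirror /=; lia_if.
Qed.

(** At a flag fixed by R1 the walk starts at a wall; since every edge is the image
    of the first one it meets a second wall after one edge or two. *)
Lemma classify_R1 (x : M) : (forall y : M, act y R2 <> y) -> act x R1 = x ->
  isomorphic (chain b (Interval 1 1)) M \/ isomorphic (chain b (Interval 1 3)) M.
Proof.
move=> nR2 xR1.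
have path1 m : chain_path (Interval 1 m) 1%R = 1 by rewrite /chain_path mulVg.
have path2 m : chain_path (Interval 1 m) 2%R = R2.
  by rewrite (chain_path_mirror _ true 1) path1 mul1g.
have path3 m : chain_path (Interval 1 m) 3%R = R2 * R1.
  by rewrite (chain_path_mirror _ false 2) path2.
have path4 m : chain_path (Interval 1 m) 4%R = R2 * R1 * R2.
  by rewrite (chain_path_mirror _ true 3) path3.
pose x2 := act x R2; pose x3 := act x2 R1; pose x4 := act x3 R2.
have [x2R1|x2R1] := pselect (x3 = x2); [left|right].
  apply: (@walk_iso _ _ _ x) => // [c k|k l]; rewrite /in_shape => kin; last first.
    move=> lin; have [[-> ->]|[[-> ->]|->]] :
      (k = 1 /\ l = 2 \/ k = 2 /\ l = 1 \/ k = l)%R by lia.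
    - by rewrite path1 path2 act1 => /esym /nR2.
    - by rewrite path1 path2 act1 => /nR2.
    - by [].
  have [[-> ->]|kE] : ((c = false /\ step (Interval 1 1) c k = k) \/
      step (Interval 1 1) c k = mirror c k)%R.
  - by rewrite /step /mirror /=; case: c; lia_if.
  - rewrite chain_path_mirror actM.
    have [->|->] : (k = 1 \/ k = 2)%R by lia.
      by rewrite path1 act1.
    by rewrite path2.
  - by rewrite kE.
have x4R1 : act x4 R1 = x4.
  have [g Eg xg] := (edge_transitiveP M).1 tM x x3.
  have : stabiliser (act x3 g) R1 by rewrite xg.
  have x3R1 : act x3 R1 <> x3 by rewrite act_gen2 => /esym.
  rewrite /stabiliser /= /x4; case/generated02P: Eg => ->; rewrite ?act1 ?actM ?fM //.
  - by case: (b) => // E; case: (x3R1 E).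
  - by case: (b) => //; rewrite [act (act x3 R2) R2]act_gen2 => E; case: (x3R1 E).
have d12 : x <> x2 by move=> /esym/nR2.
have d23 : x2 <> x3 by move=> /esym.
have d34 : x3 <> x4 by move=> /esym/nR2.
have d13 : x <> x3.
  by move=> x13; apply: d12; rewrite -{1}xR1 x13 act_gen2.
have d24 : x2 <> x4.
  by move=> x24; apply: d13; rewrite -[x](act_gen2 _ i2) -/x2 x24 act_gen2.
have d14 : x <> x4.
  by move=> x14; apply: d23; rewrite /x2 x14 act_gen2.
have w1 : act x (chain_path (Interval 1 3) 1%R) = x by rewrite path1 act1.
have w2 : act x (chain_path (Interval 1 3) 2%R) = x2 by rewrite path2.
have w3 : act x (chain_path (Interval 1 3) 3%R) = x3 by rewrite path3 actM.
have w4 : act x (chain_path (Interval 1 3) 4%R) = x4 by rewrite path4 !actM.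
apply: (@walk_iso _ _ _ x) => // [c k|k l]; rewrite /in_shape => kin; last first.
  move=> lin; have four j : (1%:Z <= j <= 1%:Z + 3%:Z)%R -> [\/ j = 1, j = 2, j = 3 | j = 4]%R.
    move=> jin; have [|[|[|]]] : (j = 1 \/ j = 2 \/ j = 3 \/ j = 4)%R by lia.
    - exact: Or41.
    - exact: Or42.
    - exact: Or43.
    - exact: Or44.
  by case: (four k kin) => ->; case: (four l lin) => ->; rewrite ?w1 ?w2 ?w3 ?w4 //;
    [move=> /esym/d12|move=> /esym/d13|move=> /esym/d14|move=> /esym/d24|move=> /esym/d34].
have [[-> [-> ->]]|[[-> [-> ->]]|->]] :
   ((c = false /\ k = 1 /\ step (Interval 1 3) c k = 1) \/
    (c = false /\ k = 4 /\ step (Interval 1 3) c k = 4) \/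
    step (Interval 1 3) c k = mirror c k)%R.
- by rewrite /step /mirror /=; case: c; lia_if.
- by rewrite chain_path_mirror actM w1.
- by rewrite chain_path_mirror actM w4.
- by [].
Qed.

(** Without fixed flags the stabilisers contain no reflections, and the walk
    closes up at the first power of R1 R2 that fixes its starting flag. *)
Lemma classify_free (x : M) : (forall (y : M) c, act y (gen (if c then i2 else i1)) <> y) ->
  exists n, isomorphic (chain b (Closed n)) M.
Proof.
move=> nfix; pose w k := act x (chain_word k).
have wmirror c k : w (mirror c k) = act (w k) (gen (if c then i2 else i1)).
  by rewrite /w chain_word_mirror actM.
have wpath n k : act x (chain_path (Closed n) k) = w k.
  by rewrite /chain_path chain_word_0 invg1 mul1g.
(* If w k = w (k + 2 d + 1), applying the same reflections to both sides moves them
   towards each other until a reflection fixes the flag in the middle. *)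
have wodd (d : nat) k : w k <> w (k + d%:Z * 2 + 1)%R.
  elim: d k => [|d IH] k wk.
    have [c kE] : exists c, mirror c k = (k + 0%:Z * 2 + 1)%R.
      by exists ((k %% 2)%Z != 0)%R; rewrite /mirror; lia_if.
    by apply: (nfix (w k) c); rewrite -wmirror kE.
  have [c [kE kE']] : exists c, mirror c k = (k + 1)%R /\
      mirror c (k + d.+1%:Z * 2 + 1)%R = (k + 1 + d%:Z * 2 + 1)%R.
    by exists ((k %% 2)%Z != 0)%R; rewrite /mirror; split; lia_if.
  by apply: (IH (k + 1)%R); rewrite -kE' -kE !wmirror wk.
have weven (d : nat) k : w k = w (k + d%:Z * 2)%R -> act x ((R1 * R2) ^+ d) = x.
  rewrite /w chain_word_shift actM => /(congr1 (fun y => act y (chain_word k)^-1)).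
  by rewrite !actK.
have winj k l : w k = w l ->
    exists2 d : nat, act x ((R1 * R2) ^+ d) = x & (l = k + d%:Z * 2 \/ k = l + d%:Z * 2)%R.
  wlog kl : k l / (k <= l)%R => [hwlog|wkl].
    have [/hwlog //|/ltW/hwlog h] := leP k l.
    by move=> /esym/h [d dx dkl]; exists d => //; case: dkl => ->; [right|left].
  have [d [lE|lE]] : exists d : nat, (l = k + d%:Z * 2 \/ l = k + d%:Z * 2 + 1)%R.
    by exists (`|l - k| %/ 2)%N; lia.
    by exists d; [apply: (weven d k); rewrite -lE|left].
  by case: (wodd d k); rewrite -lE.
have [per|nper] := pselect (exists n, (0 < n)%N && `[< act x ((R1 * R2) ^+ n) = x >]).
  pose n := ex_minn per; have [n_gt0 nx nmin] : [/\ (0 < n)%N, act x ((R1 * R2) ^+ n) = x &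
      forall d, (0 < d)%N -> act x ((R1 * R2) ^+ d) = x -> (n <= d)%N].
    rewrite /n; case: ex_minnP => m /andP[m_gt0 /asboolP mx] mmin; split=> // d d_gt0 dx.
    by apply: mmin; rewrite d_gt0; apply/asboolP.
  have wn k : w (k + n%:Z * 2)%R = w k by rewrite /w chain_word_shift actM nx.
  exists (Fin n_gt0); apply: (@walk_iso _ _ _ x) => // [c k|k l] kin; last first.
    move=> lin; rewrite !wpath => /winj[d dx dkl].
    have [d0|d_gt0] := posnP d; first by move: dkl; rewrite d0; lia.
    by have := nmin d d_gt0 dx; move: kin lin dkl; rewrite /=; lia.
  rewrite !wpath /step /=; case: ifP => _; first by rewrite wn.
  by case: ifP => // _; rewrite -[RHS]wn subrK.
exists Inf; apply: (@walk_iso _ _ _ x) => // k l _ _; rewrite !wpath => /winj[d dx dkl].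
have [d0|d_gt0] := posnP d; first by move: dkl; rewrite d0; lia.
by case: nper; exists d; rewrite d_gt0; apply/asboolP.
Qed.

End Classification.

Lemma model_free c : free_type (name_type c) (model c).
Proof. exact: chain_free_type. Qed.

Lemma closed_stabiliser b n (x y : chain b (Closed n)) : stabiliser x = stabiliser y.
Proof.
have H : normal_closure [set: Gamma] ([set rho b] `|` rotation_power n) =
    stabiliser (chain_origin (Closed n) : chain b (Closed n)).
  case: b x y => _ _; [exact: (map_subgroup_chain (nAcirc n))|].
  exact: (map_subgroup_chain (nA n)).
by rewrite (normal_stabilisers x H) (normal_stabilisers y H).
Qed.

Lemma model_regular c :
  match c with nM2star0 | nM2P0 => True
  | _ => forall x y : model c, stabiliser x = stabiliser y end.
Proof.
case: c => [n|n||||||] //; try exact: closed_stabiliser; try exact: two_stabiliser.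
move=> x y; congr stabiliser; apply: position_inj.
have zero (z : chain false (Interval 0 0)) : position z = 0%R.
  by have := position_range z; rewrite /=; lia.
exact: etrans (zero _) (esym (zero _)).
Qed.

Lemma four_edge_transitive b : edge_transitive (chain b (Interval 1 3)).
Proof.
apply/edge_transitiveP => x y.
have range (z : chain b (Interval 1 3)) : (1 <= position z <= 4)%R.
  by have := position_range z; rewrite /=; lia.
have [xy|xy] := pselect (stabiliser y = stabiliser x).
  by exists 1; [apply/generated02P; apply: Or41|rewrite act1].
exists R2; first by apply/generated02P; apply: Or43.
apply/four_stabiliser; rewrite (position_step true) /step /mirror /=.
have nxy : ~ (position y = position x \/ position y + position x = 5)%R.
  by move/four_stabiliser.
by have := range x; have := range y; move: nxy; lia_if.
Qed.

Lemma model_edge_transitive c : edge_transitive (model c).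
Proof.
have reg (M : Map) : (forall x y : M, stabiliser x = stabiliser y) -> edge_transitive M.
  move=> H; apply/edge_transitiveP => x y.
  by exists 1; [apply/generated02P; apply: Or41|rewrite act1].
case: c => [n|n||||||]; try exact: four_edge_transitive.
- exact/reg/(model_regular (nA n)).
- exact/reg/(model_regular (nAcirc n)).
- exact/reg/(model_regular nN1).
- exact/reg/(model_regular nN2star).
- exact/reg/(model_regular nN2P).
- exact/reg/(model_regular nD).
Qed.

Lemma edge_transitive_free_classification M :
  (edge_transitive M /\ has_free_edge M) <->
  exists c : map_name, isomorphic M (named_map c).
Proof.
split=> [[tM hM]|[c Mc]]; last first.
  have cM : isomorphic (model c) M.
    exact: isomorphic_trans (model_iso c) (isomorphic_sym Mc).
  split; first exact: edge_transitive_iso cM (@model_edge_transitive c).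
  exact: free_type_edge (free_type_iso cM (@model_free c)).
suff [c cM] : exists c, isomorphic (model c) M.
  by exists c; apply: isomorphic_trans (model_iso c); apply: isomorphic_sym.
have [b fM] := edge_transitive_free tM hM.
have [[x xR2]|nR2] := pselect (exists x : M, act x R2 = x).
  (* Then R0 is trivial as well, whatever the type. *)
  have fM' : free_type false M.
    by move=> y; rewrite fM (edge_fix_R2 tM _ xR2); case: (b).
  by have [|] := classify_R2 fM' tM xR2; [exists nN1|exists nD].
have {}nR2 (y : M) : act y R2 <> y by move=> yR2; apply: nR2; exists y.
have [[x xR1]|nR1] := pselect (exists x : M, act x R1 = x).
  have [|] := classify_R1 fM tM nR2 xR1; case: b {fM} => ?;
  by [exists nN2P|exists nN2star|exists nM2P0|exists nM2star0].
have [x] := flag_inhabited M.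
have [|n] := @classify_free b M fM x.
  by move=> y [|] // yR1; apply: nR1; exists y.
by case: b {fM} => ?; [exists (nAcirc n)|exists (nA n)].
Qed.

(** * Distinctness *)

Lemma kernel_iso (M M' : Map) : isomorphic M M' -> kernel M = kernel M'.
Proof.
move=> [f [[g fK gK] fe]]; apply/seteqP; split=> h hM x.
  by rewrite -[x]gK -fe hM.
by apply: (can_inj fK); rewrite fe hM.
Qed.

Lemma kernel_step b s c :
  kernel (chain b s) (gen (if c then i2 else i1)) <->
  forall k, in_shape s k -> step s c k = k.
Proof.
split=> [K k kin|K x]; last first.
  by apply: position_inj; rewrite position_step K // position_range.
have := congr1 position (K (flag_at b s k)).
by rewrite position_step position_flag_at.
Qed.

Lemma fix_step b s c :
  (exists x : chain b s, act x (gen (if c then i2 else i1)) = x) <->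
  exists2 k, in_shape s k & step s c k = k.
Proof.
split=> [[x /(congr1 position)]|[k kin kc]].
  by rewrite position_step => xc; exists (position x); rewrite // position_range.
exists (flag_at b s k); apply: position_inj.
by rewrite position_step position_flag_at.
Qed.

Definition trivial_R1 c := match c with nN1 | nN2star | nN2P => true | _ => false end.
Definition trivial_R2 c := match c with nN1 | nD => true | _ => false end.
Definition fixed_R1 c := match c with nA _ | nAcirc _ | nD => false | _ => true end.

Lemma model_R1 c : kernel (model c) R1 <-> trivial_R1 c.
Proof.
rewrite (kernel_step _ _ false); case: c => [n|n||||||] /=;
  try by split=> // _ k; rewrite /step /mirror /=; lia_if.
all: split=> // H.
- by have := H 0%R; case: n H => [n n_gt0|] H; rewrite /step /mirror /=; lia_if.
- by have := H 0%R; case: n H => [n n_gt0|] H; rewrite /step /mirror /=; lia_if.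
- by have := H 0%R isT.
- by have := H 2%R isT.
- by have := H 2%R isT.
Qed.

Lemma model_R2 c : kernel (model c) R2 <-> trivial_R2 c.
Proof.
rewrite (kernel_step _ _ true); case: c => [n|n||||||] /=;
  try by split=> // _ k; rewrite /step /mirror /=; lia_if.
all: split=> // H.
- by have := H 0%R; case: n H => [n n_gt0|] H; rewrite /step /mirror /=; lia_if.
- by have := H 0%R; case: n H => [n n_gt0|] H; rewrite /step /mirror /=; lia_if.
- by have := H 1%R isT.
- by have := H 1%R isT.
- by have := H 1%R isT.
- by have := H 1%R isT.
Qed.

Lemma model_fix_R1 c : (exists x : model c, act x R1 = x) <-> fixed_R1 c.
Proof.
rewrite (fix_step _ _ false); case: c => [n|n||||||] /=; split=> //.
- by case=> k; case: n => [n n_gt0|]; rewrite /step /mirror /=; lia_if.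
- by case=> k; case: n => [n n_gt0|]; rewrite /step /mirror /=; lia_if.
- by exists 0%R.
- by exists 1%R.
- by exists 1%R.
- by case=> k; rewrite /step /mirror /=; lia_if.
- by exists 1%R.
- by exists 1%R.
Qed.

Lemma line_rot b (x : chain b (Closed Inf)) j : position x = 0%R ->
  position (act x ((R1 * R2) ^+ j)) = (j%:Z * 2)%R.
Proof.
move=> x0; elim: j => [|j IH]; first by rewrite expg0 act1 x0.
rewrite act_rot (position_step true) (position_step false) IH.
by rewrite /step /mirror /=; lia_if.
Qed.

Lemma closed_shape_inj b n n' :
  kernel (chain b (Closed n)) = kernel (chain b (Closed n')) -> n = n'.
Proof.
have origin0 m : position (chain_origin (Closed m) : chain b (Closed m)) = 0%R by [].
have finite m (m_gt0 : (0 < m)%N) j :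
    kernel (chain b (Closed (Fin m_gt0))) ((R1 * R2) ^+ j) -> (0 < j)%N -> (m <= j)%N.
  move=> K j_gt0; rewrite leqNgt; apply/negP => jm.
  have := congr1 position (K (chain_origin (Closed (Fin m_gt0)))).
  by rewrite closed_rot ?origin0 ?(ltnW jm) //; lia_if.
have infinite j : kernel (chain b (Closed Inf)) ((R1 * R2) ^+ j) -> j = 0%N.
  move=> K; have := congr1 position (K (chain_origin (Closed Inf))).
  by rewrite line_rot ?origin0 //; lia.
case: n n' => [n n_gt0|] [n' n_gt0'|] // KE.
- have nn' : n = n'.
    apply/eqP; rewrite eqn_leq; apply/andP; split.
      by apply: (finite n n_gt0) => //; rewrite KE; apply: closed_rot_kernel.
    by apply: (finite n' n_gt0') => //; rewrite -KE; apply: closed_rot_kernel.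
  by case: n' / nn' n_gt0' {KE} => n_gt0'; congr Fin; apply: bool_irrelevance.
- have n0 : n = 0%N by apply: infinite; rewrite -KE; apply: closed_rot_kernel.
  by exfalso; have := n_gt0; rewrite n0.
- have n0 : n' = 0%N by apply: infinite; rewrite KE; apply: closed_rot_kernel.
  by exfalso; have := n_gt0'; rewrite n0.
Qed.

(** If R2 acts nontrivially then the type is determined by whether R0 is trivial;
    with the actions of R1 and R2 and the fixed flags of R1 this determines the
    name up to n, which is the order of R1 R2. *)
Lemma named_map_inj c d : isomorphic (named_map c) (named_map d) -> c = d.
Proof.
move=> cd; have {cd} cd : isomorphic (model c) (model d).
  apply: isomorphic_trans (model_iso c) _; apply: isomorphic_trans cd _.
  exact: isomorphic_sym (model_iso d).
have K := kernel_iso cd.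
have t1 : trivial_R1 c = trivial_R1 d by apply/idP/idP => /model_R1; [rewrite K|rewrite -K] => /model_R1.
have t2 : trivial_R2 c = trivial_R2 d by apply/idP/idP => /model_R2; [rewrite K|rewrite -K] => /model_R2.
have fix1 (M M' : Map) : isomorphic M M' -> (exists x : M, act x R1 = x) ->
    exists x : M', act x R1 = x.
  by move=> [f [_ fe]] [x xR1]; exists (f x); rewrite -fe xR1.
have t3 : fixed_R1 c = fixed_R1 d.
  by apply/idP/idP => /model_fix_R1/fix1 h; apply/model_fix_R1/h => //; apply: isomorphic_sym.
have t0 : ~~ trivial_R2 c -> name_type c = name_type d.
  move=> n2c; have n2d : ~~ trivial_R2 d by rewrite -t2.
  have ty (e : map_name) : ~~ trivial_R2 e -> kernel (model e) R0 <-> name_type e = false.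
    move=> n2e; split=> [K0|et x]; last by rewrite model_free et.
    case et : (name_type e) => //; exfalso; move/negP: n2e; apply; apply/model_R2 => x.
    by have := model_free x; rewrite et => <-.
  case ec : (name_type c); case ed : (name_type d) => //.
    by move/(ty d n2d): ed; rewrite -K => /(ty c n2c); rewrite ec.
  by move/(ty c n2c): ec; rewrite K => /(ty d n2d); rewrite ed.
move: K t0 t1 t2 t3.
case: c {cd} => [n|n||||||]; case: d => [n'|n'||||||] //= K t0 t1 t2 t3;
  try by have := t0 isT.
- by congr nA; apply: (@closed_shape_inj false).
- by congr nAcirc; apply: (@closed_shape_inj true).
Qed.

(** * Classes *)

Lemma named_map_class c :
  in_class (match c with nM2star0 => N2star | nM2P0 => N2P | _ => N1 end) (named_map c).
Proof.
apply: in_class_iso (model_iso c) _.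
have reg (M : Map) : (forall x y : M, stabiliser x = stabiliser y) -> in_class N1 M.
  move=> H x; apply/seteqP; split=> // g _; apply/normaliser_stabiliser; exact: H.
have four b : in_class (N2 b) (chain b (Interval 1 3)).
  by move=> x; apply/seteqP; split=> g; rewrite normaliser_stabiliser -four_N2.
case: c => [n|n||||||].
- exact/reg/(model_regular (nA n)).
- exact/reg/(model_regular (nAcirc n)).
- exact/reg/(model_regular nN1).
- exact/reg/(model_regular nN2star).
- exact/reg/(model_regular nN2P).
- exact/reg/(model_regular nD).
- exact: (four false).
- exact: (four true).
Qed.

(** * Automorphism groups *)

Lemma rotation_relator n g : rotation_power n g -> exists2 k,
  g = (R1 * R2) ^+ k & dihedral_rels n (pos_word (flatten (nseq k [:: true; false]))).
Proof. by case: n => // k k_gt0 ->; exists k => //; right. Qed.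

Section DihedralAut.
Variables (b : bool) (n : xnat) (M : Map) (x0 : M).
Hypothesis fM : free_type b M.
Hypothesis regM : forall x y : M, stabiliser x = stabiliser y.
Hypothesis stabx0 :
  stabiliser x0 = normal_closure [set: Gamma] ([set rho b] `|` rotation_power n).

Definition side_gen (c : bool) : Gamma := gen (if c then i1 else i2).

Definition side_aut (c : bool) : Aut M :=
  projT1 (cid (aut_exists (regM x0 (act x0 (side_gen c))))).

Lemma side_autE c : val (side_aut c) x0 = act x0 (side_gen c).
Proof. by rewrite /side_aut; case: cid. Qed.

Lemma word_eval_aut (w : word bool) :
  val (word_eval side_aut w) x0 = act x0 (word_eval side_gen w).
Proof.
elim: w => [|[c e] w IH]; first by rewrite act1.
have autV : (side_aut c)^-1 = side_aut c.
  apply: mulg1_eq; apply: (@aut_eq _ _ _ x0) => /=.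
  by rewrite side_autE aut_equivariant side_autE act_gen2.
rewrite /= autV genV !if_same /= actM -side_autE -aut_equivariant.
by congr (val _ _).
Qed.

Lemma word_eval_pos (G : groupType) (f : bool -> G) k :
  word_eval f (pos_word (flatten (nseq k [:: true; false]))) = (f true * f false) ^+ k.
Proof. by elim: k => [|k IH] //=; rewrite IH expgS mulgA. Qed.

Lemma side_aut_rels r : dihedral_rels n r -> word_eval side_aut r = 1.
Proof.
move=> rn; apply: (@aut_eq _ _ _ x0); rewrite word_eval_aut /=.
case: rn => [[->|->]|]; rewrite /= ?mulg1 ?gen_sq ?act1 //.
case: n stabx0 => // k k_gt0 sx0 ->; rewrite word_eval_pos.
have : normal_closure [set: Gamma] ([set rho b] `|` rotation_power (Fin k_gt0)) ((R1 * R2) ^+ k).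
  by apply: sub_normal_closure; right.
by rewrite -sx0.
Qed.

Definition dihedral_gen (i : 'I_3) : dihedral n :=
  match val i with
  | 0 => if b then pres_gen (dihedral_rels n) false else 1
  | 1 => pres_gen (dihedral_rels n) true
  | _ => pres_gen (dihedral_rels n) false
  end.

Lemma dihedral_sq c : pres_gen (dihedral_rels n) c * pres_gen (dihedral_rels n) c = 1.
Proof.
rewrite /pres_gen pres_class_mul; apply/pres_classP/WcRel.
by case: c; left; [left|right].
Qed.

Lemma dihedral_gen_rels r : Gamma_rels r -> word_eval dihedral_gen r = 1.
Proof.
have sq i : dihedral_gen i * dihedral_gen i = 1.
  by elim/ord3_ind: i; rewrite /dihedral_gen /=; case: b; rewrite ?dihedral_sq ?mulg1.
case=> [[[]|]|] -> /=; rewrite mulg1 ?sq //.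
rewrite /dihedral_gen /=; case: b; rewrite ?mul1g ?dihedral_sq //.
by rewrite mulg1 dihedral_sq.
Qed.

Definition to_dihedral : Gamma -> dihedral n := pres_lift dihedral_gen.

Lemma to_dihedralM : {morph to_dihedral : g h / g * h}.
Proof. exact: pres_liftM dihedral_gen_rels. Qed.

Lemma to_dihedral_gen i : to_dihedral (gen i) = dihedral_gen i.
Proof. exact: pres_lift_gen dihedral_gen_rels i. Qed.

Lemma to_dihedral1 : to_dihedral 1 = 1.
Proof. by apply: (mulgI (to_dihedral 1)); rewrite -to_dihedralM !mulg1. Qed.

Lemma to_dihedralV g : to_dihedral g^-1 = (to_dihedral g)^-1.
Proof. by apply/esym/mulg1_eq; rewrite -to_dihedralM mulgV to_dihedral1. Qed.

Lemma stabiliser_to_dihedral g : stabiliser x0 g -> to_dihedral g = 1.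
Proof.
rewrite stabx0; move: g; apply: smallest_sub.
  split=> // [|h k hK _]; last first.
    by rewrite /= conjgE !to_dihedralM to_dihedralV hK mul1g mulVg.
  split=> [|h k hK kK|h hK]; rewrite /= ?to_dihedral1 //.
    by rewrite to_dihedralM hK kK mulg1.
  by rewrite to_dihedralV hK invg1.
have R12 : to_dihedral (R1 * R2) = pres_gen _ true * pres_gen _ false.
  by rewrite to_dihedralM !to_dihedral_gen.
move=> g [->|]; rewrite /=.
  rewrite /rho; case eb : b; rewrite ?to_dihedralM !to_dihedral_gen /dihedral_gen /= eb //.
  exact: dihedral_sq.
case/rotation_relator=> k -> kn.
have toX j : to_dihedral ((R1 * R2) ^+ j) = to_dihedral (R1 * R2) ^+ j.
  by elim: j => [|j IH]; rewrite ?expg0 ?to_dihedral1 // !expgS (to_dihedralM (R1 * R2)) IH.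
rewrite toX R12 -word_eval_pos.
have classE w : pres_class (dihedral_rels n) w = word_eval (pres_gen (dihedral_rels n)) w.
  elim: w => [|[c e] w IH] //.
  by rewrite -cat1s -pres_class_mul pres_class_letter IH.
by rewrite -classE; apply/pres_classP/WcRel.
Qed.

Definition dihedral_aut : dihedral n -> Aut M := pres_lift side_aut.

Lemma dihedral_autM : {morph dihedral_aut : d e / d * e}.
Proof. exact: pres_liftM side_aut_rels. Qed.

Lemma dihedral_autE d :
  exists g, to_dihedral g = d /\ val (dihedral_aut d) x0 = act x0 g.
Proof.
have [w ->] := pres_classE d; exists (word_eval side_gen w).
split; last by rewrite /dihedral_aut pres_liftE ?word_eval_aut //; apply: side_aut_rels.
elim: w => [|[c e] w IH]; first exact: to_dihedral1.
rewrite -cat1s -pres_class_mul pres_class_letter /= to_dihedralM IH genV if_same.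
congr (_ * _); rewrite to_dihedral_gen.
have sqV : (pres_gen (dihedral_rels n) c)^-1 = pres_gen (dihedral_rels n) c.
  exact: mulg1_eq (dihedral_sq c).
by rewrite sqV if_same; case: (c).
Qed.

(** The kernel of the map from words in R1 and R2 is contained in that of the map
    to the dihedral group, because the stabiliser is the normal closure of elements
    that are trivial there. *)
Lemma aut_dihedral : isogroup (Aut M) (dihedral n).
Proof.
apply: isogroup_sym; apply: (isogroup_morph dihedral_autM).
apply: inj_surj_bij => [d e de|f].
  have [g [gd dg]] := dihedral_autE d; have [h [he eh]] := dihedral_autE e.
  have : stabiliser x0 (g * h^-1) by rewrite /stabiliser /= actM -dg de eh actK.
  by move/stabiliser_to_dihedral; rewrite to_dihedralM to_dihedralV gd he => /divg1_eq.
have [g] := act_transitive x0 (val f x0).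
suff [d dg] : exists d, val (dihedral_aut d) x0 = act x0 g.
  by move=> xg; exists d; apply: (@aut_eq _ _ _ x0); rewrite dg.
elim/Gamma_ind: g => [|g i [d dg]].
  exists 1; rewrite act1 (_ : dihedral_aut 1 = 1) //.
  by apply: (mulgI (dihedral_aut 1)); rewrite -dihedral_autM !mulg1.
have step c : exists e, val (dihedral_aut e) x0 = act (act x0 g) (side_gen c).
  exists (d * pres_gen (dihedral_rels n) c).
  rewrite dihedral_autM {2}/dihedral_aut pres_lift_gen; last exact: side_aut_rels.
  by rewrite /= side_autE aut_equivariant dg.
rewrite actM; elim/ord3_ind: i; [|exact: (step true)|exact: (step false)].
by rewrite fM; case: (b); [exact: (step false)|exists d].
Qed.

End DihedralAut.

Lemma group2_dihedral (G : groupType) (s : G) :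
  s != 1 -> (forall g : G, g = 1 \/ g = s) -> isogroup G (dihedral (@Fin 1 isT)).
Proof.
move=> s1 Gs; pose f (c : bool) := s.
have ss : s * s = 1.
  case: (Gs (s * s)) => // /(congr1 (fun g => g * s^-1)).
  by rewrite mulgK mulgV => /eqP; rewrite (negPf s1).
have fr r : dihedral_rels (@Fin 1 isT) r -> word_eval f r = 1.
  by case=> [[->|->]|->] /=; rewrite mulg1.
pose a := pres_gen (dihedral_rels (@Fin 1 isT)) true.
have aa : a * a = 1 by apply: dihedral_sq.
have ab : a * pres_gen (dihedral_rels (@Fin 1 isT)) false = 1.
  by rewrite /a /pres_gen pres_class_mul; apply/pres_classP/WcRel; right.
have bE : pres_gen (dihedral_rels (@Fin 1 isT)) false = a.
  by rewrite -(mulg1_eq ab); apply: mulg1_eq.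
have aV : a^-1 = a by apply: mulg1_eq.
have two (d : dihedral (@Fin 1 isT)) : d = 1 \/ d = a.
  elim/presented_ind: d => [|d c|d c]; first by left.
    by case: c; rewrite ?bE -/a => -[] ->; rewrite ?mul1g ?aa; [right|left|right|left].
  by case: c; rewrite ?bE -/a aV => -[] ->; rewrite ?mul1g ?aa; [right|left|right|left].
have fM := pres_liftM fr.
have f1 : pres_lift f (1 : dihedral (@Fin 1 isT)) = 1 :> G.
  by apply: (mulgI (pres_lift f (1 : dihedral (@Fin 1 isT)))); rewrite -fM !mulg1.
have fa : pres_lift f a = s by rewrite (pres_lift_gen fr).
apply: isogroup_sym; apply: (isogroup_morph fM); apply: inj_surj_bij => [d e|g].
  by case: (two d) => ->; case: (two e) => ->; rewrite ?f1 ?fa // => E; case/eqP: s1.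
by case: (Gs g) => ->; [exists 1|exists a].
Qed.

Lemma aut_two (M : Map) (x y : M) :
  x <> y -> stabiliser x = stabiliser y ->
  (forall z, stabiliser z = stabiliser x -> z = x \/ z = y) ->
  isogroup (Aut M) (dihedral (@Fin 1 isT)).
Proof.
move=> xy sxy xyP; have [s sx] := aut_exists sxy.
apply: (@group2_dihedral _ s) => [|f].
  by apply/eqP => s1; apply: xy; rewrite -sx s1.
case: (xyP (val f x) (aut_stabiliser f x)) => fx; [left|right].
  exact: (@aut_eq _ _ _ x).
by apply: (@aut_eq _ _ _ x); rewrite fx sx.
Qed.

Lemma named_map_aut_two c :
  (exists k, [/\ in_shape (name_shape c) k, k <> origin (name_shape c),
     stabiliser (chain_origin (name_shape c) : model c) =
     stabiliser (flag_at (name_type c) (name_shape c) k) &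
     forall z : model c, stabiliser z = stabiliser (chain_origin (name_shape c) : model c) ->
       position z = origin (name_shape c) \/ position z = k]) ->
  isogroup (Aut (named_map c)) (dihedral (@Fin 1 isT)).
Proof.
move=> [k [kin k0 sk zk]]; have [f [bf fe]] := model_iso c.
have fI := bij_inj bf; have [g fK gK] := bf.
apply: (@aut_two _ (f (chain_origin _)) (f (flag_at _ _ k))).
- by move/fI/(congr1 position); rewrite position_flag_at // => /esym.
- by rewrite !(stabiliser_inj _ fe fI).
move=> z; rewrite -[z]gK !(stabiliser_inj _ fe fI) => /zk[zE|zE]; [left|right];
  congr f; apply: position_inj; rewrite zE //.
by rewrite position_flag_at.
Qed.

Lemma named_map_aut c :
  match c with
  | nN1 => forall f : Aut (named_map c), f = 1
  | _ => exists n : xnat, isogroup (Aut (named_map c)) (dihedral n)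
  end.
Proof.
have closed d n : name_shape d = Closed n ->
    map_subgroup d = normal_closure [set: Gamma] ([set rho (name_type d)] `|` rotation_power n) ->
    exists n : xnat, isogroup (Aut (named_map d)) (dihedral n).
  move=> dn dH; exists n; have [f [bf fe]] := model_iso d.
  have fI := bij_inj bf; have [g fK gK] := bf.
  apply: (@aut_dihedral (name_type d) n _ (f (chain_origin _))).
  - exact: free_type_iso (model_iso d) (@model_free d).
  - move=> x y; rewrite -[x]gK -[y]gK !(stabiliser_inj _ fe fI).
    move: (g x) (g y); rewrite /model dn; exact: closed_stabiliser.
  - by rewrite (stabiliser_inj _ fe fI) -dH map_subgroup_chain.
have two d lo : name_shape d = Interval lo 1 ->
    exists n : xnat, isogroup (Aut (named_map d)) (dihedral n).
  move=> dn; exists (@Fin 1 isT); apply: named_map_aut_two.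
  exists (lo%:Z + 1)%R; rewrite /model dn; split=> [|||z _]; rewrite /in_shape /=.
  - lia.
  - lia.
  - exact: two_stabiliser.
  - by have := position_range z; rewrite /in_shape; lia.
have four d : name_shape d = Interval 1 3 ->
    exists n : xnat, isogroup (Aut (named_map d)) (dihedral n).
  move=> dn; exists (@Fin 1 isT); apply: named_map_aut_two.
  exists 4%R; rewrite /model dn /=; split=> //.
    by apply/four_stabiliser; right; rewrite position_flag_at.
  by move=> z /four_stabiliser; rewrite position_origin /=; lia.
case: c => [n|n||||||]; [exact: (closed (nA n))|exact: (closed (nAcirc n))| | | | | |];
  [|exact: (two nN2star 1%N erefl)|exact: (two nN2P 1%N erefl)|exact: (two nD 0%N erefl)
  |exact: (four nM2star0 erefl)|exact: (four nM2P0 erefl)].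
move=> f; have [h [[g hK gK] he]] := model_iso nN1.
have zero (z : chain false (Interval 0 0)) : position z = 0%R.
  by have := position_range z; rewrite /=; lia.
apply: (@aut_eq _ _ _ (h (chain_origin _))); apply: (can_inj gK); apply: position_inj.
exact: etrans (zero _) (esym (zero _)).
Qed.

Local Open Scope ring_scope.

(** * Coordinates on the triangle of a flag *)

Section Coordinates.
Variable R : realType.
Implicit Types t : 'rV[R]_3.

Lemma simplexP t : simplex t <->
  [/\ 0 <= t ord0 i0, 0 <= t ord0 i1, 0 <= t ord0 i2 &
      t ord0 i0 + t ord0 i1 + t ord0 i2 = 1].
Proof.
rewrite /simplex /= !big_ord_recl big_ord0 addr0 addrA.
have -> : lift ord0 ord0 = i1 :> 'I_3 by apply: val_inj.
have -> : lift ord0 (lift ord0 ord0) = i2 :> 'I_3 by apply: val_inj.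
have -> : ord0 = i0 :> 'I_3 by apply: val_inj.
split=> [[t_ge0 t1]|[t0 t1 t2 tE]]; first by split.
by split=> //; elim/ord3_ind.
Qed.

Lemma bary_ext t t' : t ord0 i0 = t' ord0 i0 -> t ord0 i1 = t' ord0 i1 ->
  t ord0 i2 = t' ord0 i2 -> t = t'.
Proof. by move=> e0 e1 e2; apply/rowP; elim/ord3_ind. Qed.

Definition bary (a b c : R) : 'rV[R]_3 :=
  \row_i (if val i is 0 then a else if val i is 1 then b else c).

Lemma baryE a b c : (bary a b c ord0 i0 = a) * (bary a b c ord0 i1 = b) *
  (bary a b c ord0 i2 = c).
Proof. by rewrite /bary !mxE. Qed.

(** The union of the triangles of a chain is swept out by a segment that rotates
    about the pole t_0 = 1 and, when R0 acts as R2, also about the pole t_2 = 1.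
    The height tells the circle or parallel on which a point lies, the width is
    the length of the part of it in one triangle, and the lateral coordinate is the
    distance from the side glued by R2, opposite to the side glued by R1. *)
Definition width (b : bool) (h : R) : R := if b then 1 - `|h| else h.

Definition height (b : bool) t : R :=
  if b then t ord0 i0 - t ord0 i2 else t ord0 i1 + t ord0 i2.

Definition lateral (b : bool) t : R :=
  if b then width b (height b t) - t ord0 i1 else t ord0 i2.

Definition pole (b : bool) t : Prop := t ord0 i0 = 1 \/ b /\ t ord0 i2 = 1.

Definition side2 (b : bool) t : Prop := t ord0 i2 = 0 \/ b /\ t ord0 i0 = 0.

Lemma lateral_bounds b t : simplex t -> 0 <= lateral b t <= width b (height b t).
Proof.
move=> /simplexP[t0 t1 t2 tE]; rewrite /lateral /width /height.
case: b; last by apply/andP; split; lra.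
by case: (ger0P (t ord0 i0 - t ord0 i2)) => ?; apply/andP; split; lra.
Qed.

Lemma width_pole b t : simplex t -> width b (height b t) = 0 <-> pole b t.
Proof.
move=> /simplexP[t0 t1 t2 tE]; rewrite /width /height /pole.
case: b; last by split=> [?|[?|[]//]]; [left|]; lra.
case: (ger0P (t ord0 i0 - t ord0 i2)) => ?; split=> [?|[?|[_ ?]]];
  by [lra|left; lra|right; split=> //; lra].
Qed.

Lemma lateral_side2 b t : simplex t -> lateral b t = 0 <-> side2 b t.
Proof.
move=> /simplexP[t0 t1 t2 tE]; rewrite /lateral /width /height /side2.
case: b; last by split=> [?|[?|[]//]]; [left|]; lra.
case: (ger0P (t ord0 i0 - t ord0 i2)) => ?; split=> [?|[?|[_ ?]]];
  by [lra|left; lra|right; split=> //; lra].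
Qed.

Lemma lateral_side1 b t : simplex t ->
  lateral b t = width b (height b t) <-> t ord0 i1 = 0.
Proof.
move=> /simplexP[t0 t1 t2 tE]; rewrite /lateral /width /height.
by case: b; split=> ?; lra.
Qed.

Lemma coordinates_inj b t t' : simplex t -> simplex t' ->
  height b t = height b t' -> lateral b t = lateral b t' -> t = t'.
Proof.
move=> /simplexP[t0 t1 t2 tE] /simplexP[t0' t1' t2' tE'].
rewrite /lateral /height; case: b => hE; rewrite ?hE => vE;
  by apply: bary_ext; lra.
Qed.

Definition height_range (b : bool) (h : R) : Prop := if b then -1 <= h <= 1 else 0 <= h <= 1.

Lemma height_bounds b t : simplex t -> height_range b (height b t).
Proof.
move=> /simplexP[t0 t1 t2 tE]; rewrite /height_range /height.
by case: b; apply/andP; split; lra.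
Qed.

Lemma width_ge0 b h : height_range b h -> 0 <= width b h.
Proof.
rewrite /height_range /width; case: b => /andP[h0 h1] //.
by rewrite subr_ge0 ler_norml h0 h1.
Qed.

Lemma coordinates_exist b h v : height_range b h -> 0 <= v <= width b h ->
  exists t, [/\ simplex t, height b t = h & lateral b t = v].
Proof.
rewrite /height_range /width; case: b => /andP[h0 h1] /andP[v0 v1].
  have [hn hp] : h <= `|h| /\ - h <= `|h| by rewrite ler_norm -normrN ler_norm.
  (* s is t_0 + t_2, which is at least |h| = |t_0 - t_2|. *)
  pose s := `|h| + v.
  exists (bary ((s + h) / 2) (1 - s) ((s - h) / 2)).
  have hE : (s + h) / 2 - (s - h) / 2 = h by field.
  split; first by apply/simplexP; rewrite !baryE /s; split; lra.
    by rewrite /height !baryE hE.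
  by rewrite /lateral /height /width !baryE hE /s; lra.
exists (bary (1 - h) (h - v) v); split.
- by apply/simplexP; rewrite !baryE; split; lra.
- by rewrite /height !baryE; lra.
- by rewrite /lateral baryE.
Qed.

(** Position along a circle or parallel on which each segment has length w; the
    lateral coordinate v is measured from the even end of the segment k, which is
    its upper end if k is odd. *)
Definition sweep (w v : R) (k : int) : R :=
  if (k %% 2)%Z == 0 then k%:~R * w + v else (k + 1)%:~R * w - v.

Lemma sweep_bounds w v k : 0 <= v <= w ->
  k%:~R * w <= sweep w v k <= (k%:~R + 1) * w.
Proof.
move=> /andP[v0 vw]; rewrite /sweep; case: ifP => _; rewrite ?intrD;
  by apply/andP; split; lra.
Qed.

Lemma sweep_shift w v k j : (j %% 2)%Z = 0 ->
  sweep w v (k + j) = sweep w v k + j%:~R * w.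
Proof.
move=> j2; rewrite /sweep (_ : ((k + j) %% 2)%Z = (k %% 2)%Z); last by lia.
by case: ifP => _; rewrite !intrD; ring.
Qed.

Lemma sweep_mirror0 w c k : sweep w (if c then 0 else w) (mirror c k) =
  sweep w (if c then 0 else w) k.
Proof.
by rewrite /sweep /mirror; case: c; case: (boolP ((k %% 2)%Z == 0)) => k2 /=;
  rewrite (_ : (_ == 0) = ~~ ((k %% 2)%Z == 0)) ?k2 ?(negPf k2) /=; try lia;
  rewrite !intrD; ring.
Qed.

Lemma parityS (k : int) : (((k + 1) %% 2)%Z == 0) = ~~ ((k %% 2)%Z == 0).
Proof. by lia. Qed.

Lemma mirrorE c (k : int) :
  mirror c k = if ((k %% 2)%Z == 0) == c then k - 1 else k + 1.
Proof. by []. Qed.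

(** Each position lies in the closed segment given by the bounds above, and closed
    segments of the line that meet are equal or adjacent. *)
Lemma sweep_eq w v v' k k' : 0 < w -> 0 <= v <= w -> 0 <= v' <= w ->
  sweep w v k = sweep w v' k' ->
  v = v' /\ (k = k' \/ exists c, v = (if c then 0 else w) /\ k' = mirror c k).
Proof.
move=> w0 vw vw' E.
have /andP[b1 b2] := sweep_bounds k vw; have /andP[b1' b2'] := sweep_bounds k' vw'.
have le1 : (k <= k' + 1)%R.
  rewrite -(ler_int R) intrD -(ler_pM2r w0); lra.
have le2 : (k' <= k + 1)%R.
  rewrite -(ler_int R) intrD -(ler_pM2r w0); lra.
case/andP: vw => v0 vw; case/andP: vw' => v0' vw'; move: E.
have [->|[kE|kE]] : (k' = k \/ k' = k + 1 \/ k = k' + 1)%R by lia.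
- by rewrite /sweep; case: ifP => _ E; split; [lra|left|lra|left].
- rewrite kE /sweep parityS; case: (boolP ((k %% 2)%Z == 0)) => k2 /=;
    rewrite !intrD => E; split; [lra|right|lra|right].
    by exists false; rewrite mirrorE k2; split=> //; lra.
  by exists true; rewrite mirrorE (negPf k2); split=> //; lra.
- rewrite kE /sweep parityS; case: (boolP ((k' %% 2)%Z == 0)) => k2 /=;
    rewrite !intrD => E; split; [lra|right|lra|right].
    by exists false; rewrite mirrorE parityS k2 addrK; split=> //; lra.
  by exists true; rewrite mirrorE parityS k2 addrK; split=> //; lra.
Qed.

End Coordinates.

(** * Gluing in a chain *)

(** For the line and for rows with walls no two positions are identified. *)
Definition period (s : chain_shape) : int := if s is Closed (Fin n _) then n%:Z * 2 else 0.

Lemma position_mod b s (x y : chain b s) j : position x = position y + j * period s -> x = y.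
Proof.
have := position_range x; have := position_range y; rewrite /in_shape /period.
case: s x y => [[n n_gt0|]|lo m] x y xin yin xy; apply: position_inj; try lia.
suff -> : position x = position y by [].
have [j0|[j1|j1]] : (j = 0 \/ 1 <= j \/ j <= -1)%R by lia.
- by rewrite xy j0; lia.
- by nia.
- by nia.
Qed.

(** The second case is a wall, where the reflection leads out of the row. *)
Lemma position_act b s c (x : chain b s) :
  (exists j, mirror c (position x) = position (act x (gen (if c then i2 else i1))) + j * period s)
  \/ (act x (gen (if c then i2 else i1)) = x /\
      forall (y : chain b s) j, mirror c (position x) <> position y + j * period s).
Proof.
have := position_range x; have xE := position_step c x.
case: s x xE => [[n n_gt0|]|lo m] x xE; rewrite /in_shape => xin.
- left; rewrite xE /step /period /=.
  case: ifP => _; first by exists (-1); ring.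
  by case: ifP => _; [exists 0; ring|exists 1; ring].
- by left; exists 0; rewrite xE mul0r addr0.
case: (boolP (in_shape (Interval lo m) (mirror c (position x)))) => kin.
  by left; exists 0; rewrite xE /step /fold_back kin mul0r addr0.
right; split; first by apply: position_inj; rewrite xE /step /fold_back (negPf kin).
move=> y j kE; move/negP: kin; apply; rewrite kE /period mulr0 addr0.
exact: position_range.
Qed.

Section Gluing.
Variable R : realType.
Implicit Types t : 'rV[R]_3.

Lemma glue_refl (M : Map) (x : M) t : glue_orbit x t x.
Proof. by exists 1%g; [case: (generated_subgroup [set gen i | i in [set i | t ord0 i = 0]])|rewrite act1]. Qed.

Lemma glue_gen (M : Map) (x y : M) t i :
  t ord0 i = 0 -> glue_orbit x t y -> glue_orbit x t (act y (gen i)).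
Proof.
move=> ti [g gt <-]; exists (g * gen i)%g; last by rewrite actM.
case: (generated_subgroup [set gen i | i in [set i | t ord0 i = 0]]) => _ gM _.
by apply: gM => //; apply: sub_generated; exists i.
Qed.

Lemma glue_ind (M : Map) (x : M) t (P : M -> Prop) :
  P x -> (forall y i, t ord0 i = 0 -> P y -> P (act y (gen i))) ->
  forall y, glue_orbit x t y -> P y.
Proof.
move=> Px Pi; apply: flag_orbit_ind => // _ y [i ti <-]; split=> [|Py].
  by move/(Pi _ _ ti); rewrite act_gen2.
exact: Pi.
Qed.

Variables (b : bool) (s : chain_shape).

(** Away from the poles t lies on at most one of the sides glued by R1 and R2, so
    that at most two flags meet there. *)
Lemma glueP (x y : chain b s) t : simplex t ->
  glue_orbit x t y <->
  [\/ pole b t, y = x, t ord0 i1 = 0 /\ y = act x R1 | side2 b t /\ y = act x R2].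
Proof.
move=> st; have /simplexP[t0 t1 t2 tE] := st.
have R0t (z : chain b s) : b -> act z R0 = act z R2.
  by move=> bt; rewrite chain_free_type bt.
have R0f (z : chain b s) : ~~ b -> act z R0 = z.
  by move=> /negPf bf; rewrite chain_free_type bf.
have bP : b \/ ~~ b by apply/orP; case: (b).
split=> [|[pt|->|[t10 ->]|[]]]; last first.
- case=> [t20|[bt t00]] ->; first exact: glue_gen t20 (glue_refl _ _).
  have -> : act x R2 = act x R0 by rewrite R0t.
  exact: glue_gen t00 (glue_refl _ _).
- exact: glue_gen t10 (glue_refl _ _).
- exact: glue_refl.
- apply: (@flag_ind _ x) => [|z i xz]; first exact: glue_refl.
  case: pt => [t01|[bt t21]].
    have [t10 t20] : t ord0 i1 = 0 /\ t ord0 i2 = 0 by split; lra.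
    elim/ord3_ind: i; [|exact: glue_gen t10 xz|exact: glue_gen t20 xz].
    by have [bt|bf] := bP; [rewrite R0t //; apply: glue_gen t20 xz|rewrite R0f].
  have [t10 t00] : t ord0 i1 = 0 /\ t ord0 i0 = 0 by split; lra.
  elim/ord3_ind: i; [exact: glue_gen t00 xz|exact: glue_gen t10 xz|].
  have <- : act z R0 = act z R2 by rewrite R0t.
  exact: glue_gen t00 xz.
have [pt|npt] := pselect (pole b t); first by move=> _; apply: Or41.
have excl : t ord0 i1 = 0 -> ~ side2 b t.
  move=> t10 [t20|[bt t00]]; apply: npt; first by left; lra.
  by right; split=> //; lra.
move: y; apply: glue_ind; first exact: Or42.
have R2case z : side2 b t ->
    [\/ pole b t, z = x, t ord0 i1 = 0 /\ z = act x R1 | side2 b t /\ z = act x R2] ->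
    [\/ pole b t, act z R2 = x, t ord0 i1 = 0 /\ act z R2 = act x R1 |
        side2 b t /\ act z R2 = act x R2].
  move=> s2 [//|->|[/excl//]|[_ ->]]; first exact: Or44.
  by rewrite act_gen2; apply: Or42.
move=> z; elim/ord3_ind => ti.
- by have [bt|bf] := bP; [rewrite R0t //; apply: R2case; right|rewrite R0f].
- case=> [//|->|[_ ->]|[s2 _]]; first exact: Or43.
    by rewrite act_gen2; apply: Or42.
  by case: (excl ti).
- by apply: R2case; left.
Qed.

Definition reach t (x : chain b s) : R :=
  sweep (width b (height b t)) (lateral b t) (position x).

Lemma reach_pole t x : simplex t -> width b (height b t) = 0 -> reach t x = 0.
Proof.
move=> st w0; have := lateral_bounds b st; rewrite /reach /sweep w0 => v0.
by case: ifP => _; lra.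
Qed.

(** On the side with lateral coordinate 0 a flag meets its image under R2, and on
    the opposite side its image under R1, in agreement with the reflections of the
    line; at a pole all flags meet and the width vanishes. *)
Lemma chart_inj (x y : chain b s) t t' : simplex t -> simplex t' ->
  (t = t' /\ glue_orbit x t y) <->
  height b t = height b t' /\
  exists j : int, reach t x = reach t' y + (j * period s)%:~R * width b (height b t).
Proof.
move=> st st'.
have even j : ((j * period s) %% 2)%Z = 0.
  by rewrite /period; case: (s) => [[n ?|]|lo m]; lia.
have shift (z : chain b s) j :
    reach t z + (j * period s)%:~R * width b (height b t) =
    sweep (width b (height b t)) (lateral b t) (position z + j * period s).
  by rewrite sweep_shift.
have [w0|w_neq0] := eqVneq (width b (height b t)) 0.
  have pt := (width_pole b st).1 w0.
  split=> [[tt' _]|[hE _]].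
    by rewrite -tt'; split=> //; exists 0; rewrite !reach_pole // w0 mulr0 addr0.
  split; last by apply/glueP => //; apply: Or41.
  apply: (coordinates_inj st st' hE).
  have := lateral_bounds b st; have := lateral_bounds b st'; rewrite -hE w0; lra.
have w_gt0 : 0 < width b (height b t).
  by rewrite lt_neqAle eq_sym w_neq0 width_ge0 //; apply: height_bounds.
have vt := lateral_bounds b st; have vt' := lateral_bounds b st'.
split=> [[<- /(glueP _ _ st)xy]|[hE [j]]].
  split=> //.
  have side c : lateral b t = (if c then 0 else width b (height b t)) ->
      y = act x (gen (if c then i2 else i1)) ->
      exists j : int, reach t x = reach t y + (j * period s)%:~R * width b (height b t).
    move=> lE yE; have [[j jE]|[xc _]] := position_act c x; last first.
      by exists 0; rewrite mul0r mul0r addr0 yE xc.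
    exists j; rewrite shift yE -jE /reach lE.
    by have := sweep_mirror0 (width b (height b t)) c (position x); case: (c).
  case: xy => [/(width_pole b st) w0|->|[t10 yE]|[t20 yE]].
  - by rewrite w0 eqxx in w_neq0.
  - by exists 0; rewrite mul0r mul0r addr0.
  - by apply: (side false) => //; apply/lateral_side1.
  - by apply: (side true) => //; apply/lateral_side2.
have -> : reach t' y = sweep (width b (height b t)) (lateral b t') (position y).
  by rewrite /reach hE.
rewrite -sweep_shift // => E; rewrite -hE in vt'.
have [lE xy] := sweep_eq w_gt0 vt vt' E.
have tt' : t = t' by apply: (coordinates_inj st st' hE).
split=> //; apply/(glueP _ _ st); case: xy => [xy|[c [lc yx]]].
  by apply: Or42; apply/esym; apply: position_mod xy.
have yE : y = act x (gen (if c then i2 else i1)).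
  have [[i iE]|[_ /(_ y j)]] := position_act c x; last first.
    by rewrite yx.
  by apply: (@position_mod b s _ _ (i - j)); move: yx; rewrite iE mulrBl; lia.
case: c lc {yx} yE => lc yE; [apply: Or44|apply: Or43]; split=> //.
  exact/(lateral_side2 b st).
exact/(lateral_side1 b st).
Qed.

End Gluing.

Lemma finite_positions b s (B : nat) :
  finite_set [set x : chain b s | `|position x| <= B%:Z].
Proof.
apply: (@sub_finite_set _ _
  ((fun i : nat => flag_at b s (i%:Z - B%:Z)) @` `I_(B + B).+1)); last first.
  exact/finite_image/finite_II.
move=> x /= xB; exists (absz (position x + B%:Z)); first by rewrite /=; lia.
by rewrite -[RHS]flag_at_position; congr flag_at; lia.
Qed.

Lemma chain_bounded b s : s <> Closed Inf ->
  exists B : nat, forall x : chain b s, `|position x| <= B%:Z.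
Proof.
case: s => [[n n_gt0|]|lo m] // _.
  by exists (n * 2)%N => y; have := position_range y; rewrite /in_shape; lia.
by exists (lo + m)%N => y; have := position_range y; rewrite /in_shape; lia.
Qed.

Lemma finite_chain b s : s <> Closed Inf -> finite_set [set: chain b s].
Proof.
move=> /(@chain_bounded b)[B xB].
by apply: sub_finite_set (@finite_positions b s B) => x _ /=.
Qed.

Lemma infinite_line b : infinite_set [set: chain b (Closed Inf)].
Proof.
move=> fin; apply: infinite_nat.
have := finite_image (fun x : chain b (Closed Inf) => absz (position x)) fin.
apply: sub_finite_set => n _; exists (flag_at b (Closed Inf) n%:Z) => //.
by rewrite position_flag_at.
Qed.

Lemma segment_floor (R : realType) (u w : R) : 0 < w ->
  (Num.floor (u / w))%:~R * w <= u < ((Num.floor (u / w))%:~R + 1) * w.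
Proof.
move=> w_gt0; rewrite -ler_pdivlMr // -ltr_pdivrMr // -(intrD _ _ 1).
exact: floor_itv.
Qed.

Section Realised.
Variables (R : realType) (b : bool) (s : chain_shape).
Implicit Types t : 'rV[R]_3.

(** The centre of a face with infinitely many flags is an ideal point. *)
Definition visible (h : R) : Prop :=
  height_range b h /\ (b -> s = Closed Inf -> h <> -1).

Lemma glue_finite (x : chain b s) t :
  simplex t -> finite_set (glue_orbit x t) <-> (s = Closed Inf -> ~ pole b t).
Proof.
move=> st; split=> [fin sI pt|fin].
  have: finite_set [set: chain b s].
    by apply: sub_finite_set fin => y _; apply/glueP => //; apply: Or41.
  by rewrite sI; apply: infinite_line.
have [sI|sI] := pselect (s = Closed Inf); last first.
  by apply: sub_finite_set (finite_chain b sI).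
apply: (@sub_finite_set _ _ ([set x; act x R1] `|` [set act x R2])).
  move=> y /(glueP _ _ st)[/(fin sI)//|->|[_ ->]|[_ ->]]; last by right.
    by left; left.
  by left; right.
by rewrite !finite_setU; split; [split|]; apply: finite_set1.
Qed.

Lemma ordinaryP (x : chain b s) t :
  ordinary x t <-> simplex t /\ (s = Closed Inf -> width b (height b t) <> 0).
Proof.
split=> [[st /(glue_finite _ st)fin]|[st fin]]; split=> //.
  by move=> /fin npt /(width_pole b st).
by apply/glue_finite => // /fin w0 /(width_pole b st).
Qed.

Lemma realisedP (x : chain b s) t : realised x t <-> simplex t /\ visible (height b t).
Proof.
split=> [[st fin]|[st [_ vt]]]; split=> //.
  split; first exact: height_bounds.
  move=> bt sI hE; have /simplexP[t0 t1 t2 tE] := st.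
  have t21 : t ord0 i2 = 1 by move: hE; rewrite /height bt; lra.
  by have /(glue_finite _ st)/(_ sI) := fin t21; apply; right.
move=> t21; apply/(glue_finite _ st) => sI; have /simplexP[t0 t1 t2 tE] := st.
case=> [|[bt _]]; first by lra.
by apply: (vt bt sI); rewrite /height bt; lra.
Qed.

Definition in_range (u h : R) : Prop :=
  match s with
  | Closed Inf => width b h = 0 -> u = 0
  | Closed (Fin n _) => 0 <= u <= n%:R * 2 * width b h
  | Interval lo m => lo%:R * width b h <= u <= (lo%:R + m%:R + 1) * width b h
  end.

Lemma reach_in_range (x : chain b s) t : simplex t -> in_range (reach t x) (height b t).
Proof.
move=> st; have vt := lateral_bounds b st; have w0 := width_ge0 (height_bounds b st).
have /andP[r1 r2] := sweep_bounds (position x) vt; rewrite -/(reach t x) in r1 r2.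
have := position_range x; rewrite /in_range /in_shape.
have le_int (k l : int) : k <= l -> k%:~R * width b (height b t) <= l%:~R * width b (height b t).
  by move=> kl; apply: ler_wpM2r => //; rewrite ler_int.
case: s x r1 r2 => [[n n_gt0|]|lo m] x r1 r2 xin.
- have := le_int 0 (position x); have := le_int (position x + 1) (n%:Z * 2).
  rewrite !intrD intrM => h1 h2; apply/andP; split.
    by apply: le_trans r1; rewrite -[leLHS](mul0r (width b (height b t))) h2 //; lia.
  by apply: (le_trans r2); apply: h1; lia.
- by move=> wE; move: r1 r2; rewrite wE; lra.
- have := le_int lo (position x); have := le_int (position x + 1) (lo%:Z + m%:Z + 1).
  rewrite !intrD => h1 h2; apply/andP; split.
    by apply: le_trans r1; apply: h2; lia.
  by apply: (le_trans r2); apply: h1; lia.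
Qed.

Lemma chart_surj (u h : R) : height_range b h -> in_range u h ->
  exists (x : chain b s) t, [/\ simplex t, height b t = h & reach t x = u].
Proof.
move=> hr ur; have w_ge0 := width_ge0 hr; pose w := width b h.
have [w0|w_neq0] := eqVneq w 0.
  have [|t [st ht vt]] := @coordinates_exist R b h 0 hr; first by rewrite -/w w0 lexx.
  exists (chain_origin s), t; split=> //; rewrite reach_pole ?ht //.
  move: ur; rewrite /in_range -/w w0; case: (s) => [[n _|]|lo m] => [|->//|];
    by rewrite !mulr0 => /andP[? ?]; lra.
have w_gt0 : 0 < w by rewrite lt_neqAle eq_sym w_neq0.
suff [k kin kb] : exists2 k, in_shape s k & k%:~R * w <= u <= (k%:~R + 1) * w.
  pose v := if (k %% 2)%Z == 0 then u - k%:~R * w else (k%:~R + 1) * w - u.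
  have [|t [st ht vt]] := @coordinates_exist R b h v hr.
    by rewrite -/w /v; move: kb => /andP[? ?]; case: ifP => _; apply/andP; split; lra.
  exists (flag_at b s k), t; split=> //.
  rewrite /reach ht vt position_flag_at // /sweep /v /w.
  by case: ifP => k2; rewrite ?intrD; [rewrite ifT|rewrite ifF] => //; ring.
(* At the end hi of the row the floor would be one too large. *)
have seg (lo hi : int) : lo < hi -> lo%:~R * w <= u <= hi%:~R * w ->
    exists2 k, lo <= k < hi & k%:~R * w <= u <= (k%:~R + 1) * w.
  move=> lohi /andP[ulo uhi]; have [uE|u_lt] := leP (hi%:~R * w) u.
    exists (hi - 1); first by lia.
    by rewrite intrB; apply/andP; split; lra.
  have kb := segment_floor u w_gt0; exists (Num.floor (u / w)); last first.
    by case/andP: kb => -> /ltW.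
  case/andP: kb => k1 k2; have := le_lt_trans k1 u_lt; have := le_lt_trans ulo k2.
  rewrite -(intrD _ _ 1) !ltr_pM2r // !ltr_int; lia.
move: ur; rewrite /in_range -/w /in_shape; case: (s) => [[n n_gt0|]|lo m] ur.
- have [||k kn kb] := seg 0 (n%:Z * 2); [lia| |by exists k].
  by rewrite mul0r intrM.
- by have /andP[k1 /ltW k2] := segment_floor u w_gt0; exists (Num.floor (u / w)); rewrite ?k1.
- have [||k kn kb] := seg lo (lo%:Z + m%:Z + 1); [lia| |by exists k => //; lia].
  by rewrite !intrD.
Qed.

End Realised.

(** * Surfaces swept out by a chain *)

Lemma pair_continuous (T U V : topologicalType) (f : T -> U) (g : T -> V) (x : T) :
  {for x, continuous f} -> {for x, continuous g} ->
  {for x, continuous (fun y => (f y, g y))}.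
Proof.
by move=> cf cg; apply: (@cvg_pair _ _ _ (nbhs x) (nbhs (f x)) (nbhs (g x)) _ _ _ f g).
Qed.

Section ContinuousPointwise.
Variables (R : realType) (T : topologicalType) (f g : T -> R) (x : T).
Hypotheses (cf : {for x, continuous f}) (cg : {for x, continuous g}).

Lemma contD : {for x, continuous (fun y => f y + g y)}.
Proof. exact: continuousD. Qed.

Lemma contB : {for x, continuous (fun y => f y - g y)}.
Proof. exact: continuousB. Qed.

Lemma contM : {for x, continuous (fun y => f y * g y)}.
Proof. exact: continuousM. Qed.

End ContinuousPointwise.

Section Swept.
Variables (R : realType) (b : bool) (s : chain_shape).
Implicit Types t : 'rV[R]_3.

Lemma coord_cont i : continuous (fun t => t ord0 i).
Proof. exact: coord_continuous. Qed.

Lemma height_cont : continuous (height b : 'rV[R]_3 -> R).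
Proof.
by rewrite /height; case: b => t; [apply: continuousB|apply: continuousD]; apply: coord_cont.
Qed.

Lemma width_cont : continuous (width b : R -> R).
Proof.
rewrite /width; case: b => h //; apply: continuousB; [exact: cst_continuous|exact: norm_continuous].
Qed.

Lemma width_height_cont : continuous (fun t => width b (height b t)).
Proof. by move=> t; apply: continuous_comp; [exact: height_cont|exact: width_cont]. Qed.

Lemma lateral_cont : continuous (lateral b : 'rV[R]_3 -> R).
Proof.
have wc := width_height_cont; rewrite /lateral; case: b wc => wc t; last exact: coord_cont.
exact: (@continuousB _ _ _ (fun t => width true (height true t)) (fun t => t ord0 i1) t (wc t) (@coord_cont i1 t)).
Qed.

Lemma reach_cont (x : chain b s) : continuous (fun t => reach t x).
Proof.
have mul (k : R) : continuous (fun t => k * width b (height b t)).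
  move=> t; exact: (@continuousM _ _ (fun=> k) _ t (@cst_continuous _ _ k t) (@width_height_cont t)).
move=> t; rewrite /reach /sweep; case: ((position x %% 2)%Z == 0).
  exact: (@continuousD _ _ _ _ _ t (mul _ t) (@lateral_cont t)).
exact: (@continuousB _ _ _ _ _ t (mul _ t) (@lateral_cont t)).
Qed.

Lemma simplex_compact : compact (@simplex R).
Proof.
apply: bounded_closed_compact.
  exists 1; split=> // M M1 t /simplexP[t0 t1 t2 tE].
  have M0 : 0 <= M by rewrite ltW // (lt_trans _ M1).
  rewrite /= [`|t|]mx_normrE.
  apply: bigmax_le => // -[i j] _ /=; rewrite (ord1 i).
  by elim/ord3_ind: j; rewrite ger0_norm //; lra.
have -> : @simplex R = [set t | 0 <= t ord0 i0] `&` [set t | 0 <= t ord0 i1] `&`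
    [set t | 0 <= t ord0 i2] `&` [set t | t ord0 i0 + t ord0 i1 + t ord0 i2 = 1].
  apply/seteqP; split=> t; first by move=> /simplexP[].
  by move=> [[[? ?] ?] ?]; apply/simplexP.
have ge0 i : closed [set t : 'rV[R]_3 | 0 <= t ord0 i].
  apply: (@preimage_closed _ _ (fun t : 'rV[R]_3 => t ord0 i) [set x | 0 <= x]).
    by move=> t _; apply: coord_cont.
  exact: closed_ge.
apply: closedI; first by apply: closedI; [apply: closedI|]; apply: ge0.
have sum_cont : continuous (fun t => t ord0 i0 + t ord0 i1 + t ord0 i2).
  move=> t; exact: contD (contD (@coord_cont i0 t) (@coord_cont i1 t)) (@coord_cont i2 t).
apply: (@preimage_closed _ _ (fun t : 'rV[R]_3 => t ord0 i0 + t ord0 i1 + t ord0 i2) [set 1]).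
  by move=> t _; apply: sum_cont.
exact: closed_eq.
Qed.

Variables (X : topologicalType) (S : set X) (Q : R * R -> X).
Hypothesis X_hausdorff : hausdorff_space X.
Hypothesis Q_cont : continuous Q.
Hypothesis Q_in : forall u h, visible b s h -> in_range b s u h -> S (Q (u, h)).
Hypothesis Q_surj : forall z, S z ->
  exists u h, [/\ visible b s h, in_range b s u h & Q (u, h) = z].
Hypothesis Q_inj : forall u h u' h', visible b s h -> in_range b s u h ->
  visible b s h' -> in_range b s u' h' ->
  Q (u, h) = Q (u', h') <->
  h = h' /\ exists j : int, u = u' + (j * period s)%:~R * width b h.
Hypothesis Q_proper : s = Closed Inf -> forall u h, visible b s h -> in_range b s u h ->
  width b h <> 0 -> exists c d : R, 0 < d /\ \forall z \near Q (u, h),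
    forall u' h', visible b s h' -> in_range b s u' h' -> Q (u', h') = z ->
    d <= width b h' /\ `|u'| <= c.

Definition swept (x : chain b s) t : X := Q (reach t x, height b t).

Lemma swept_cont x : continuous (swept x).
Proof.
move=> t; apply: (@continuous_comp _ _ _ (fun t => (reach t x, height b t)) Q).
  by apply: pair_continuous; [exact: reach_cont|exact: height_cont].
exact: Q_cont.
Qed.

Lemma swept_inj x y t t' : realised x t -> realised y t' ->
  swept x t = swept y t' <-> t = t' /\ glue_orbit x t y.
Proof.
move=> /realisedP[st vt] /realisedP[st' vt']; rewrite chart_inj // /swept Q_inj //;
  exact: reach_in_range.
Qed.

Lemma swept_surj z : S z -> exists (x : chain b s) t, realised x t /\ swept x t = z.
Proof.
move=> /Q_surj[u [h [vh uh <-]]]; have [x [t [st ht xt]]] := chart_surj vh.1 uh.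
exists x, t; split; first by apply/realisedP; rewrite ht.
by rewrite /swept xt ht.
Qed.

Definition thick (d : R) : set 'rV[R]_3 :=
  [set t | simplex t /\ d <= width b (height b t)].

Lemma thick_compact d : compact (thick d).
Proof.
apply: subclosed_compact simplex_compact _ => [|t []//].
apply: closedI; first exact: compact_closed (@norm_hausdorff _ _) simplex_compact.
apply: (@preimage_closed _ _ (fun t => width b (height b t)) [set x | d <= x]).
  by move=> t _; apply: width_height_cont.
exact: closed_ge.
Qed.

(** A row of finitely many flags needs no restriction; in an infinite row the bounds
    on the position and on the width bound the number of the segment. *)
Lemma swept_local (x : chain b s) t : ordinary x t -> exists (B : nat) (d : R),
  (forall (y : chain b s) t', thick d t' -> ordinary y t') /\
  \forall z \near swept x t, S z -> exists (y : chain b s) t',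
    [/\ `|position y| <= B%:Z, thick d t' & swept y t' = z].
Proof.
move=> /ordinaryP[st ot]; have [sI|sI] := pselect (s = Closed Inf); last first.
  have [B yB] := chain_bounded b sI.
  (* For a finite map the neighbourhood is everything. *)
  exists B, 0; split=> [y t' [st' _]|]; first by apply/ordinaryP.
  apply: nearW => z /swept_surj[y [t' [/realisedP[st' _] yz]]]; exists y, t'.
  by split=> //; split=> //; apply/width_ge0/height_bounds.
have vt : visible b s (height b t).
  split=> [|bt _ hE]; first exact: height_bounds.
  by apply: (ot sI); rewrite hE /width bt normrN1 subrr.
have [c [d [d_gt0 near_cd]]] := Q_proper sI vt (reach_in_range x st) (ot sI).
exists (Num.bound (c / d)).+1, d; split=> [y t' [st' dt']|].
  by apply/ordinaryP; split=> // _ w0; move: dt'; rewrite w0; lra.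
apply: filterS near_cd => z zP /swept_surj[y [t' [/realisedP[st' vt'] yz]]]; exists y, t'.
have [dw cu] := zP _ _ vt' (reach_in_range y st') yz.
split=> //; have /andP[r1 r2] := sweep_bounds (position y) (lateral_bounds b st').
rewrite -/(reach t' y) in r1 r2; set w := width b (height b t') in dw r1 r2.
have cdw : c < (Num.bound (c / d))%:R * w.
  have : c / d < (Num.bound (c / d))%:R.
    by apply: archi_boundP; rewrite divr_ge0 ?(ltW d_gt0) // (le_trans _ cu).
  rewrite ltr_pdivrMr // => /lt_le_trans; apply.
  by apply: ler_wpM2l.
have w_gt0 : 0 < w by apply: lt_le_trans dw.
move: cu; rewrite ler_norml => /andP[cu1 cu2].
have k1 : (position y)%:~R * w < (Num.bound (c / d))%:R * w by lra.
have k2 : - (Num.bound (c / d))%:R * w < ((position y)%:~R + 1) * w by lra.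
rewrite ltr_pM2r // in k1; rewrite ltr_pM2r // in k2.
have {}k1 : (position y < (Num.bound (c / d))%:Z)%R by rewrite -(ltr_int R).
have {}k2 : (- (Num.bound (c / d))%:Z < position y + 1)%R.
  by rewrite -(ltr_int R) intrN intrD.
lia.
Qed.

Lemma relatively_open (T : set X) :
  T `<=` S -> (forall z, T z -> \forall z' \near z, S z' -> T z') ->
  exists2 O, open O & T = O `&` S.
Proof.
move=> TS Tn; exists (interior [set z | S z -> T z]); first exact: open_interior.
apply/seteqP; split=> [z Tz|z [Oz Sz]].
  by split; [exact: Tn|exact: TS].
exact: nbhs_singleton Oz Sz.
Qed.

(** The image of a compatible family of open sets is open, since near each of its
    points the complement is covered by finitely many compact sets. *)
Lemma swept_open (W : chain b s -> set 'rV[R]_3) :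
  (forall x, exists2 O, open O & W x = O `&` ordinary x) ->
  (forall x y t, W x t -> glue_orbit x t y -> W y t) ->
  exists2 O, open O & \bigcup_(x in [set: chain b s]) (swept x @` W x) = O `&` S.
Proof.
move=> Wopen Wglue.
pose O x := projT1 (cid2 (Wopen x)).
have OP x : open (O x) /\ W x = O x `&` ordinary x.
  by rewrite /O; case: cid2 => A /= oA WA.
have ord_real (x : chain b s) t : ordinary x t -> realised x t.
  by move=> [st fin]; split.
apply: relatively_open => [_ [x _ [t Wt <-]]|_ [x _ [t Wt <-]]].
  have ot : ordinary x t by move: Wt; rewrite (OP x).2 => -[].
  have /realisedP[st vt] := ord_real _ _ ot.
  by apply: Q_in => //; apply: reach_in_range.
have ot : ordinary x t by move: Wt; rewrite (OP x).2 => -[].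
have [B [d [thick_ord nearB]]] := swept_local ot.
(* The parts of the nearby triangles outside the given open sets have compact image,
   and the point under consideration is not in it. *)
pose bad := \bigcup_(k in [set k : int | `|k| <= B%:Z])
  (swept (flag_at b s k) @` (thick d `&` ~` O (flag_at b s k))).
have bad_closed : closed bad.
  apply: closed_bigcup => [|k _].
    apply: (@sub_finite_set _ _ ((fun i : nat => i%:Z - B%:Z) @` `I_(B + B).+1)); last first.
      exact/finite_image/finite_II.
    by move=> k /= kB; exists (absz (k + B%:Z)); [rewrite /=|]; lia.
  apply: compact_closed => //; apply: continuous_compact.
    exact/continuous_subspaceT/swept_cont.
  apply: subclosed_compact (@thick_compact d) _ => [|t' []//].
  apply: closedI; first exact: compact_closed (@norm_hausdorff _ _) (@thick_compact d).
  by apply: open_closedC; case: (OP (flag_at b s k)).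
have near_bad : \forall z \near swept x t, ~ bad z.
  have : open (~` bad) by apply: closed_openC.
  rewrite openE; apply; move=> [k _ [t' [tt' nO] xt]].
  have real' := ord_real _ _ (thick_ord (flag_at b s k) _ tt').
  have [tE glue] := (swept_inj (ord_real _ _ ot) real').1 (esym xt).
  by apply: nO; have := Wglue _ _ _ Wt glue; rewrite tE (OP _).2 => -[].
near=> z => Sz.
have [|y [t' [yB tt' yz]]] := (near nearB z _) Sz; first by [].
exists y => //; exists t' => //; rewrite (OP y).2; split; last exact: thick_ord.
apply: contrapT => nO; apply: (near near_bad z _) => //.
exists (position y); first exact: yB.
by exists t'; rewrite ?flag_at_position.
Unshelve. all: by end_near.
Qed.

Lemma lies_on_swept : lies_on R (chain b s) S.
Proof.
exists swept; split.
- by move=> x; apply/continuous_subspaceT/swept_cont.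
- apply/seteqP; split=> [_ [x _ [t /realisedP[st vt] <-]]|z].
    by apply: Q_in => //; apply: reach_in_range.
  by move=> /swept_surj[x [t [rt <-]]]; exists x => //; exists t.
- by move=> x y t t'; apply: swept_inj.
- exact: swept_open.
Qed.

End Swept.

(** * Polar coordinates *)

Section Polar.
Variable R : realType.
Implicit Types (x y a c r th : R).

Lemma trig_period x (j : int) :
  cos (x + j%:~R * (pi *+ 2)) = cos x /\ sin (x + j%:~R * (pi *+ 2)) = sin x.
Proof.
have nat_period (z : R) (n : nat) : cos (z + n%:R * (pi *+ 2)) = cos z /\
    sin (z + n%:R * (pi *+ 2)) = sin z.
  by rewrite mulr_natl (periodicn (@cosD2pi R)) (periodicn (@sinD2pi R)).
case: j => n; first exact: nat_period.
have [<- <-] := nat_period (x + (Negz n)%:~R * (pi *+ 2)) n.+1.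
by rewrite NegzE mulrNz mulNr subrK.
Qed.

Lemma cos_eq1 x : 0 <= x < pi *+ 2 -> cos x = 1 -> x = 0.
Proof.
move=> /andP[x0 x2] cx; have pi0 := @pi_gt0 R; have [xpi|xpi] := leP x pi.
  by apply: cos_inj; rewrite ?cos0 // in_itv /= ?x0 ?lexx ?pi_ge0.
suff : pi *+ 2 - x = 0 by rewrite mulr2n in x2 *; lra.
apply: cos_inj; rewrite ?cos0 ?in_itv /= ?lexx ?pi_ge0 ?mulr2n //.
  by rewrite mulr2n in x2; apply/andP; split; lra.
by rewrite -cx -(cosN x) -(trig_period (- x) 1).1 mul1r addrC mulr2n.
Qed.

Lemma angle_eq x y : cos x = cos y -> sin x = sin y ->
  exists j : int, x = y + j%:~R * (pi *+ 2).
Proof.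
move=> cxy sxy; have pi0 : 0 < pi *+ 2 :> R by rewrite mulrn_wgt0 // pi_gt0.
pose j := Num.floor ((x - y) / (pi *+ 2)); exists j.
have := segment_floor (x - y) pi0; rewrite -/j => /andP[j1 j2].
suff : x - y + (- j)%:~R * (pi *+ 2) = 0 by rewrite intrN; lra.
apply: cos_eq1; first by rewrite intrN; apply/andP; split; lra.
by rewrite (trig_period _ _).1 cosB cxy sxy -!expr2 cos2Dsin2.
Qed.

Lemma polar_eq r r' x y : 0 <= r -> 0 <= r' ->
  r * cos x = r' * cos y -> r * sin x = r' * sin y ->
  r = r' /\ (r <> 0 -> exists j : int, x = y + j%:~R * (pi *+ 2)).
Proof.
move=> r0 r0' cE sE.
have rr' : r = r'.
  apply/eqP; rewrite -(@eqrXn2 _ 2) //.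
  rewrite -[r ^+ 2]mulr1 -[r' ^+ 2]mulr1 -{1}(cos2Dsin2 x) -(cos2Dsin2 y).
  by rewrite !mulrDr -!exprMn cE sE.
split=> // /eqP rn0; rewrite -rr' in cE sE.
by apply: angle_eq; [apply: (mulfI rn0)|apply: (mulfI rn0)].
Qed.

Lemma polar_exists a c r : 0 <= r -> r ^+ 2 = a ^+ 2 + c ^+ 2 ->
  exists th, [/\ 0 <= th <= pi *+ 2, (0 <= c -> th <= pi), a = r * cos th & c = r * sin th].
Proof.
move=> r0 rE; have pi0 := @pi_ge0 R.
have [r_eq0|rn0] := eqVneq r 0.
  have /eqP : a ^+ 2 + c ^+ 2 = 0 by rewrite -rE r_eq0 expr0n.
  rewrite paddr_eq0 ?sqr_ge0 // !sqrf_eq0 => /andP[/eqP -> /eqP ->].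
  by exists 0; rewrite r_eq0 !mul0r lexx mulrn_wge0.
have r_gt0 : 0 < r by rewrite lt_neqAle eq_sym rn0.
have r2_gt0 : 0 < r ^+ 2 by rewrite exprn_gt0.
have ar : -1 <= a / r <= 1.
  rewrite -ler_norml -(@ler_pXn2r _ 2) ?nnegrE // expr1n real_normK ?num_real //.
  by rewrite exprMn exprVn ler_pdivrMr // mul1r rE lerDl sqr_ge0.
have [/andP[t0 tpi] ct] := acos_def ar; set t := acos (a / r) in t0 tpi ct.
have aE : a = r * cos t by rewrite ct mulrCA divff // mulr1.
have st0 : 0 <= sin t by apply: sin_ge0_pi; rewrite t0.
have s2 : (r * sin t) ^+ 2 = c ^+ 2.
  have := cos2Dsin2 t; rewrite exprMn => H.
  have -> : sin t ^+ 2 = 1 - cos t ^+ 2 by lra.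
  by rewrite mulrBr mulr1 -exprMn -aE rE; ring.
have [c0|c0] := leP 0 c.
  exists t; split=> //; first by rewrite t0 mulr2n; lra.
  apply/esym/eqP; rewrite -(@eqrXn2 _ 2) ?s2 //; exact: mulr_ge0.
exists (pi *+ 2 - t); split.
- by rewrite mulr2n; apply/andP; split; lra.
- by lra.
- have := (trig_period (- t) 1).1; rewrite mul1r cosN addrC => ->; exact: aE.
have := (trig_period (- t) 1).2; rewrite mul1r sinN addrC => ->.
suff cE : - c = r * sin t by rewrite mulrN -cE opprK.
apply/eqP; rewrite -(@eqrXn2 _ 2) ?sqrrN ?s2 //; first by lra.
exact: mulr_ge0.
Qed.

(** A bounded oscillation does not harm continuity where the amplitude vanishes. *)
Lemma squeeze_continuous (T : topologicalType) (r u w : T -> R) (f : R -> R) :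
  continuous r -> continuous u -> continuous w -> continuous f ->
  (forall y, `|f y| <= 1) -> (forall p, w p = 0 -> r p = 0) ->
  continuous (fun p => r p * f (u p / w p)).
Proof.
move=> cr cu cw cf f1 wr p; have [wp|wp] := eqVneq (w p) 0; last first.
  have cuw : {for p, continuous (fun q => u q / w q)}.
    exact: contM (cu p) (continuousV wp (cw p)).
  exact: contM (cr p) (continuous_comp cuw (cf _)).
rewrite /continuous_at (wr p wp) mul0r; apply/cvgr0Pnorm_lt => e e0.
have /cvgr0Pnorm_lt /(_ e e0) : r q @[q --> p] --> 0.
  by have := cr p; rewrite /continuous_at (wr p wp).
apply: filterS => q; apply: le_lt_trans.
by rewrite normrM ler_piMr.
Qed.

End Polar.

(** * The disc and the sphere *)

Section Models.
Variable R : realType.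
Implicit Types (h u w q : R).

(** Radius of the circle in the disc, or of the parallel on the sphere, of height h. *)
Definition radius (b : bool) h : R := if b then Num.sqrt (1 - h ^+ 2) else h.

Lemma radius_ge0 b h : height_range b h -> 0 <= radius b h.
Proof. by rewrite /radius; case: b => [_|/andP[]//]; apply: sqrtr_ge0. Qed.

Lemma sqr_radius h : height_range true h -> radius true h ^+ 2 = 1 - h ^+ 2.
Proof.
move=> hr; rewrite sqr_sqrtr // subr_ge0.
by rewrite -[h ^+ 2]real_normK ?num_real // expr_le1 // ler_norml.
Qed.

Lemma width0_radius b h : width b h = 0 -> radius b h = 0.
Proof.
rewrite /width /radius; case: b => // /eqP; rewrite subr_eq0 => /eqP h1.
by rewrite -[h ^+ 2]real_normK ?num_real // -h1 expr1n subrr sqrtr0.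
Qed.

Lemma radius0_width b h : height_range b h -> radius b h = 0 -> width b h = 0.
Proof.
case: b => [hr r0|//]; have := sqr_radius hr; rewrite r0 expr0n /= => h1.
have : `|h| ^+ 2 = 1 by rewrite real_normK ?num_real //; lra.
by move/eqP; rewrite sqrp_eq1 // => /eqP hE; rewrite /width hE subrr.
Qed.

Lemma radius_cont b : continuous (radius b).
Proof.
rewrite /radius; case: b => h //.
have c : {for h, continuous (fun x : R => 1 - x ^+ 2)}.
  apply: contB; first exact: cst_continuous.
  exact: exprn_continuous.
by apply: continuous_comp c _; apply: sqrt_continuous.
Qed.

(** The row from lo to lo + N is bent through a total angle of A. *)
Definition turn (A lo N q : R) : R := A * ((q - lo) / N).

Lemma turn_cont A lo N : continuous (turn A lo N).
Proof.
move=> q; have c1 : {for q, continuous (fun x : R => x - lo)}.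
  by apply: contB; [exact: (fun U => id)|exact: cst_continuous].
have c2 : {for q, continuous (fun x : R => (x - lo) / N)}.
  exact: contM c1 (@cst_continuous _ _ N^-1 q).
exact: contM (@cst_continuous _ _ A q) c2.
Qed.

Section Turn.
Variables (A lo N w : R).
Hypotheses (A_gt0 : 0 < A) (N_gt0 : 0 < N) (w_gt0 : 0 < w).

Lemma turn_bounds u : lo * w <= u <= (lo + N) * w -> 0 <= turn A lo N (u / w) <= A.
Proof.
move=> /andP[u1 u2]; rewrite /turn; apply/andP; split.
  apply: mulr_ge0; first exact: ltW.
  by apply: divr_ge0; [rewrite subr_ge0 ler_pdivlMr|exact: ltW].
rewrite -[leRHS]mulr1 ler_pM2l // ler_pdivrMr // mul1r lerBlDl ler_pdivrMr //.
Qed.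

Lemma turn_eq u u' c : turn A lo N (u / w) = turn A lo N (u' / w) + c * A ->
  u = u' + c * N * w.
Proof.
have [A0 N0 w0] : [/\ A != 0, N != 0 & w != 0] by rewrite !gt_eqF.
rewrite /turn => E; have {}E : (u / w - lo) / N = (u' / w - lo) / N + c.
  by apply: (mulfI A0); rewrite E; ring.
have -> : u = ((u / w - lo) / N * N + lo) * w by field; rewrite N0 w0.
by rewrite E; field; rewrite N0 w0.
Qed.

Lemma turn_surj th : 0 <= th <= A ->
  exists2 u, lo * w <= u <= (lo + N) * w & turn A lo N (u / w) = th.
Proof.
move=> /andP[t0 tA]; exists ((lo + th / A * N) * w).
  have tA0 : 0 <= th / A by rewrite divr_ge0 // ltW.
  have tA1 : th / A <= 1 by rewrite ler_pdivrMr // mul1r.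
  have tN0 : 0 <= th / A * N by rewrite mulr_ge0 // ltW.
  have tN1 : th / A * N <= N by rewrite -[leRHS]mul1r ler_pM2r.
  by rewrite !ler_pM2r // lerDl lerD2l tN0.
by rewrite /turn mulfK ?gt_eqF // addrC addKr mulfK ?gt_eqF // mulrC divfK ?gt_eqF.
Qed.

End Turn.

(** At a pole the quotient is division by zero, but the radius vanishes. *)
Definition swirl b (A lo N : R) (p : R * R) : R * R :=
  (radius b p.2 * cos (turn A lo N (p.1 / width b p.2)),
   radius b p.2 * sin (turn A lo N (p.1 / width b p.2))).

Lemma fst_cont : continuous (fun p : R * R => p.1).
Proof. by move=> p; apply: cvg_fst. Qed.

Lemma snd_cont : continuous (fun p : R * R => p.2).
Proof. by move=> p; apply: cvg_snd. Qed.

Lemma swirl_cont b A lo N : continuous (swirl b A lo N).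
Proof.
have rc : continuous (fun p : R * R => radius b p.2).
  by move=> p; apply: continuous_comp (@snd_cont p) _; apply: radius_cont.
have wc : continuous (fun p : R * R => width b p.2).
  by move=> p; apply: continuous_comp (@snd_cont p) _; apply: width_cont.
have tc (f : R -> R) : continuous f -> continuous (fun q => f (turn A lo N q)).
  by move=> cf q; apply: continuous_comp (@turn_cont A lo N q) _; apply: cf.
have osc (f : R -> R) : continuous f -> (forall q, `|f q| <= 1) ->
    continuous (fun p : R * R => radius b p.2 * f (turn A lo N (p.1 / width b p.2))).
  move=> cf f1; apply: (@squeeze_continuous _ _ (fun p => radius b p.2) (fun p => p.1)
    (fun p => width b p.2) (fun q => f (turn A lo N q))) => //.
  - exact: fst_cont.
  - exact: tc.
  - by move=> q; apply: width0_radius.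
move=> p; apply: (pair_continuous (osc cos _ _ p) (osc sin _ _ p)).
- exact: continuous_cos.
- exact: cos_max.
- exact: continuous_sin.
- exact: sin_max.
Qed.

Lemma swirl_norm b A lo N p :
  (swirl b A lo N p).1 ^+ 2 + (swirl b A lo N p).2 ^+ 2 = radius b p.2 ^+ 2.
Proof. by rewrite /= !exprMn -mulrDr cos2Dsin2 mulr1. Qed.

End Models.

Section Surfaces.
Variable R : realType.
Implicit Types (u h : R) (b : bool).

Lemma width_gt0 b h : height_range b h -> width b h <> 0 -> 0 < width b h.
Proof.
by move=> hr /eqP w0; rewrite lt_neqAle eq_sym w0 width_ge0.
Qed.

Lemma width0_range b s u h : in_range b s u h -> width b h = 0 -> u = 0.
Proof.
rewrite /in_range => + w0; rewrite w0; case: s => [[n _|]|lo m]; last 2 first.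
- exact.
- by rewrite !mulr0 => /andP[? ?]; lra.
by rewrite !mulr0 => /andP[? ?]; lra.
Qed.

Section ClosedRow.
Variables (b : bool) (n : nat) (n_gt0 : (0 < n)%N).
Local Notation s := (Closed (Fin n_gt0)).
Definition closed_swirl : R * R -> R * R := swirl b (pi *+ 2) 0 (n%:R * 2).

Lemma closed_length_gt0 : 0 < n%:R * 2 :> R.
Proof. by rewrite mulr_gt0 // ltr0n. Qed.

Lemma full_turn_gt0 : 0 < pi *+ 2 :> R.
Proof. by rewrite mulrn_wgt0 // pi_gt0. Qed.

Lemma closed_swirl_inj u u' h : height_range b h ->
  in_range b s u h -> in_range b s u' h ->
  closed_swirl (u, h) = closed_swirl (u', h) <->
  exists j : int, u = u' + (j * period s)%:~R * width b h.
Proof.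
move=> hr ur ur'; have [w0|w0] := pselect (width b h = 0).
  rewrite (width0_range ur w0) (width0_range ur' w0); split=> // _.
  by exists 0; rewrite w0 mulr0 addr0.
have w_gt0 := width_gt0 hr w0; have r0 := radius_ge0 hr.
have pE (j : int) : (j * period s)%:~R = j%:~R * (n%:R * 2) :> R.
  by rewrite /period !intrM.
split=> [[cE sE]|[j ->]].
  have [_ []] := polar_eq r0 r0 cE sE; first by move/(radius0_width hr).
  move=> j /(turn_eq full_turn_gt0 closed_length_gt0 w_gt0) jE.
  by exists j; rewrite pE jE mulrA.
have tE : turn (pi *+ 2) 0 (n%:R * 2) ((u' + (j * period s)%:~R * width b h) / width b h) =
    turn (pi *+ 2) 0 (n%:R * 2) (u' / width b h) + j%:~R * (pi *+ 2).
  by rewrite /turn pE; field; rewrite !gt_eqF // ltr0n.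
by rewrite /closed_swirl /swirl /= tE !(trig_period _ _).1 !(trig_period _ _).2.
Qed.

Lemma closed_swirl_surj a c h : height_range b h -> a ^+ 2 + c ^+ 2 = radius b h ^+ 2 ->
  exists2 u, in_range b s u h & closed_swirl (u, h) = (a, c).
Proof.
move=> hr acE; have [w0|w0] := pselect (width b h = 0).
  exists 0; first by rewrite /in_range w0 mulr0 lexx.
  have r0 := width0_radius w0; move: acE; rewrite r0 expr0n /= => /eqP.
  rewrite paddr_eq0 ?sqr_ge0 // !sqrf_eq0 => /andP[/eqP -> /eqP ->].
  by rewrite /closed_swirl /swirl /= r0 !mul0r.
have [th [thA _ aE cE]] := polar_exists (radius_ge0 hr) (esym acE).
have [u ur uth] := turn_surj 0 full_turn_gt0 closed_length_gt0 (width_gt0 hr w0) thA.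
exists u; first by move: ur; rewrite mul0r add0r.
by rewrite /closed_swirl /swirl /= uth aE cE.
Qed.

End ClosedRow.

Section IntervalRow.
Variables (b : bool) (lo m : nat).
Local Notation s := (Interval lo m).
Definition interval_swirl : R * R -> R * R := swirl b pi lo%:R (m%:R + 1).

Lemma interval_length_gt0 : 0 < m%:R + 1 :> R.
Proof. by rewrite ltr_wpDl // ler0n. Qed.

Lemma interval_turn u h : height_range b h -> width b h <> 0 -> in_range b s u h ->
  0 <= turn pi lo%:R (m%:R + 1) (u / width b h) <= pi.
Proof.
move=> hr w0 ur.
by apply: (turn_bounds (pi_gt0 R) interval_length_gt0 (width_gt0 hr w0)); rewrite addrA.
Qed.

Lemma interval_swirl_inj u u' h : height_range b h ->
  in_range b s u h -> in_range b s u' h ->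
  (interval_swirl (u, h)).1 = (interval_swirl (u', h)).1 -> u = u'.
Proof.
move=> hr ur ur' /= cE; have [w0|w0] := pselect (width b h = 0).
  by rewrite (width0_range ur w0) (width0_range ur' w0).
have rn0 : radius b h != 0 by apply/eqP => /(radius0_width hr).
have {}cE := mulfI rn0 cE.
have /cos_inj tE := cE; have := tE (interval_turn hr w0 ur) (interval_turn hr w0 ur').
move=> {}tE; have := @turn_eq _ pi lo%:R (m%:R + 1) (width b h) (pi_gt0 R)
  interval_length_gt0 (width_gt0 hr w0) u u' 0.
by rewrite tE !mul0r !addr0; apply.
Qed.

Lemma interval_swirl_ge0 u h : height_range b h -> in_range b s u h ->
  0 <= (interval_swirl (u, h)).2.
Proof.
move=> hr ur; have [w0|w0] := pselect (width b h = 0).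
  by rewrite /= (width0_radius w0) mul0r.
by apply: mulr_ge0; [exact: radius_ge0|apply/sin_ge0_pi/interval_turn].
Qed.

Lemma interval_swirl_surj a c h : height_range b h -> 0 <= c ->
  a ^+ 2 + c ^+ 2 = radius b h ^+ 2 ->
  exists2 u, in_range b s u h & interval_swirl (u, h) = (a, c).
Proof.
move=> hr c0 acE; have [w0|w0] := pselect (width b h = 0).
  exists 0; first by rewrite /in_range w0 !mulr0 lexx.
  have r0 := width0_radius w0; move: acE; rewrite r0 expr0n /= => /eqP.
  rewrite paddr_eq0 ?sqr_ge0 // !sqrf_eq0 => /andP[/eqP -> /eqP ->].
  by rewrite /interval_swirl /swirl /= r0 !mul0r.
have [th [/andP[th0 _] /(_ c0) thpi aE cE]] := polar_exists (radius_ge0 hr) (esym acE).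
have thA : 0 <= th <= pi by rewrite th0.
have [u ur uth] := turn_surj lo%:R (pi_gt0 R) interval_length_gt0 (width_gt0 hr w0) thA.
exists u; first by move: ur; rewrite addrA.
by rewrite /interval_swirl /swirl /= uth aE cE.
Qed.

End IntervalRow.

Lemma not_line_visible b s h : s <> Closed Inf -> visible b s h <-> height_range b h.
Proof. by move=> sI; split=> [[]//|hr]; split. Qed.

(** The triangles of a closed row surround the pole at the centre of the disc. *)
Lemma closed_row_disc n (n_gt0 : (0 < n)%N) :
  lies_on R (chain false (Closed (Fin n_gt0))) (closed_disc R).
Proof.
have vis h : visible false (Closed (Fin n_gt0)) h <-> 0 <= h <= 1 by apply: not_line_visible.
apply: (@lies_on_swept R false _ _ _ (closed_swirl false n)) => //.
- exact: swirl_cont.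
- move=> u h /vis/andP[h0 h1] _.
  have := swirl_norm false (pi *+ 2) 0 (n%:R * 2) (u, h).
  by rewrite /closed_disc /= => ->; rewrite expr_le1.
- move=> [a c]; rewrite /closed_disc /= => ac.
  pose h := Num.sqrt (a ^+ 2 + c ^+ 2).
  have h0 : 0 <= h by apply: sqrtr_ge0.
  have hr : height_range false h.
    by rewrite /height_range h0 /= -[leRHS]sqrtr1 ler_wsqrtr.
  have [|u ur uE] := @closed_swirl_surj false n n_gt0 a c h hr.
    by rewrite sqr_sqrtr // addr_ge0 ?sqr_ge0.
  by exists u, h; split; [exact/vis|exact: ur|exact: uE].
- move=> u h u' h' /vis hr ur /vis hr' ur'; split=> [E|[hh' hj]]; last first.
    rewrite -hh' in ur' *; exact: (@closed_swirl_inj false n n_gt0 u u' h hr ur ur').2 hj.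
  have [hh' _] := polar_eq (radius_ge0 (b := false) hr) (radius_ge0 (b := false) hr')
    (congr1 fst E) (congr1 snd E).
  rewrite /radius in hh'; split=> //; rewrite -hh' in ur' E.
  exact: (@closed_swirl_inj false n n_gt0 u u' h hr ur ur').1 E.
Qed.

(** With two poles each triangle becomes a sector between two meridians. *)
Lemma closed_row_sphere n (n_gt0 : (0 < n)%N) :
  lies_on R (chain true (Closed (Fin n_gt0))) (sphere R).
Proof.
have vis h : visible true (Closed (Fin n_gt0)) h <-> -1 <= h <= 1 by apply: not_line_visible.
apply: (@lies_on_swept R true _ _ _ (fun p => (closed_swirl true n p, p.2))) => //.
- by move=> p; apply: pair_continuous; [exact: swirl_cont|exact: snd_cont].
- move=> u h /vis hr _.
  have := swirl_norm true (pi *+ 2) 0 (n%:R * 2) (u, h).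
  by rewrite sqr_radius // /sphere /= => ->; rewrite subrK.
- move=> [[a c] h]; rewrite /sphere /= => ach.
  have hr : height_range true h.
    rewrite /height_range -ler_norml -(@ler_pXn2r _ 2) ?nnegrE // expr1n.
    by rewrite real_normK ?num_real // -ach lerDr addr_ge0 ?sqr_ge0.
  have [|u ur uE] := @closed_swirl_surj true n n_gt0 a c h hr.
    by rewrite sqr_radius // -ach addrK.
  by exists u, h; split; [exact/vis|exact: ur|rewrite uE].
- move=> u h u' h' /vis hr ur /vis hr' ur'; split=> [E|[hh' hj]]; last first.
    by rewrite -hh' in ur' *; congr pair; apply: (@closed_swirl_inj true n n_gt0 u u' h hr ur ur').2 hj.
  have hh' : h = h' by exact: (congr1 snd E).
  split=> //; rewrite -hh' in ur' E.
  exact: (@closed_swirl_inj true n n_gt0 u u' h hr ur ur').1 (congr1 fst E).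
Qed.

(** The triangles of a row with walls form a half disc with the pole at its
    centre; stretching the half disc vertically gives the disc. *)
Lemma interval_row_disc lo m : lies_on R (chain false (Interval lo m)) (closed_disc R).
Proof.
have vis h : visible false (Interval lo m) h <-> 0 <= h <= 1 by apply: not_line_visible.
pose stretch (z : R * R) := (z.1, 2 * z.2 - Num.sqrt (1 - z.1 ^+ 2)).
have sc : continuous stretch.
  move=> z; have c1 : {for z, continuous (fun z : R * R => 1 - z.1 ^+ 2)}.
    have c0 : {for z, continuous (fun z : R * R => z.1 * z.1)}.
      exact: contM (@fst_cont R z) (@fst_cont R z).
    exact: contB (@cst_continuous _ _ (1 : R) z) c0.
  have c2 : {for z, continuous (fun z : R * R => Num.sqrt (1 - z.1 ^+ 2))}.
    exact: (continuous_comp c1 (@sqrt_continuous R _)).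
  have c3 := contM (@cst_continuous _ _ (2 : R) z) (@snd_cont R z).
  exact: pair_continuous (@fst_cont R z) (contB c3 c2).
have stretch_disc (z : R * R) :
    0 <= z.2 -> z.1 ^+ 2 + z.2 ^+ 2 <= 1 -> closed_disc R (stretch z).
  case: z => a c /= c0 E; rewrite /closed_disc /=; set d := Num.sqrt _.
  have d0 : 0 <= d by apply: sqrtr_ge0.
  have d2 : d ^+ 2 = 1 - a ^+ 2 by rewrite sqr_sqrtr //; have sq := sqr_ge0 c; lra.
  have cd : c <= d by rewrite -(@ler_pXn2r _ 2) ?nnegrE // d2; lra.
  have cdc : 0 <= c * (d - c) by apply: mulr_ge0; lra.
  rewrite !expr2 in d2 *; nra.
apply: (@lies_on_swept R false _ _ _ (stretch \o interval_swirl false lo m)) => //.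
- by move=> p; apply: continuous_comp; [exact: swirl_cont|exact: sc].
- move=> u h /vis hr ur; apply: stretch_disc; first exact: (interval_swirl_ge0 (b := false) hr ur).
  rewrite (swirl_norm false pi lo%:R (m%:R + 1) (u, h)).
  by rewrite expr_le1; case/andP: hr.
- move=> [a z]; rewrite /closed_disc /= => az.
  pose d := Num.sqrt (1 - a ^+ 2).
  have d0 : 0 <= d by apply: sqrtr_ge0.
  have d2 : d ^+ 2 = 1 - a ^+ 2 by rewrite sqr_sqrtr //; have sq := sqr_ge0 z; lra.
  have /andP[z1 z2] : - d <= z <= d.
    by rewrite -ler_norml -(@ler_pXn2r _ 2) ?nnegrE // real_normK ?num_real // d2; lra.
  (* The vertical chord [-d, d] is the image of the chord [0, d] of the half disc. *)
  pose c := (z + d) / 2; have c0 : 0 <= c by rewrite /c; lra.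
  have cd : c <= d by rewrite /c; lra.
  pose h := Num.sqrt (a ^+ 2 + c ^+ 2).
  have h2 : h ^+ 2 = a ^+ 2 + c ^+ 2 by rewrite sqr_sqrtr // addr_ge0 ?sqr_ge0.
  have h0 : 0 <= h by apply: sqrtr_ge0.
  have hr : height_range false h.
    rewrite /height_range h0 /= -(@ler_pXn2r _ 2) ?nnegrE // expr1n h2.
    have cd2 : c ^+ 2 <= d ^+ 2 by rewrite ler_pXn2r ?nnegrE.
    by rewrite d2 in cd2; lra.
  have [u ur uE] := @interval_swirl_surj false lo m a c h hr c0 (esym h2).
  exists u, h; split; [exact/vis|exact: ur|].
  by rewrite /= uE /stretch /= -/d /c; congr pair; field.
- move=> u h u' h' /vis hr ur /vis hr' ur'; split=> [/= E|[<- [j ->]]]; last first.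
    by rewrite /period mulr0 mul0r addr0.
  have c1 := congr1 fst E; have c2 := congr1 snd E; rewrite /stretch /= in c1 c2.
  rewrite c1 in c2; have {}c2 : (interval_swirl false lo m (u, h)).2 =
    (interval_swirl false lo m (u', h')).2 by rewrite /=; lra.
  have [hh' _] := polar_eq (radius_ge0 (b := false) hr) (radius_ge0 (b := false) hr') c1 c2.
  rewrite /radius in hh'; split=> //; exists 0; rewrite !mul0r addr0.
  rewrite -hh' in ur' c1; exact: (@interval_swirl_inj false lo m u u' h hr ur ur' c1).
Qed.

(** With two poles the triangles of a row with walls form half a sphere, seen
    from the side as a disc. *)
Lemma interval_row_lune lo m : lies_on R (chain true (Interval lo m)) (closed_disc R).
Proof.
have vis h : visible true (Interval lo m) h <-> -1 <= h <= 1 by apply: not_line_visible.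
apply: (@lies_on_swept R true _ _ _ (fun p => ((interval_swirl true lo m p).1, p.2))) => //.
- move=> p.
  exact: pair_continuous (continuous_comp (@swirl_cont R true _ _ _ p) (@fst_cont R _)) (@snd_cont R p).
- move=> u h /vis hr _; rewrite /closed_disc.
  have := swirl_norm true pi lo%:R (m%:R + 1) (u, h).
  rewrite -/(interval_swirl true lo m) sqr_radius //.
  by case: (interval_swirl _ _ _ _) => a c /= E; have sq := sqr_ge0 c; lra.
- move=> [a h]; rewrite /closed_disc /= => ah.
  have hr : height_range true h.
    rewrite /height_range -ler_norml -(@ler_pXn2r _ 2) ?nnegrE // expr1n.
    by rewrite real_normK ?num_real //; have sq := sqr_ge0 a; lra.
  have [||u ur uE] := @interval_swirl_surj true lo m a (Num.sqrt (1 - a ^+ 2 - h ^+ 2)) h hr.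
  + exact: sqrtr_ge0.
  + by rewrite sqr_radius // sqr_sqrtr; lra.
  by exists u, h; split; [exact/vis|exact: ur|congr pair; exact: (congr1 fst uE)].
- move=> u h u' h' /vis hr ur /vis hr' ur'; split=> [E|[<- [j ->]]]; last first.
    by rewrite /period mulr0 mul0r addr0.
  have hh' : h = h' by exact: (congr1 snd E).
  split=> //; exists 0; rewrite !mul0r addr0; rewrite -hh' in ur' E.
  exact: (@interval_swirl_inj true lo m u u' h hr ur ur' (congr1 fst E)).
Qed.

End Surfaces.

Section Lines.
Variable R : realType.
Implicit Types (u h : R).

Lemma near_neq (T : topologicalType) (f : T -> R) (z : T) (c : R) :
  {for z, continuous f} -> f z != c -> \forall y \near z, f y != c.
Proof.
move=> cf fz; have cg : {for z, continuous (fun y => f y - c)}.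
  exact: contB cf (@cst_continuous _ _ c z).
have g0 : f z - c != 0 by rewrite subr_eq0.
by apply: filterS (cvgr_neq0 _ cg g0) => y; rewrite subr_eq0.
Qed.

(** A continuous inverse bounds u from above and the width from below. *)
Lemma proper_inverse b s (X : topologicalType) (Q : R * R -> X) (z0 : X) (U H : X -> R) :
  {for z0, continuous U} -> {for z0, continuous H} -> 0 < width b (H z0) ->
  (\forall z \near z0, forall u h, visible b s h -> in_range b s u h -> Q (u, h) = z ->
     u = U z /\ h = H z) ->
  exists c d : R, 0 < d /\ \forall z \near z0,
    forall u h, visible b s h -> in_range b s u h -> Q (u, h) = z ->
    d <= width b h /\ `|u| <= c.
Proof.
move=> cU cH w0 near0; exists (`|U z0| + 1), (width b (H z0) / 2); split; first by lra.
have cW : {for z0, continuous (fun z => width b (H z))}.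
  exact: (continuous_comp cH (@width_cont R b _)).
have cN : {for z0, continuous (fun z => `|U z|)}.
  exact: (continuous_comp cU (@norm_continuous _ _ _)).
have nW : \forall z \near z0, width b (H z0) / 2 < width b (H z).
  by apply: (cvgr_gt _ cW); lra.
have nU : \forall z \near z0, `|U z| < `|U z0| + 1.
  by apply: (cvgr_lt _ cN); lra.
near=> z => u h vh ur zE.
have [-> ->] : u = U z /\ h = H z by apply: (near near0 z).
by split; apply: ltW; [apply: (near nW z)|apply: (near nU z)].
Unshelve. all: by end_near.
Qed.

Lemma no_period j u u' w : u = u' + (j * period (Closed Inf))%:~R * w -> u = u'.
Proof. by rewrite /period mulr0 mul0r addr0. Qed.

(** The Cayley transform of the point (u / h, 1 / h - 1) of the closed upper half
    plane.  Each triangle becomes a vertical strip going up to infinity, where the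
    pole is, and infinity goes to the boundary point (1, 0) of the disc. *)
Definition cayley (p : R * R) : R * R :=
  (1 - 2 * p.2 / (1 + p.1 ^+ 2), - (2 * p.2 * p.1 / (1 + p.1 ^+ 2))).

Definition cayley_u (z : R * R) : R := - z.2 / (1 - z.1).
Definition cayley_h (z : R * R) : R := (1 - z.1) * (1 + cayley_u z ^+ 2) / 2.

Lemma sqr1_gt0 (x : R) : 0 < 1 + x ^+ 2.
Proof. by have sq := sqr_ge0 x; lra. Qed.

Lemma cayley_cont : continuous cayley.
Proof.
move=> p; have n0 : 1 + p.1 ^+ 2 != 0 by rewrite gt_eqF // sqr1_gt0.
have c0 : {for p, continuous (fun p : R * R => p.1 * p.1)}.
  exact: contM (@fst_cont R p) (@fst_cont R p).
have c1 : {for p, continuous (fun p : R * R => 1 + p.1 ^+ 2)}.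
  exact: contD (@cst_continuous _ _ (1 : R) p) c0.
have c2 : {for p, continuous (fun p : R * R => (1 + p.1 ^+ 2)^-1)}.
  exact: (@continuousV _ _ (fun p : R * R => 1 + p.1 ^+ 2) p n0 c1).
have c3 : {for p, continuous (fun p : R * R => 2 * p.2)}.
  exact: contM (@cst_continuous _ _ (2 : R) p) (@snd_cont R p).
apply: (pair_continuous (contB (@cst_continuous _ _ (1 : R) p) (contM c3 c2))).
exact: continuousN (contM (contM c3 (@fst_cont R p)) c2).
Qed.

Lemma cayleyK u h : h <> 0 -> cayley_u (cayley (u, h)) = u /\ cayley_h (cayley (u, h)) = h.
Proof.
move=> /eqP h0; have u0 : 1 + u ^+ 2 != 0 by rewrite gt_eqF // sqr1_gt0.
have uE : cayley_u (cayley (u, h)) = u.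
  by rewrite /cayley_u /cayley /= opprK subKr; field; rewrite u0 h0.
by split=> //; rewrite /cayley_h uE /cayley /= subKr; field.
Qed.

Lemma cayley_pole u h : (cayley (u, h)).1 = 1 -> h = 0.
Proof.
move=> /= E; have u0 : 1 + u ^+ 2 != 0 by rewrite gt_eqF // sqr1_gt0.
have : 2 * h / (1 + u ^+ 2) = 0 by lra.
by move/eqP; rewrite mulf_eq0 invr_eq0 (negPf u0) orbF mulf_eq0 pnatr_eq0 /= => /eqP.
Qed.

Lemma cayley_u_cont z : z.1 != 1 -> {for z, continuous cayley_u}.
Proof.
move=> z1; have n0 : 1 - z.1 != 0 by rewrite subr_eq0 eq_sym.
have c1 := contB (@cst_continuous _ _ (1 : R) z) (@fst_cont R z).
exact: contM (continuousN (@snd_cont R z)) (@continuousV _ _ (fun z : R * R => 1 - z.1) z n0 c1).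
Qed.

Lemma cayley_h_cont z : z.1 != 1 -> {for z, continuous cayley_h}.
Proof.
move=> z1; have cu := cayley_u_cont z1.
have c1 := contB (@cst_continuous _ _ (1 : R) z) (@fst_cont R z).
have c2 : {for z, continuous (fun z => cayley_u z ^+ 2)} by exact: (contM cu cu).
have c3 := contM c1 (contD (@cst_continuous _ _ (1 : R) z) c2).
exact: contM c3 (@cst_continuous _ _ (2 : R)^-1 z).
Qed.

Lemma line_disc : lies_on R (chain false (Closed Inf)) (closed_disc R).
Proof.
have vis h : visible false (Closed Inf) h <-> 0 <= h <= 1 by split=> [[]//|hr]; split.
apply: (@lies_on_swept R false _ _ _ cayley) => //.
- exact: cayley_cont.
- move=> u h /vis/andP[h0 h1] _; rewrite /closed_disc /=; have u0 := sqr1_gt0 u.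
  have -> : (1 - 2 * h / (1 + u ^+ 2)) ^+ 2 + (- (2 * h * u / (1 + u ^+ 2))) ^+ 2 =
      1 - 4 * (h * (1 - h)) / (1 + u ^+ 2) by field; rewrite gt_eqF.
  by rewrite gerBl divr_ge0 ?(ltW u0) // mulr_ge0 // mulr_ge0 ?subr_ge0.
- move=> [a c]; rewrite /closed_disc /= => ac; have [a1|a1] := eqVneq a 1.
    have c0 : c = 0.
      apply/eqP; rewrite -sqrf_eq0; apply/eqP; rewrite a1 expr1n in ac.
      by have sq := sqr_ge0 c; lra.
    exists 0, 0; split; [by apply/vis; rewrite lexx ler01|by []|].
    by rewrite /cayley /= a1 c0; congr pair; field.
  have d0 : 0 < 1 - a.
    have aa : a <= 1.
      rewrite leNgt; apply/negP => a_gt1; have sq := sqr_ge0 c.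
      by rewrite expr2 in ac; nra.
    by rewrite subr_gt0 lt_neqAle a1.
  have d_neq0 : 1 - a != 0 by rewrite gt_eqF.
  exists (cayley_u (a, c)), (cayley_h (a, c)).
  have u0 := sqr1_gt0 (cayley_u (a, c)).
  have u_neq0 : 1 + cayley_u (a, c) ^+ 2 != 0 by rewrite gt_eqF.
  have h0 : 0 < cayley_h (a, c) by rewrite /cayley_h divr_gt0 // mulr_gt0.
  split.
  + apply/vis; rewrite ltW //=.
    have -> : cayley_h (a, c) = ((1 - a) ^+ 2 + c ^+ 2) / (2 * (1 - a)).
      by rewrite /cayley_h /cayley_u /=; field.
    rewrite ler_pdivrMr ?mulr_gt0 // mul1r !expr2; rewrite !expr2 in ac; lra.
  + by rewrite /in_range /width => h00; move: h0; rewrite h00 ltxx.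
  + rewrite /cayley /=; congr pair.
      by rewrite /cayley_h /=; field.
    have -> : 2 * cayley_h (a, c) * cayley_u (a, c) / (1 + cayley_u (a, c) ^+ 2) =
        (1 - a) * cayley_u (a, c) by rewrite /cayley_h /=; field.
    by rewrite /cayley_u /=; field.
- move=> u h u' h' _ ur _ ur'; split=> [E|[<- [j /no_period ->]]//].
  have [h0|h0] := pselect (h = 0).
    have h0' : h' = 0.
      by apply: (@cayley_pole u' h'); rewrite -E /= h0 mulr0 mul0r subr0.
    by split; [rewrite h0|exists 0; rewrite (ur h0) (ur' h0') !mul0r addr0].
  have h0' : h' <> 0.
    by move=> h0'; apply: h0; apply: (@cayley_pole u h); rewrite E /= h0' mulr0 mul0r subr0.
  have [uE hE] := cayleyK u h0; have [uE' hE'] := cayleyK u' h0'.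
  rewrite E in uE hE; split; first by rewrite -hE hE'.
  by exists 0; rewrite !mul0r addr0 -uE uE'.
- move=> _ u h /vis/andP[hh0 _] ur h0; have [uE hE] := cayleyK u h0.
  have z1 : (cayley (u, h)).1 != 1 by apply/eqP => /cayley_pole.
  apply: (@proper_inverse _ _ _ _ _ cayley_u cayley_h).
  + exact: cayley_u_cont.
  + exact: cayley_h_cont.
  + by rewrite hE /width lt_neqAle hh0 eq_sym andbT; apply/eqP.
  have near1 : \forall z \near cayley (u, h), z.1 != 1.
    exact: near_neq (@fst_cont R _) z1.
  apply: filterS near1 => z z1' u' h' _ ur' zE.
  have h0' : h' <> 0.
    by move=> h0'; case/eqP: z1'; rewrite -zE /= h0' mulr0 mul0r subr0.
  by have [] := cayleyK u' h0'; rewrite zE.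
Qed.

End Lines.

Local Arguments width {R} b h : simpl never.

Section LineSphere.
Variable R : realType.
Implicit Types (u h : R).

(** The inverse stereographic projection of the point (u / w, h / w) of the plane.
    Each triangle becomes a vertical strip, infinite in both directions; its upper
    end is the vertex, at the top of the sphere, and its lower end is the ideal
    point at the centre of the face. *)
Definition stereo (p : R * R) : R * R * R :=
  let w := width true p.2 in let d := w ^+ 2 + p.1 ^+ 2 + p.2 ^+ 2 in
  ((2 * p.1 * w / d, 2 * p.2 * w / d), (p.1 ^+ 2 + p.2 ^+ 2 - w ^+ 2) / d).

Definition stereo_h (z : R * R * R) : R :=
  let y := z.1.2 / (1 - z.2) in y / (1 + `|y|).

Definition stereo_u (z : R * R * R) : R :=
  z.1.1 / (1 - z.2) * width true (stereo_h z).

Lemma stereo_denom_gt0 u h : 0 < width true h ^+ 2 + u ^+ 2 + h ^+ 2.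
Proof.
have u2 := sqr_ge0 u; have h2 := sqr_ge0 h; have w2 := sqr_ge0 (width true h).
have [h0|h0] := eqVneq h 0.
  by rewrite h0 /width normr0 subr0 expr1n; lra.
have h2' : 0 < h ^+ 2 by rewrite exprn_even_gt0.
lra.
Qed.

Lemma stereo_sphere p : sphere R (stereo p).
Proof.
case: p => u h; rewrite /sphere /stereo /=; have := stereo_denom_gt0 u h.
by rewrite /width => d0; field; rewrite gt_eqF.
Qed.

Lemma sqr_cont (T : topologicalType) (f : T -> R) x :
  {for x, continuous f} -> {for x, continuous (fun y => f y ^+ 2)}.
Proof. by move=> cf; exact (contM cf cf). Qed.

Lemma stereo_cont : continuous stereo.
Proof.
move=> p; have wc : {for p, continuous (fun p : R * R => width true p.2)}.
  exact: (continuous_comp (@snd_cont R p) (@width_cont R true _)).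
have uc := @fst_cont R p; have hc := @snd_cont R p.
have dc := contD (contD (sqr_cont wc) (sqr_cont uc)) (sqr_cont hc).
have d0 : width true p.2 ^+ 2 + p.1 ^+ 2 + p.2 ^+ 2 != 0.
  by rewrite gt_eqF // stereo_denom_gt0.
have ic := @continuousV _ _ (fun p : R * R => width true p.2 ^+ 2 + p.1 ^+ 2 + p.2 ^+ 2) p d0 dc.
have c2 := @cst_continuous (R * R)%type R 2 p.
apply: (pair_continuous (pair_continuous (contM (contM (contM c2 uc) wc) ic)
  (contM (contM (contM c2 hc) wc) ic))).
exact: contM (contB (contD (sqr_cont uc) (sqr_cont hc)) (sqr_cont wc)) ic.
Qed.

Lemma stereo_top u h : 1 - (stereo (u, h)).2 =
  2 * width true h ^+ 2 / (width true h ^+ 2 + u ^+ 2 + h ^+ 2).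
Proof.
rewrite /stereo /=; have := stereo_denom_gt0 u h.
by rewrite /width => d0; field; rewrite gt_eqF.
Qed.

Lemma stereo_pole u h : (stereo (u, h)).2 = 1 <-> width true h = 0.
Proof.
have d0 := stereo_denom_gt0 u h; split=> [z1|w0].
  have := stereo_top u h; rewrite z1 subrr => /esym/eqP.
  rewrite mulf_eq0 invr_eq0 (gt_eqF d0) orbF mulf_eq0 pnatr_eq0 /= sqrf_eq0.
  by move/eqP.
by have := stereo_top u h; rewrite w0 expr0n /= mulr0 mul0r; lra.
Qed.

Lemma stereoK u h : 0 < width true h ->
  stereo_u (stereo (u, h)) = u /\ stereo_h (stereo (u, h)) = h.
Proof.
move=> w0; have d0 := stereo_denom_gt0 u h.
have wn0 : width true h != 0 by rewrite gt_eqF.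
have yE : (stereo (u, h)).1.2 / (1 - (stereo (u, h)).2) = h / width true h.
  rewrite stereo_top /=; move: d0 wn0; rewrite /width => d0 wn0.
  by field; rewrite wn0 gt_eqF.
have xE : (stereo (u, h)).1.1 / (1 - (stereo (u, h)).2) = u / width true h.
  rewrite stereo_top /=; move: d0 wn0; rewrite /width => d0 wn0.
  by field; rewrite wn0 gt_eqF.
have hE : stereo_h (stereo (u, h)) = h.
  rewrite /stereo_h yE normrM normfV (gtr0_norm w0).
  have -> : 1 + `|h| / width true h = (width true h)^-1.
    by rewrite -[X in X + _](mulfV wn0) -mulrDl /width subrK mul1r.
  by rewrite invrK divfK.
by split=> //; rewrite /stereo_u hE xE divfK.
Qed.

Lemma stereo_coord_cont z : z.2 != 1 ->
  {for z, continuous (fun z : R * R * R => z.1.1 / (1 - z.2))} /\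
  {for z, continuous (fun z : R * R * R => z.1.2 / (1 - z.2))}.
Proof.
move=> z1; have n0 : 1 - z.2 != 0 by rewrite subr_eq0 eq_sym.
have c1 : {for z, continuous (fun z : R * R * R => z.1)} by apply: cvg_fst.
have c2 : {for z, continuous (fun z : R * R * R => z.2)} by apply: cvg_snd.
have ic := @continuousV _ _ (fun z : R * R * R => 1 - z.2) z n0
  (contB (@cst_continuous _ _ (1 : R) z) c2).
split; first exact: contM (continuous_comp c1 (@fst_cont R _)) ic.
exact: contM (continuous_comp c1 (@snd_cont R _)) ic.
Qed.

Lemma stereo_h_cont z : z.2 != 1 -> {for z, continuous stereo_h}.
Proof.
move=> /stereo_coord_cont[_ yc].
have nc := continuous_comp yc (@norm_continuous R R _).
have kc := contD (@cst_continuous _ _ (1 : R) z) nc.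
have k0 : 1 + `|z.1.2 / (1 - z.2)| != 0.
  by rewrite gt_eqF // ltr_wpDr // ltr01.
exact: contM yc (@continuousV _ _ (fun z : R * R * R => 1 + `|z.1.2 / (1 - z.2)|) z k0 kc).
Qed.

Lemma stereo_u_cont z : z.2 != 1 -> {for z, continuous stereo_u}.
Proof.
move=> z1; have [xc _] := stereo_coord_cont z1.
exact: contM xc (continuous_comp (stereo_h_cont z1) (@width_cont R true _)).
Qed.

Lemma stereo_surj z : sphere R z -> z.2 != 1 ->
  [/\ -1 < stereo_h z < 1, 0 < width true (stereo_h z) & stereo (stereo_u z, stereo_h z) = z].
Proof.
case: z => [[a c] e]; rewrite /sphere /= => ace e1.
have e0 : 1 - e != 0 by rewrite subr_eq0 eq_sym.
rewrite /stereo_u /stereo_h /=; set x := a / (1 - e); set y := c / (1 - e).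
have k0 : 0 < 1 + `|y| by have := normr_ge0 y; lra.
have kn0 : 1 + `|y| != 0 by rewrite gt_eqF.
set h := y / (1 + `|y|).
have hn : `|h| = `|y| / (1 + `|y|) by rewrite normrM normfV (gtr0_norm k0).
have wE : width true h = (1 + `|y|)^-1 by rewrite /width hn; field.
have w0 : 0 < width true h by rewrite wE invr_gt0.
split=> //; first by rewrite -ltr_norml hn ltr_pdivrMr // mul1r; lra.
rewrite /stereo /= wE /h; move: (1 + `|y|) kn0 => k kn0.
have sE : 1 + x ^+ 2 + y ^+ 2 = 2 / (1 - e).
  have -> : 1 + x ^+ 2 + y ^+ 2 = ((1 - e) ^+ 2 + (a ^+ 2 + c ^+ 2)) / (1 - e) ^+ 2.
    by rewrite /x /y; field.
  have -> : a ^+ 2 + c ^+ 2 = 1 - e ^+ 2 by lra.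
  by field.
have dE : k^-1 ^+ 2 + (x * k^-1) ^+ 2 + (y / k) ^+ 2 = 2 / (1 - e) / k ^+ 2.
  by rewrite -sE; field.
rewrite dE; congr (_, _, _).
- by rewrite /x; field; rewrite kn0 e0.
- by rewrite /y; field; rewrite kn0 e0.
have -> : (x * k^-1) ^+ 2 + (y / k) ^+ 2 - k^-1 ^+ 2 = (2 / (1 - e) - 2) / k ^+ 2.
  by rewrite -sE; field.
by field; rewrite kn0 e0.
Qed.

Lemma line_sphere : lies_on R (chain true (Closed Inf)) (sphere R).
Proof.
have vis h : visible true (Closed Inf) h <-> -1 < h <= 1.
  rewrite /visible /height_range; split=> [[/andP[h1 h2] /(_ isT erefl)/eqP hN1]|/andP[h1 h2]].
    by rewrite lt_neqAle eq_sym hN1 h1.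
  by split=> [|_ _ hE]; [rewrite ltW|rewrite hE ltxx in h1].
have vis_pole h : visible true (Closed Inf) h -> width true h = 0 -> h = 1.
  move=> /vis/andP[h1 h2]; rewrite /width => /eqP; rewrite subr_eq0 eq_sym eqr_norml ler01 andbT.
  by case/orP=> /eqP // hE; rewrite hE ltxx in h1.
have vis_width h : visible true (Closed Inf) h -> width true h <> 0 -> 0 < width true h.
  by move=> [hr _]; apply: width_gt0.
apply: (@lies_on_swept R true _ _ _ stereo) => //.
- exact: stereo_cont.
- by move=> u h _ _; apply: stereo_sphere.
- move=> z zS; have [z1|z1] := eqVneq z.2 1.
    exists 0, 1; split; [by apply/vis; apply/andP; split; lra|by []|].
    case: z z1 zS => [[a c] e] /= ->; rewrite /sphere /= expr1n => ac.
    have [a0 c0] : a = 0 /\ c = 0.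
      have /eqP : a ^+ 2 + c ^+ 2 = 0 by lra.
      by rewrite paddr_eq0 ?sqr_ge0 // !sqrf_eq0 => /andP[/eqP -> /eqP ->].
    rewrite a0 c0 /stereo /width normr1 subrr; by rewrite !expr0n expr1n /= !mulr0 !mul0r !add0r subr0 divr1.
  have [/andP[h1 h2] w0 zE] := stereo_surj zS z1.
  exists (stereo_u z), (stereo_h z); split=> //; first by apply/vis; rewrite h1 ltW.
  by rewrite /in_range => wE; rewrite wE ltxx in w0.
- move=> u h u' h' vh ur vh' ur'; split=> [E|[<- [j /no_period ->]]//].
  have [w0|w0] := pselect (width true h = 0).
    have w0' : width true h' = 0 by apply/(stereo_pole u'); rewrite -E; apply/stereo_pole.
    split; first by rewrite (vis_pole h) // (vis_pole h').
    by exists 0; rewrite (ur w0) (ur' w0') !mul0r addr0.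
  have w0' : width true h' <> 0.
    by move=> w0'; apply: w0; apply/(stereo_pole u); rewrite E; apply/stereo_pole.
  have [uE hE] := stereoK u (vis_width h vh w0).
  have [uE' hE'] := stereoK u' (vis_width h' vh' w0').
  rewrite E in uE hE; split; first by rewrite -hE hE'.
  by exists 0; rewrite !mul0r addr0 -uE uE'.
- move=> _ u h vh ur w0; have [uE hE] := stereoK u (vis_width h vh w0).
  have z1 : (stereo (u, h)).2 != 1 by apply/eqP => /stereo_pole.
  apply: (@proper_inverse _ _ _ _ _ _ stereo_u stereo_h).
  + exact: stereo_u_cont.
  + exact: stereo_h_cont.
  + by rewrite hE; apply: vis_width.
  have near1 : \forall z \near stereo (u, h), z.2 != 1.
    by apply: near_neq z1; apply: cvg_snd.
  apply: filterS near1 => z z1' u' h' vh' _ zE.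
  have w0' : width true h' <> 0.
    by move=> w0'; case/eqP: z1'; rewrite -zE; apply/stereo_pole.
  by have [] := stereoK u' (vis_width h' vh' w0'); rewrite zE.
Qed.

End LineSphere.

(** * Transport along isomorphisms, and the theorem *)

Lemma glue_iso (R : realType) (M M' : Map) (f : M -> M') (x : M) (t : 'rV[R]_3) :
  equivariant f -> glue_orbit (f x) t = f @` glue_orbit x t.
Proof.
move=> fe; apply/seteqP; split=> [_ [g tg <-]|_ [_ [g tg <-] <-]].
  by exists (act x g); [exists g|rewrite fe].
by exists g; rewrite ?fe.
Qed.

Lemma lies_on_iso (R : realType) (M M' : Map) (X : topologicalType) (S : set X) :
  isomorphic M M' -> lies_on R M S -> lies_on R M' S.
Proof.
move=> [f [[g fK gK] fe]] [p [pc pS pi po]].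
have ge : equivariant g by move=> y h; apply: (can_inj fK); rewrite fe !gK.
have glueE (y z : M') (t : 'rV[R]_3) : glue_orbit (g y) t (g z) <-> glue_orbit y t z.
  rewrite (glue_iso y t ge); split=> [[z' yz /(can_inj gK) <-]//|yz].
  by exists z.
have fin (y : M') (t : 'rV[R]_3) : finite_set (glue_orbit (g y) t) <-> finite_set (glue_orbit y t).
  split=> h; last by rewrite (glue_iso y t ge); apply: finite_image.
  by rewrite -[y]gK (glue_iso (g y) t fe); apply: finite_image.
have ordE (y : M') : ordinary (g y) = ordinary y :> set 'rV[R]_3.
  by apply/seteqP; split=> t [st /fin ft].
have realE (y : M') : realised (g y) = realised y :> set 'rV[R]_3.
  by apply/seteqP; split=> t [st ft]; split=> // /ft/fin.
exists (fun y => p (g y)); split.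
- by move=> y; rewrite -realE; apply: pc.
- rewrite -pS; apply/seteqP; split=> [_ [y _ [t yt <-]]|_ [x _ [t xt <-]]].
    by exists (g y) => //; exists t; rewrite ?realE.
  by exists (f x) => //; exists t; rewrite -?realE ?fK.
- by move=> y z s t; rewrite -!realE => ys zt; rewrite pi // glueE.
move=> W Wo Wg; have [|x y t|O oO WE] := po (W \o f).
- by move=> x /=; rewrite -{2}[x]fK ordE; apply: Wo.
- by move=> /= Wt xy; apply: Wg Wt _; apply/glueE; rewrite !fK.
exists O => //; rewrite -WE; apply/seteqP; split=> [_ [y _ [t Wt <-]]|_ [x _ [t Wt <-]]].
  by exists (g y) => //; exists t => //=; rewrite gK.
by exists (f x) => //; exists t => //; rewrite fK.
Qed.

Lemma named_map_surface (R : realType) c :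
  match c with
  | nAcirc _ => lies_on R (named_map c) (sphere R)
  | _ => lies_on R (named_map c) (closed_disc R)
  end.
Proof.
have iso := model_iso c.
case: c iso => [[n n_gt0|]|[n n_gt0|]||||||] iso; apply: lies_on_iso iso _.
- exact: closed_row_disc.
- exact: line_disc.
- exact: closed_row_sphere.
- exact: line_sphere.
- exact: interval_row_disc.
- exact: interval_row_disc.
- exact: interval_row_lune.
- exact: interval_row_disc.
- exact: interval_row_disc.
- exact: interval_row_lune.
Qed.

Local Close Scope ring_scope.
Local Close Scope group_scope.
Local Close Scope classical_set_scope.

Theorem theorem19p1 (R : realType) :
  [/\ forall M : Map,
        (edge_transitive M /\ has_free_edge M) <->
        (exists c : map_name, isomorphic M (named_map c)),
      forall c d : map_name, isomorphic (named_map c) (named_map d) -> c = d,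
      forall c : map_name,
        in_class (match c with
                  | nM2star0 => N2star
                  | nM2P0 => N2P
                  | _ => N1
                  end) (named_map c),
      forall c : map_name,
        match c with
        | nAcirc _ => lies_on R (named_map c) (sphere R)
        | _ => lies_on R (named_map c) (closed_disc R)
        end &
      forall c : map_name,
        match c with
        | nN1 => forall f : Aut (named_map c), f = 1%g
        | _ => exists n : xnat, isogroup (Aut (named_map c)) (dihedral n)
        end].
Proof.
split.
- exact: edge_transitive_free_classification.
- exact: named_map_inj.
- exact: named_map_class.
- exact: named_map_surface.
- exact: named_map_aut.
Qed.
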